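(* Let $a\in\mathbb{R}$, $\omega_{av}\in\mathbb{R}$ and $\sigma>1$, and let $\eta_m=\min(1,\sigma-1/2)$. There exists $\epsilon>0$ such that for every $\omega_0\in L^2$ with zero mean and $\|\omega_0\|_{L^2}<\epsilon$, and for every $\eta$ with $1/2<\eta<\eta_m$, the initial value problem $$\omega_t+a\,u\,\omega_x=\omega\,\mathcal{H}(\omega)+\omega_{av}\,\mathcal{H}(\omega)-\Lambda^\sigma\omega,\qquad u_x=\mathcal{H}(\omega),\qquad \omega(\cdot,0)=\omega_0,$$ for $x\in\mathbb{S}$, $t>0$, has a unique solution $\omega$ in $X^\eta_\infty$.
   Context: $\mathbb{S}$ is the circle, i.e. $[-\pi,\pi]$ with periodic boundary conditions; functions are real-valued; $L^2=L^2[-\pi,\pi]$. For periodic $f$, $\hat f(k)$, $k\in\mathbb{Z}$, are its Fourier coefficients. $\mathcal{H}$ is the periodic Hilbert transform, with Fourier symbol $-i\,\mathrm{sgn}(k)$ (zero at $k=0$). $\Lambda^\sigma$ is the Fourier multiplier with symbol $|k|^\sigma$. The function $u$ is determined by $u_x=\mathcal{H}(\omega)$ and the requirement that $u$ has zero mean. The unknown $\omega$ has zero mean. The homogeneous Sobolev norm is $\|f\|_{\dot H^s}^2=\sum_{k}|k|^{2s}|\hat f(k)|^2$. The space $X^\eta_\infty$ (for given $\sigma>0$, $\eta>0$) is $$X^\eta_\infty=\Big\{\omega:\mathbb{S}\times[0,\infty)\to\mathbb{R}\ \Big|\ \omega\in L^\infty([0,\infty);L^2),\ \sup_{0<t<\infty}t^{\eta/\sigma}\|\omega\|_{\dot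 H^\eta}<\infty\Big\},$$ with norm $\max\big(\sup_{0<t<\infty}\|\omega\|_{L^2},\ \sup_{0<t<\infty}t^{\eta/\sigma}\|\omega\|_{\dot H^\eta}\big)$. Solutions of the initial value problem are understood in the Duhamel (mild) sense: $$\omega(\cdot,t)=e^{-t\mathcal{L}}\omega_0+\int_0^te^{-(t-\tau)\mathcal{L}}\,\mathbb{P}_0\big[(1+a)\,\omega\,\mathcal{H}(\omega)-a\,(u\omega)_x\big](\cdot,\tau)\,d\tau ,$$ where $e^{-t\mathcal{L}}$ is the Fourier multiplier with symbol $e^{-t|k|^\sigma-it\,\omega_{av}\,\mathrm{sgn}(k)}$ and $\mathbb{P}_0$ is the projection that removes the mean of a periodic function. *)

(* Defs.v *)
From mathcomp Require Import all_boot all_order all_algebra.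
From mathcomp Require Import all_classical all_reals all_analysis.
From mathcomp Require Import complex.

Set Implicit Arguments.
Unset Strict Implicit.
Unset Printing Implicit Defensive.

Import Order.TTheory GRing.Theory Num.Theory.
Import numFieldNormedType.Exports.

Local Open Scope classical_set_scope.
Local Open Scope ring_scope.
Local Open Scope complex_scope.

(* A function on the circle is a function R -> R considered up to equality
   almost everywhere for [circle_measure]; apart from measurability, its values
   outside [-pi, pi] are irrelevant.  A function of (x, t) is curried with the
   time variable first. *)

Section Circle.
Variable R : realType.
Implicit Types (f g h u : R -> R) (w : R -> R -> R) (c : int -> R[i]).
Implicit Types (a omega_av sigma s eta t tau : R) (k : int).

Definition circle_measure : {measure set (measurableTypeR R) -> \bar R} :=
  mrestr (@lebesgue_measure R) (measurable_itv `[- pi, pi]%R).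

Definition L2 : {pred R -> R} := Lfun circle_measure 2%:E.

Definition L2_norm f : \bar R := Lnorm circle_measure 2%:E (EFin \o f).

Definition zero_mean f := \int[circle_measure]_x f x = 0.

Definition cexp (z : R[i]) : R[i] :=
  (expR (complex.Re z))%:C * (cos (complex.Im z) +i* sin (complex.Im z)).

Definition Cintegral (mu : {measure set (measurableTypeR R) -> \bar R})
    (D : set R) (F : R -> R[i]) : R[i] :=
  (\int[mu]_(x in D) complex.Re (F x)) +i*
  (\int[mu]_(x in D) complex.Im (F x)).

Definition fourier f k : R[i] :=
  ((2 * pi)^-1)%:C *
  Cintegral circle_measure setT
    (fun x => (f x)%:C * cexp (0 +i* (- (k%:~R * x)))).

(* Fourier coefficients of the derivative of f as a periodic distribution *)
Definition fourier_dx f k : R[i] := (0 +i* k%:~R) * fourier f k.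

Definition normsqC (z : R[i]) : R := complex.Re z ^+ 2 + complex.Im z ^+ 2.

Definition l2_norm c : \bar R :=
  poweR (\esum_(k in [set: int]) (normsqC (c k))%:E) 2^-1.

Definition sobolev_norm s f : \bar R :=
  poweR (\esum_(k in [set: int])
           (powR `|k|%:~R (2 * s) * normsqC (fourier f k))%:E) 2^-1.

Definition is_hilbert f h :=
  h \in L2 /\ forall k, fourier h k = (0 +i* (- (sgz k)%:~R)) * fourier f k.

(* u_x = h, where h is the Hilbert transform of the vorticity *)
Definition is_velocity h u :=
  [/\ u \in L2, zero_mean u & forall k, fourier_dx u k = fourier h k].

Definition simple_L2 (v : R -> R -> R) :=
  exists n (A : 'I_n -> set R) (g : 'I_n -> R -> R),
    [/\ forall i, measurable (A i : set (measurableTypeR R)),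
        forall i, g i \in L2 &
        forall t x, v t x = \sum_(i < n) \1_(A i) t * g i x].

(* strong (Bochner) measurability of t |-> w(., t) from [0, oo[ to L^2 *)
Definition strongly_measurable w :=
  exists v : nat -> R -> R -> R, (forall n, simple_L2 (v n)) /\
    {ae @lebesgue_measure R, forall t, 0 <= t ->
       (fun n => L2_norm (v n t \- w t)) @ \oo --> 0%E}.

Definition in_Xinf sigma eta w :=
  [/\ forall t, 0 <= t -> w t \in L2,
      strongly_measurable w,
      (ereal_sup [set L2_norm (w t) | t in [set t : R | (0 < t)%R]] < +oo)%E &
      (ereal_sup [set (powR t (eta / sigma)%R)%:E * sobolev_norm eta (w t) |
                  t in [set t : R | (0 < t)%R]] < +oo)%E].

(* symbol of exp(- t L), where L = Lambda^sigma - omega_av H *)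
Definition semigroup_symbol sigma omega_av t k : R[i] :=
  cexp ((- (t * powR `|k|%:~R sigma)) +i* (- (t * omega_av * (sgz k)%:~R))).

Definition proj0 c : int -> R[i] := fun k => if k == 0 then 0 else c k.

(* Fourier coefficients of (1 + a) f h - a (u f)_x *)
Definition nonlinearity a f h u : int -> R[i] := fun k =>
  (1 + a)%:C * fourier (f \* h) k - a%:C * fourier_dx (u \* f) k.

(* Bochner integrability over D of an L^2-valued map F given by its Fourier
   coefficients: L^2 being separable, strong measurability is measurability
   of every coefficient (Pettis), and the norm is given, up to a
   constant factor, by Parseval. *)
Definition bochner_integrable (D : set R) (F : R -> int -> R[i]) :=
  (forall k,
     measurable_fun (D : set (measurableTypeR R))
       (fun tau => complex.Re (F tau k)) /\
     measurable_fun (D : set (measurableTypeR R))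
       (fun tau => complex.Im (F tau k))) /\
  (\int[@lebesgue_measure R]_(tau in D) l2_norm (F tau) < +oo)%E.

Definition duhamel_integrand a omega_av sigma w (h u : R -> R -> R) t
    : R -> int -> R[i] :=
  fun tau k => semigroup_symbol sigma omega_av (t - tau) k *
               proj0 (nonlinearity a (w tau) (h tau) (u tau)) k.

(* The Duhamel formula is an identity in L^2, written coefficient by
   coefficient. *)
Definition mild_solution a omega_av sigma (w0 : R -> R) w :=
  [/\ forall t, 0 <= t -> zero_mean (w t),
      w 0 = w0 %[ae circle_measure] &
      exists h u : R -> R -> R,
        (forall t, 0 < t -> is_hilbert (w t) (h t) /\
                            is_velocity (h t) (u t)) /\
        forall t, 0 < t ->
          let F := duhamel_integrand a omega_av sigma w h u t in
          bochner_integrable `]0, t[%classic F /\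
          forall k, fourier (w t) k =
            semigroup_symbol sigma omega_av t k * fourier w0 k +
            Cintegral (@lebesgue_measure R) `]0, t[%classic
              (fun tau => F tau k)].

End Circle.

Arguments L2 {R}.

(* Main.v *)
(* On the Fourier side the equation reads
     w_k(t) = S_k(t) c_k + int_0^t S_k(t - s) B(w(s), w(s))_k ds,
   with |B(v, w)_k| <= 2 (1 + |a|) |k| Q(|v|, |w|)_k and
   Q(X, Y)_k = sum_j (1 / |k| + 1 / |j|) X_j Y_(k - j), where 1 / 0 = 0; since
   1 / |j| is in l^2, Q is bounded on l^2, and since sigma > 1 the factor |k| is
   absorbed by the time integral of S_k.
   Existence: the weights E_k(t) = exp(|k| t^(1 / sigma) / 2) are submultiplicative
   in k, and their growth in t costs only half of the decay of S_k.  Hence the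
   Picard iterates, multiplied by E_k(t), are dominated by the iterates of the
   time-independent l^2 recursion Z = b + C Q(Z, Z), which converge for small
   data.  As t^(eta / sigma) |k|^eta <= 2 E_k(t) for every eta <= 1, the limit
   lies in X^eta for all these eta at once, whence the uniformity of epsilon.
   Uniqueness: a sup-in-time l^2 bound suffices.  The sum over k >= N of
   exp(- r k^sigma) has a small integral in r, so on short time intervals, whose
   length depends only on the l^2 bound, the difference of two solutions is at
   most half of any bound already known for it.  The assumption eta > 1/2 makes
   the Fourier series of w absolutely convergent, so that the coefficients of the
   products are given by B; finally the coefficients determine w a.e. *)

Require Import Defs.
From mathcomp Require Import all_boot all_order all_algebra.
From mathcomp Require Import all_classical all_reals all_analysis.
From mathcomp Require Import complex measurable_realfun ring lra.

Set Implicit Arguments.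
Unset Strict Implicit.
Unset Printing Implicit Defensive.

Import Order.TTheory GRing.Theory Num.Theory.
Import numFieldNormedType.Exports.
Import Normc.

Local Open Scope classical_set_scope.
Local Open Scope ring_scope.
Local Open Scope complex_scope.

(** * Sums over the integers *)

(** A contraction argument in X^eta itself would bring in time integrals whose constants depend on
    eta and on the singular weight at t = 0. Domination by a time-independent sequence avoids them:
    at each frequency the time integral of S_k contributes |k|^(- sigma) <= 1 / |k|, which pays for
    the factor |k| of the product. Moreover the increments of the Picard iterates are dominated by
    the increments of an increasing, bounded majorant sequence, so convergence follows from
    monotonicity and no Lipschitz constant is ever estimated. Uniqueness cannot reuse this scheme: a
    competing solution has an L^2 bound that need not be small, and it carries no exponential
    weight. Functions are recovered from coefficients by testing against polynomials in a
    trigonometric polynomial that single out an arc: vanishing coefficients make every primitive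
    vanish, and Lebesgue differentiation concludes. *)

Section IntegerSums.
Variable R : realType.
Implicit Types (f g : int -> R) (M N : R) (k : int) (s : seq int).

(** The range is -n, ..., n - 1, since [Negz i] is - (i + 1). *)
Definition psum f (n : nat) : R := \sum_(i < n) (f (Posz i) + f (Negz i)).
Definition zsum f : R := limn (psum f).
(** Testing all finite duplicate-free lists makes the bound independent of any order of summation,
    so that it passes directly to injective reindexings and to pointwise limits. *)
Definition ubsum f M := forall s, uniq s -> \sum_(k <- s) f k <= M.
Definition zsummable f := exists M, ubsum (fun k => `|f k|) M.

Definition range_int (n : nat) : seq int :=
  map Posz (iota 0 n) ++ map Negz (iota 0 n).

Lemma mem_range_int n k : (k \in range_int n) = (match k with Posz i => i < n | Negz i => i < n end)%N.
Proof.
rewrite mem_cat; case: k => i.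
  rewrite mem_map; last by move=> x y [].
  rewrite mem_iota add0n /=; case: (i < n)%N => //=.
  by apply/negbTE/negP => /mapP[].
rewrite [X in _ || X]mem_map; last by move=> x y [].
rewrite mem_iota add0n /=; case: (i < n)%N; rewrite ?orbT ?orbF //.
by apply/negbTE/negP => /mapP[].
Qed.

Lemma range_int_uniq n : uniq (range_int n).
Proof.
rewrite cat_uniq !map_inj_uniq ?iota_uniq ?andbT//; try by move=> x y [].
by apply/hasP => -[x /mapP[i _ ->] /mapP[]].
Qed.

Lemma psumE f n : psum f n = \sum_(k <- range_int n) f k.
Proof.
rewrite /psum big_split/= big_cat/= !big_map.
by rewrite -(big_mkord xpredT (f \o Posz)) -(big_mkord xpredT (f \o Negz)) /index_iota subn0.
Qed.

Lemma ubsum_psum f M n : ubsum f M -> psum f n <= M.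
Proof. by move=> fM; rewrite psumE; apply/fM/range_int_uniq. Qed.

Lemma ler_sum_sub f s1 s2 : (forall k, 0 <= f k) -> uniq s1 -> uniq s2 -> {subset s1 <= s2} ->
  \sum_(k <- s1) f k <= \sum_(k <- s2) f k.
Proof.
move=> f0 u1 u2 s12; have [s us2] : exists s, perm_eq s2 (s1 ++ s).
  exists [seq x <- s2 | x \notin s1].
  apply: uniq_perm => //.
    rewrite cat_uniq u1 filter_uniq// andbT/=.
    by apply/hasP => -[x]; rewrite mem_filter => /andP[/negP].
  move=> x; rewrite mem_cat mem_filter.
  by case: (boolP (x \in s1)) => // /s12 ->.
by rewrite (perm_big _ us2) big_cat/= lerDl sumr_ge0.
Qed.

Lemma sub_range_int s : exists n, {subset s <= range_int n}.
Proof.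
elim: s => [|k s [n IH]]; first by exists 0%N.
exists (maxn n (match k with Posz i => i.+1 | Negz i => i.+1 end)) => x.
rewrite inE => /orP[/eqP ->|/IH]; rewrite !mem_range_int.
  by case: k => i; rewrite leq_max leqnn orbT.
by case: x => i xn; rewrite leq_max xn.
Qed.

Lemma psum_ubsum f M : (forall k, 0 <= f k) -> (forall n, psum f n <= M) -> ubsum f M.
Proof.
move=> f0 fM s us; have [n sn] := sub_range_int s.
by apply: (le_trans (ler_sum_sub f0 us (range_int_uniq n) sn)); rewrite -psumE.
Qed.

Lemma ubsum_ge0 f M : ubsum f M -> 0 <= M.
Proof. by move=> /(_ [::] isT); rewrite big_nil. Qed.

Lemma le_ubsum f M N : ubsum f M -> M <= N -> ubsum f N.
Proof. by move=> fM MN s /fM /le_trans; apply. Qed.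

Lemma ubsum_le f g M : (forall k, f k <= g k) -> ubsum g M -> ubsum f M.
Proof. by move=> fg gM s us; apply: le_trans (gM s us); apply: ler_sum => i _. Qed.

Lemma ubsumD f g M N : ubsum f M -> ubsum g N -> ubsum (fun k => f k + g k) (M + N).
Proof. by move=> fM gN s us; rewrite big_split/= lerD ?fM ?gN. Qed.

Lemma ubsumZ c f M : 0 <= c -> ubsum f M -> ubsum (fun k => c * f k) (c * M).
Proof. by move=> c0 fM s us; rewrite -mulr_sumr ler_wpM2l ?fM. Qed.

Lemma ubsum_inj f M (h : int -> int) : injective h -> ubsum f M -> ubsum (f \o h) M.
Proof.
move=> hi fM s us; have := fM (map h s).
by rewrite map_inj_uniq// big_map => /(_ us).
Qed.

Lemma cvg_sum_seq (I : Type) (F : nat -> I -> R) (f : I -> R) (r : seq I) :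
  (forall i, F ^~ i @ \oo --> f i) ->
  (fun n => \sum_(i <- r) F n i) @ \oo --> \sum_(i <- r) f i.
Proof.
move=> Ff; elim: r => [|i r IH].
  by rewrite big_nil (_ : (fun n => _) = cst 0); [exact: cvg_cst|apply/funext => n; rewrite big_nil].
rewrite big_cons (_ : (fun n => _) = (fun n => F n i + \sum_(j <- r) F n j)).
  by apply: cvgD.
by apply/funext => n; rewrite big_cons.
Qed.

(** Fatou's lemma for sums: only finitely many terms are tested at a time. *)
Lemma ubsum_lim (F : nat -> int -> R) f M : (forall k, F ^~ k @ \oo --> f k) ->
  (forall n, ubsum (F n) M) -> ubsum f M.
Proof.
move=> Ff FM s us.
have cF : (fun n => \sum_(k <- s) F n k) @ \oo --> \sum_(k <- s) f k.
  exact: cvg_sum_seq.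
by apply: (cvgr_to_le cF); near=> n; exact: FM.
Unshelve. all: by end_near. Qed.

Lemma ubsum_pt f M k : (forall k, 0 <= f k) -> ubsum f M -> f k <= M.
Proof. by move=> f0 /(_ [:: k] isT); rewrite big_seq1. Qed.

Lemma psum_homo f : (forall k, 0 <= f k) -> {homo psum f : n m / (n <= m)%N >-> n <= m}.
Proof.
move=> f0 n m nm; rewrite !psumE; apply: ler_sum_sub; rewrite ?range_int_uniq//.
by move=> [] i; rewrite !mem_range_int => /leq_trans; apply.
Qed.

Lemma psum_cvg_ge0 f M : (forall k, 0 <= f k) -> ubsum f M -> cvgn (psum f).
Proof.
move=> f0 fM; apply: nondecreasing_is_cvgn; first exact: psum_homo.
by exists M => _ [n _ <-]; apply: ubsum_psum.
Qed.

Lemma zsum_cvg f : zsummable f -> psum f @ \oo --> zsum f.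
Proof.
move=> [M fM]; suff : cvgn (psum f) by [].
(* f is the difference of the nonnegative summable families |f| + f and |f|. *)
pose p k := `|f k| + f k.
have p0 k : 0 <= p k by rewrite /p; have := ler_norm (- f k); rewrite normrN; lra.
have pM : ubsum p (M + M).
  by apply: (ubsum_le _ (ubsumD fM fM)) => k; rewrite /p lerD2l ler_norm.
have -> : psum f = psum p - psum (fun k => `|f k|).
  apply/funext => n; rewrite !fctE /psum -sumrB; apply: eq_bigr => i _; rewrite /p; ring.
by apply: is_cvgB; [exact: psum_cvg_ge0 pM|exact: psum_cvg_ge0 fM].
Qed.

Lemma zsummable_le f g : (forall k, `|f k| <= g k) -> zsummable g -> zsummable f.
Proof.
move=> fg [M gM]; exists M; apply: ubsum_le gM => k.
exact: le_trans (fg k) (ler_norm _).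
Qed.

Lemma ubsum_zsummable f M : (forall k, 0 <= f k) -> ubsum f M -> zsummable f.
Proof. by move=> f0 fM; exists M; apply: ubsum_le fM => k; rewrite ger0_norm. Qed.

Lemma zsummableD f g : zsummable f -> zsummable g -> zsummable (fun k => f k + g k).
Proof.
move=> [M fM] [N gN]; exists (M + N).
by apply: ubsum_le (ubsumD fM gN) => k; exact: ler_normD.
Qed.

Lemma zsummableZ c f : zsummable f -> zsummable (fun k => c * f k).
Proof.
move=> [M fM]; exists (`|c| * M).
by apply: ubsum_le (ubsumZ (normr_ge0 c) fM) => k; rewrite normrM.
Qed.

Lemma zsummableN f : zsummable f -> zsummable (fun k => - f k).
Proof. by move=> [M fM]; exists M; apply: ubsum_le fM => k; rewrite normrN. Qed.

Lemma zsum_lim f l : psum f @ \oo --> l -> zsum f = l.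
Proof. by move=> fl; apply/cvg_lim. Qed.

Lemma zsumD f g : zsummable f -> zsummable g -> zsum (fun k => f k + g k) = zsum f + zsum g.
Proof.
move=> sf sg; apply: zsum_lim.
have -> : psum (fun k => f k + g k) = psum f \+ psum g.
  by apply/funext => n; rewrite /psum /= -big_split; apply: eq_bigr => i _; rewrite addrACA.
by apply: cvgD; exact: zsum_cvg.
Qed.

Lemma zsumZ c f : zsummable f -> zsum (fun k => c * f k) = c * zsum f.
Proof.
move=> sf; apply: zsum_lim.
have -> : psum (fun k => c * f k) = (fun n => c * psum f n).
  by apply/funext => n; rewrite /psum /= mulr_sumr; apply: eq_bigr => i _; rewrite mulrDr.
by apply: cvgMr; exact: zsum_cvg.
Qed.

Lemma zsumN f : zsummable f -> zsum (fun k => - f k) = - zsum f.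
Proof.
move=> sf; rewrite -mulN1r -zsumZ//; congr zsum.
by apply/funext => k; rewrite mulN1r.
Qed.

Lemma zsumB f g : zsummable f -> zsummable g -> zsum (fun k => f k - g k) = zsum f - zsum g.
Proof. by move=> sf sg; rewrite zsumD ?zsumN//; exact: zsummableN. Qed.

Lemma eq_zsum f g : f =1 g -> zsum f = zsum g.
Proof. by move=> /funext ->. Qed.

Lemma zsum_le_ub f M : zsummable f -> (forall n, psum f n <= M) -> zsum f <= M.
Proof. by move=> sf fM; apply: (cvgr_to_le (zsum_cvg sf)); near=> n; exact: fM.
Unshelve. all: by end_near. Qed.

Lemma ubsum_zsum f M : zsummable f -> ubsum f M -> zsum f <= M.
Proof. by move=> sf fM; apply: zsum_le_ub => // n; apply: ubsum_psum. Qed.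

Lemma zsum_ub f : (forall k, 0 <= f k) -> zsummable f -> ubsum f (zsum f).
Proof.
move=> f0 sf; apply: psum_ubsum => // n.
apply: (cvgr_to_ge (zsum_cvg sf)); near=> m; apply: psum_homo => //.
by near: m; exact: nbhs_infty_ge.
Unshelve. all: by end_near. Qed.

Lemma zsum_ge0 f : (forall k, 0 <= f k) -> zsummable f -> 0 <= zsum f.
Proof. by move=> f0 sf; apply: ubsum_ge0 (zsum_ub f0 sf). Qed.

Lemma ler_zsum f g : zsummable f -> zsummable g -> (forall k, f k <= g k) -> zsum f <= zsum g.
Proof.
move=> sf sg fg; rewrite -subr_ge0 -zsumB//; apply: zsum_ge0 => [k|]; first by rewrite subr_ge0.
by apply: zsummableD => //; exact: zsummableN.
Qed.

Lemma zsummable_norm f : zsummable f -> zsummable (fun k => `|f k|).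
Proof. by move=> [M fM]; exists M; apply: ubsum_le fM => k; rewrite normr_id. Qed.

Lemma ler_norm_zsum f : zsummable f -> `|zsum f| <= zsum (fun k => `|f k|).
Proof.
move=> sf; have sn := zsummable_norm sf; rewrite ler_norml; apply/andP; split.
  rewrite -zsumN//; apply: ler_zsum => // [|k]; first exact: zsummableN.
  by rewrite lerNl -normrN ler_norm.
by apply: ler_zsum => // k; exact: ler_norm.
Qed.

Lemma zsummable_inj f (h : int -> int) : injective h -> zsummable f -> zsummable (f \o h).
Proof. by move=> hi [M fM]; exists M; exact: (ubsum_inj hi fM). Qed.

(** For nonnegative terms, [ubsum_inj] along h and along its inverse gives both inequalities; the
    general case subtracts |f| from |f| + f. *)
Lemma zsum_reindex f (h : int -> int) : bijective h -> zsummable f -> zsum (f \o h) = zsum f.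
Proof.
move=> [h' hK h'K]; have hi := can_inj hK; have h'i := can_inj h'K.
suff pos g : (forall k, 0 <= g k) -> zsummable g -> zsum (g \o h) = zsum g.
  move=> sf; have sn := zsummable_norm sf.
  have sp := zsummableD sn sf.
  have sfh := zsummable_inj hi sf; have snh := zsummable_inj hi sn.
  have e1 : zsum ((fun k => `|f k| + f k) \o h) = zsum (fun k => `|f k|) + zsum f.
    rewrite pos// ?zsumD// => k.
    by rewrite -lerBlDr sub0r; have := ler_norm (- f k); rewrite normrN.
  move: e1; rewrite (_ : _ \o h = (fun k => ((fun k => `|f k|) \o h) k + (f \o h) k))//.
  rewrite zsumD// (pos (fun k => `|f k|))//; exact: addrI.
move=> g0 sg; have sgh := zsummable_inj hi sg; apply/eqP; rewrite eq_le; apply/andP; split.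
  by apply: ubsum_zsum => //; exact: ubsum_inj (zsum_ub g0 sg).
rewrite -[X in zsum X <= _](_ : (g \o h) \o h' = g); last first.
  by apply/funext => k /=; rewrite h'K.
apply: ubsum_zsum; first exact: zsummable_inj.
by apply: ubsum_inj => //; apply: zsum_ub => // k; exact: g0.
Qed.

Lemma zsum1 f k : (forall j, j != k -> f j = 0) -> zsum f = f k.
Proof.
move=> fk; apply: zsum_lim; have [n nk] := sub_range_int [:: k].
apply: cvg_near_cst; near=> m; rewrite psumE.
rewrite (bigD1_seq k) ?range_int_uniq//=; last first.
  have : (n <= m)%N by near: m; exact: nbhs_infty_ge.
  have := nk k (mem_head _ _); rewrite !mem_range_int; case: (k) => i; exact: leq_trans.
by rewrite big1 ?addr0// => j /fk.
Unshelve. all: by end_near. Qed.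

(** Outside a finite range the sum of F n is at most the tail of g, and inside it finitely many
    terms tend to 0. *)
Lemma ubsum_dominated (F : nat -> int -> R) g M : (forall n k, 0 <= F n k <= g k) ->
  ubsum g M -> (forall k, F ^~ k @ \oo --> 0) ->
  forall e, 0 < e -> \forall n \near \oo, ubsum (F n) e.
Proof.
move=> Fg gM F0 e e0.
have g0 k : 0 <= g k by have /andP[/le_trans] := Fg 0%N k; apply.
have F00 n k : 0 <= F n k by have /andP[] := Fg n k.
have sg := ubsum_zsummable g0 gM.
have : \forall m \near \oo, `|zsum g - psum g m| <= e / 2.
  by move/cvgrPdist_le : (zsum_cvg sg); apply; rewrite divr_gt0.
move=> [m _ /(_ m (leqnn m))] gm.
have : (fun n => psum (F n) m) @ \oo --> (0 : R).
  rewrite (_ : (fun n => _) = (fun n => \sum_(k <- range_int m) F n k)); last first.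
    by apply/funext => n; rewrite psumE.
  rewrite [X in _ --> X](_ : 0 = \sum_(k <- range_int m) 0); last by rewrite big1.
  exact: cvg_sum_seq.
move/cvgr0Pnorm_le => /(_ (e / 2)); rewrite divr_gt0// => /(_ isT) Fm.
near=> n; apply: psum_ubsum => // N.
have : psum (F n) m <= e / 2 by apply: le_trans (ler_norm _) _; near: n.
have N' : psum (F n) N <= psum (F n) (maxn N m) by apply: psum_homo; rewrite ?leq_maxl.
suff : psum (F n) (maxn N m) - psum (F n) m <= psum g (maxn N m) - psum g m.
  have : psum g (maxn N m) <= zsum g by apply: ubsum_psum; apply: zsum_ub.
  move: gm; rewrite ler_norml => /andP[_]; lra.
pose d k := g k - F n k.
have d0 k : 0 <= d k by rewrite subr_ge0; have /andP[] := Fg n k.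
have := @psum_homo d d0 m (maxn N m); rewrite leq_maxr => /(_ isT).
have dE q : psum d q = psum g q - psum (F n) q.
  by rewrite /psum -sumrB; apply: eq_bigr => i _; rewrite /d; ring.
rewrite !dE; lra.
Unshelve. all: by end_near. Qed.

(** Tannery's theorem: [ubsum_dominated] for |f - F n| with the majorant 2 g. *)
Lemma zsum_dominated (F : nat -> int -> R) f g : (forall n k, `|F n k| <= g k) ->
  zsummable g -> (forall k, F ^~ k @ \oo --> f k) -> zsum (F n) @[n --> \oo] --> zsum f.
Proof.
move=> Fg sg Ff.
have fg k : `|f k| <= g k.
  by apply: (cvgr_to_le (cvg_norm (Ff k))); near=> n; exact: Fg.
have sF n := zsummable_le (Fg n) sg; have sf := zsummable_le fg sg.
have g0 k : 0 <= g k := le_trans (normr_ge0 _) (fg k).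
have [M gM] := sg.
apply/cvgrPdist_le => e e0.
have : \forall n \near \oo, ubsum (fun k => `|f k - F n k|) e.
  apply: (@ubsum_dominated _ (fun k => 2 * g k) (2 * M)) => // [n k||k].
  - rewrite normr_ge0/=; apply: le_trans (ler_normB _ _) _.
    by have := fg k; have := Fg n k; lra.
  - by apply: ubsumZ => //; apply: ubsum_le gM => k; exact: ler_norm.
  - by apply/norm_cvg0P; rewrite -[X in _ --> X](subrr (f k)); apply: cvgB => //; exact: cvg_cst.
apply: filterS => n Fn; rewrite -zsumB//.
have sB : zsummable (fun k => f k - F n k) by apply: zsummableD => //; exact: zsummableN.
apply: le_trans (ler_norm_zsum sB) _; apply: ubsum_zsum => //.
exact: zsummable_norm.
Unshelve. all: by end_near. Qed.

(** Up to sign, the Fourier multiplier from the vorticity to the velocity; the convention 0^-1 = 0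
    builds in the zero mean of u. *)
Definition iv k : R := (`|k|%:~R)^-1.

Lemma iv_ge0 k : 0 <= iv k.
Proof. by rewrite invr_ge0 ler0z. Qed.

Lemma iv0 : iv 0 = 0.
Proof. by rewrite /iv normr0 invr0. Qed.

Lemma ivN k : iv (- k) = iv k.
Proof. by rewrite /iv normrN. Qed.

Lemma iv_Posz n : iv (Posz n) = n%:R^-1.
Proof. by []. Qed.

Lemma iv_Negz n : iv (Negz n) = n.+1%:R^-1.
Proof. by []. Qed.

(** The bound 1 / (n + 1)^2 <= 1 / n - 1 / (n + 1) telescopes to at most 2 on each side of 0. *)
Lemma ubsum_iv2 : ubsum (fun k => iv k ^+ 2) 4.
Proof.
apply: psum_ubsum => [k|n]; first exact: sqr_ge0.
have t m : \sum_(i < m) iv (Negz i) ^+ 2 <= 2.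
  case: m => [|m]; first by rewrite big_ord0.
  suff : \sum_(i < m.+1) iv (Negz i) ^+ 2 <= 2 - m.+1%:R^-1.
    by move/le_trans; apply; rewrite gerBl invr_ge0.
  elim: m => [|m IH]; first by rewrite big_ord1 iv_Negz invr1; lra.
  rewrite big_ord_recr/= iv_Negz; set a : R := m.+1%:R in IH *.
  have a0 : 0 < a by rewrite ltr0n.
  have -> : m.+2%:R = a + 1 :> R by rewrite /a -[m.+2]addn1 natrD.
  rewrite -subr_ge0; apply: le_trans (_ : 0 <= a^-1 * (a + 1)^-1 * (a + 1)^-1) _.
    by rewrite !mulr_ge0// invr_ge0; lra.
  rewrite [leLHS](_ : _ = 2 - (a + 1)^-1 - (2 - a^-1) - (a + 1)^-1 ^+ 2).
    by move: IH; move: (\sum_(i < m.+1) _) (a^-1) (_^-1) => u v w; lra.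
  by field; rewrite !gt_eqF// ltr_wpDr.
rewrite /psum big_split/= (_ : 4 = 2 + 2); last by ring.
apply: lerD; last exact: t.
case: n => [|n]; first by rewrite big_ord0.
rewrite big_ord_recl/= iv0 expr0n add0r; exact: t.
Qed.

End IntegerSums.

(** * Real-valued modulus of complex numbers *)

Section ComplexModulus.
Variable R : realType.
Implicit Types (z w : R[i]) (x y : R).

Definition cabs z : R := Num.sqrt (normsqC z).

Lemma normsqC_ge0 z : 0 <= normsqC z.
Proof. by rewrite addr_ge0 ?sqr_ge0. Qed.

Lemma cabs_sqr z : cabs z ^+ 2 = normsqC z.
Proof. by rewrite sqr_sqrtr ?normsqC_ge0. Qed.

Lemma cabs_ge0 z : 0 <= cabs z. Proof. exact: sqrtr_ge0. Qed.

Lemma cabsE z : cabs z = normc z. Proof. by case: z. Qed.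

Lemma cabsM z w : cabs (z * w) = cabs z * cabs w.
Proof. by rewrite !cabsE normcM. Qed.

Lemma cabsD z w : cabs (z + w) <= cabs z + cabs w.
Proof. by rewrite !cabsE; exact: le_normcD. Qed.

Lemma cabsN z : cabs (- z) = cabs z.
Proof. by rewrite !cabsE; exact: normcN. Qed.

Lemma cabsB z w : cabs (z - w) <= cabs z + cabs w.
Proof. by rewrite -(cabsN w) cabsD. Qed.

Lemma cabs0 : cabs 0 = 0.
Proof. by rewrite /cabs /normsqC /= expr0n addr0 sqrtr0. Qed.

Lemma cabs_eq0 z : cabs z = 0 -> z = 0.
Proof. by rewrite cabsE => /eq0_normc. Qed.

Lemma cabs_real x : cabs x%:C = `|x|.
Proof. by rewrite /cabs /normsqC /= expr0n addr0 sqrtr_sqr. Qed.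

Lemma cabs_imag x : cabs (0 +i* x) = `|x|.
Proof. by rewrite /cabs /normsqC /= expr0n add0r sqrtr_sqr. Qed.

Lemma Re_le_cabs z : `|complex.Re z| <= cabs z.
Proof. by rewrite -sqrtr_sqr ler_wsqrtr// lerDl sqr_ge0. Qed.

Lemma Im_le_cabs z : `|complex.Im z| <= cabs z.
Proof. by rewrite -sqrtr_sqr ler_wsqrtr// lerDr sqr_ge0. Qed.

Lemma cabs_le_ReIm z : cabs z <= `|complex.Re z| + `|complex.Im z|.
Proof.
case: z => x y /=; have -> : x +i* y = x%:C + (0 +i* y) by rewrite /= /real_complex_def; simpc.
by apply: le_trans (cabsD _ _) _; rewrite cabs_real cabs_imag.
Qed.

Lemma cReD z w : complex.Re (z + w) = complex.Re z + complex.Re w.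
Proof. by case: z; case: w. Qed.
Lemma cImD z w : complex.Im (z + w) = complex.Im z + complex.Im w.
Proof. by case: z; case: w. Qed.
Lemma cReN z : complex.Re (- z) = - complex.Re z.
Proof. by case: z. Qed.
Lemma cImN z : complex.Im (- z) = - complex.Im z.
Proof. by case: z. Qed.
Lemma cReM z w : complex.Re (z * w) = complex.Re z * complex.Re w - complex.Im z * complex.Im w.
Proof. by case: z; case: w. Qed.
Lemma cImM z w : complex.Im (z * w) = complex.Re z * complex.Im w + complex.Im z * complex.Re w.
Proof. by case: z => a b; case: w => c d. Qed.
Lemma complex_eq z w : complex.Re z = complex.Re w -> complex.Im z = complex.Im w -> z = w.
Proof. by case: z => ? ?; case: w => ? ? /= -> ->. Qed.
Lemma cReJ z : complex.Re z^* = complex.Re z.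
Proof. by case: z. Qed.
Lemma cImJ z : complex.Im z^* = - complex.Im z.
Proof. by case: z. Qed.

Lemma cJM z w : conjc (z * w) = conjc z * conjc w.
Proof. exact: rmorphM. Qed.

End ComplexModulus.

(** * Absolutely convergent complex series *)

Section ComplexSums.
Variable R : realType.
Implicit Types (c d : int -> R[i]) (z : R[i]).

Definition zsumC c : R[i] := zsum (fun k => complex.Re (c k)) +i* zsum (fun k => complex.Im (c k)).
Definition zsummableC c := zsummable (fun k => cabs (c k)).

Lemma zsummable_Re c : zsummableC c -> zsummable (fun k => complex.Re (c k)).
Proof. by apply: zsummable_le => k; exact: Re_le_cabs. Qed.

Lemma zsummable_Im c : zsummableC c -> zsummable (fun k => complex.Im (c k)).
Proof. by apply: zsummable_le => k; exact: Im_le_cabs. Qed.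

Lemma zsummableC_le c (g : int -> R) : (forall k, cabs (c k) <= g k) -> zsummable g -> zsummableC c.
Proof. by move=> cg; apply: zsummable_le => k; rewrite ger0_norm ?cabs_ge0. Qed.

Lemma eq_zsumC c d : c =1 d -> zsumC c = zsumC d.
Proof. by move=> /funext ->. Qed.

Lemma zsumCD c d : zsummableC c -> zsummableC d -> zsumC (fun k => c k + d k) = zsumC c + zsumC d.
Proof.
move=> sc sd; apply: complex_eq => /=.
- rewrite -zsumD; [|exact: zsummable_Re|exact: zsummable_Re].
  by apply: eq_zsum => k; rewrite cReD.
- rewrite -zsumD; [|exact: zsummable_Im|exact: zsummable_Im].
  by apply: eq_zsum => k; rewrite cImD.
Qed.

Lemma zsummableCZ z c : zsummableC c -> zsummableC (fun k => z * c k).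
Proof.
move=> sc; apply: (@zsummableC_le _ (fun k => cabs z * cabs (c k))) => [k|].
  by rewrite cabsM.
exact: zsummableZ.
Qed.

Lemma zsumCZ z c : zsummableC c -> zsumC (fun k => z * c k) = z * zsumC c.
Proof.
move=> sc; have sr := zsummable_Re sc; have si := zsummable_Im sc.
apply: complex_eq; rewrite ?cReM ?cImM /=; rewrite -!zsumZ// -?zsumB -?zsumD//; try exact: zsummableZ.
- by apply: eq_zsum => k; rewrite cReM.
- by apply: eq_zsum => k; rewrite cImM.
Qed.

Lemma zsummableCD c d : zsummableC c -> zsummableC d -> zsummableC (fun k => c k + d k).
Proof.
move=> sc sd; apply: zsummableC_le (zsummableD sc sd) => k; exact: cabsD.
Qed.

Lemma zsummableCN c : zsummableC c -> zsummableC (fun k => - c k).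
Proof. by apply: zsummableC_le => k; rewrite cabsN. Qed.

Lemma zsumCB c d : zsummableC c -> zsummableC d -> zsumC (fun k => c k - d k) = zsumC c - zsumC d.
Proof.
move=> sc sd; rewrite zsumCD//; last exact: zsummableCN.
congr (_ + _); rewrite -[RHS]mulN1r -zsumCZ//.
by apply: eq_zsumC => k; rewrite mulN1r.
Qed.

(** The factor 2 comes from treating the real and imaginary parts separately; it only enlarges
    constants. *)
Lemma cabs_zsumC c : zsummableC c -> cabs (zsumC c) <= 2 * zsum (fun k => cabs (c k)).
Proof.
move=> sc; apply: le_trans (cabs_le_ReIm _) _ => /=; rewrite mulr_natl mulr2n.
apply: lerD.
- apply: le_trans (ler_norm_zsum (zsummable_Re sc)) _; apply: ler_zsum => //.
    exact/zsummable_norm/zsummable_Re.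
  by move=> k; exact: Re_le_cabs.
- apply: le_trans (ler_norm_zsum (zsummable_Im sc)) _; apply: ler_zsum => //.
    exact/zsummable_norm/zsummable_Im.
  by move=> k; exact: Im_le_cabs.
Qed.

Lemma zsumC_conj c : zsummableC c -> zsumC (fun k => (c k)^*) = (zsumC c)^*.
Proof.
move=> sc; apply: complex_eq; rewrite ?cReJ ?cImJ /=.
  by apply: eq_zsum => k; rewrite cReJ.
by rewrite -zsumN; [apply: eq_zsum => k; rewrite cImJ|exact: zsummable_Im].
Qed.

Lemma zsumC_opp c : zsummableC c -> zsumC (fun k => c (- k)) = zsumC c.
Proof.
move=> sc; apply: complex_eq => /=.
  by rewrite -(zsum_reindex (inv_bij (@opprK int)) (zsummable_Re sc)).
by rewrite -(zsum_reindex (inv_bij (@opprK int)) (zsummable_Im sc)).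
Qed.

Lemma zsumC1 c k : (forall j, j != k -> c j = 0) -> zsumC c = c k.
Proof.
by move=> c0; apply: complex_eq => /=; rewrite (@zsum1 _ _ k)// => j /c0 ->.
Qed.

End ComplexSums.

(** * Weighted convolutions on sequence spaces *)

Section Convolution.
Variable R : realType.
Implicit Types (X Y U : int -> R) (A B M : R).

(** A bound on the l^2 norm rather than the norm itself, so that no infinite sum has to be formed
    and limits are covered by [ubsum_lim]. *)
Definition l2le X A := 0 <= A /\ ubsum (fun k => X k ^+ 2) (A ^+ 2).

Lemma l2le_le X Y A : (forall k, 0 <= X k <= Y k) -> l2le Y A -> l2le X A.
Proof.
move=> XY [A0 YA]; split => //; apply: ubsum_le YA => k.
by have /andP[X0 XYk] := XY k; rewrite lerXn2r ?nnegrE// (le_trans X0).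
Qed.

Lemma l2leW X A B : l2le X A -> A <= B -> l2le X B.
Proof.
move=> [A0 XA] AB; have B0 := le_trans A0 AB; split => //; apply: le_ubsum XA _.
by rewrite lerXn2r ?nnegrE.
Qed.

Lemma l2le_shift X A k : l2le X A -> l2le (fun j => X (k - j)) A.
Proof.
move=> [A0 XA]; split => //.
by apply: (ubsum_inj (h := fun j => k - j)) XA => i j /addrI /oppr_inj.
Qed.

Lemma l2le_iv : l2le (iv R) 2.
Proof. by split => //; rewrite (_ : 2 ^+ 2 = 4); [exact: ubsum_iv2|ring]. Qed.

Lemma l2le_pt X A k : (forall k, 0 <= X k) -> l2le X A -> X k <= A.
Proof.
move=> X0 [A0 XA]; rewrite -(@ler_pXn2r _ 2)// ?nnegrE//.
by apply: (@ubsum_pt _ (fun k => X k ^+ 2)) => // j; exact: sqr_ge0.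
Qed.

(** Termwise AM-GM for X / A and Y / B; the cases A = 0 and B = 0, where a factor vanishes
    identically, are split off first. *)
Lemma cauchy_schwarz X Y A B : (forall k, 0 <= X k) -> (forall k, 0 <= Y k) ->
  l2le X A -> l2le Y B -> ubsum (fun k => X k * Y k) (A * B).
Proof.
move=> X0 Y0 XA YB; have [A0 sX] := XA; have [B0 sY] := YB.
have [A0'|A1] := eqVneq A 0.
  move=> s us; rewrite big1 ?mulr_ge0// => k _.
  by have := l2le_pt k X0 XA; rewrite A0' => Xk; rewrite (@le_anti _ _ (X k) 0) ?mul0r// Xk X0.
have [B0'|B1] := eqVneq B 0.
  move=> s us; rewrite big1 ?mulr_ge0// => k _.
  by have := l2le_pt k Y0 YB; rewrite B0' => Yk; rewrite (@le_anti _ _ (Y k) 0) ?mulr0// Yk Y0.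
have {A1} Ap : 0 < A by rewrite lt_neqAle eq_sym A1.
have {B1} Bp : 0 < B by rewrite lt_neqAle eq_sym B1.
have h : ubsum (fun k => A * B / 2 * (A ^- 2 * X k ^+ 2 + B ^- 2 * Y k ^+ 2))
   (A * B / 2 * (A ^- 2 * A ^+ 2 + B ^- 2 * B ^+ 2)).
  apply: ubsumZ; first by rewrite divr_ge0// mulr_ge0.
  by apply: ubsumD; apply: ubsumZ => //; rewrite invr_ge0 exprn_ge0.
have -> : A * B = A * B / 2 * (A ^- 2 * A ^+ 2 + B ^- 2 * B ^+ 2).
  by field; rewrite !gt_eqF.
apply: ubsum_le h => k; rewrite -subr_ge0.
rewrite [leRHS](_ : _ = A * B / 2 * (X k / A - Y k / B) ^+ 2).
  by rewrite mulr_ge0 ?sqr_ge0// divr_ge0// mulr_ge0.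
by field; rewrite !gt_eqF.
Qed.

(** Young's inequality from l^1 and l^2 to l^2. Cauchy-Schwarz with the weight U bounds the square
    of a truncated convolution by M times the sum of U_j X_(k - j)^2, which is summed over k first;
    [ubsum_lim] removes the truncation. *)
Lemma young X U M B : (forall k, 0 <= U k) -> (forall k, 0 <= X k) ->
  ubsum U M -> l2le X B -> l2le (fun k => zsum (fun j => U j * X (k - j))) (M * B).
Proof.
move=> U0 X0 UM XB; have [B0 sX] := XB; have M0 := ubsum_ge0 UM.
split; first exact: mulr_ge0.
have sUX k : zsummable (fun j => U j * X (k - j)).
  apply: (@ubsum_zsummable _ _ (B * M)) => [j|]; first exact: mulr_ge0.
  apply: ubsum_le (ubsumZ B0 UM) => j; rewrite mulrC ler_wpM2r//; exact: l2le_pt.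
apply: (@ubsum_lim _ (fun n k => psum (fun j => U j * X (k - j)) n ^+ 2)) => [k|n].
  by under eq_fun do rewrite expr2; rewrite expr2; apply: cvgM; exact: zsum_cvg.
move=> s us.
have st k : psum (fun j => U j * X (k - j)) n ^+ 2 <= M * \sum_(j <- range_int n) U j * X (k - j) ^+ 2.
  rewrite psumE; set S := \sum_(j <- _) _.
  have S0 : 0 <= S by apply: sumr_ge0 => j _; rewrite mulr_ge0.
  have [M00|M1] := eqVneq M 0.
    rewrite /S big1 ?expr0n ?M00 ?mul0r// => j _.
    have := ubsum_pt j U0 UM; rewrite M00 => Uj.
    by rewrite (@le_anti _ _ (U j) 0) ?mul0r// Uj U0.
  have Mp : 0 < M by rewrite lt_neqAle eq_sym M1.
  (* Cauchy-Schwarz in expanded form: the sum over j of U_j M (X_(k - j) - S / M)^2 is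
     nonnegative. *)
  have : 2 * S ^+ 2 <= M * (\sum_(j <- range_int n) U j * X (k - j) ^+ 2) + S ^+ 2.
    have -> : 2 * S ^+ 2 = \sum_(j <- range_int n) (2 * S * (U j * X (k - j))).
      by rewrite -mulr_sumr -/S expr2 mulrA.
    have := UM _ (range_int_uniq n) => hU.
    apply: (@le_trans _ _ (M * (\sum_(j <- range_int n) U j * X (k - j) ^+ 2) +
       \sum_(j <- range_int n) U j * (S ^+ 2 / M))).
      rewrite mulr_sumr -big_split/=; apply: ler_sum => j _.
      rewrite -subr_ge0 [leRHS](_ : _ = U j * M * (X (k - j) - S / M) ^+ 2).
        apply: mulr_ge0 (sqr_ge0 _); exact: mulr_ge0.
      by field; rewrite gt_eqF.
    rewrite lerD2l -mulr_suml; apply: le_trans (ler_wpM2r _ hU) _.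
      by rewrite divr_ge0 ?sqr_ge0.
    by rewrite mulrCA divff ?mulr1// gt_eqF.
  by lra.
apply: le_trans (ler_sum _ (fun k _ => st k)) _.
rewrite -mulr_sumr exprMn expr2 -mulrA ler_wpM2l// exchange_big/=.
apply: (@le_trans _ _ (\sum_(j <- range_int n) U j * B ^+ 2)).
  apply: ler_sum => j _; rewrite -mulr_sumr ler_wpM2l//.
  have : ubsum ((fun k => X k ^+ 2) \o (fun k => k - j)) (B ^+ 2).
    by apply: ubsum_inj sX => x y /addIr.
  by move/(_ s us).
by rewrite -mulr_suml ler_wpM2r ?sqr_ge0// UM// range_int_uniq.
Qed.

Lemma iv_le1 k : iv R k <= 1.
Proof.
rewrite /iv; have [->|k0] := eqVneq k 0; first by rewrite normr0 invr0.
by rewrite invf_le1 ?ltr0z ?normr_gt0// ler1z -gtz0_ge1 normr_gt0.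
Qed.

(** After a factor |k| is taken out, 1 / |k| accounts for the undifferentiated product of the
    vorticity with its Hilbert transform and 1 / |j| for the transport term. *)
Definition Qterm X Y (k j : int) := (iv R k + iv R j) * X j * Y (k - j).
Definition Qconv X Y k : R := zsum (Qterm X Y k).

Section Qconv.
Variables (X Y : int -> R) (A B : R).
Hypotheses (X0 : forall k, 0 <= X k) (Y0 : forall k, 0 <= Y k) (XA : l2le X A) (YB : l2le Y B).

Lemma Qterm_ge0 k j : 0 <= Qterm X Y k j.
Proof. by rewrite !mulr_ge0// addr_ge0// iv_ge0. Qed.

Lemma ubsum_Qterm k : ubsum (Qterm X Y k) (2 * (A * B)).
Proof.
apply: ubsum_le (ubsumZ (ler0n _ 2) (cauchy_schwarz X0 _ XA (l2le_shift k YB))) => j; last by [].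
rewrite /Qterm -mulrA ler_wpM2r ?mulr_ge0//.
by have := iv_le1 k; have := iv_le1 j; lra.
Qed.

Lemma Qterm_summable k : zsummable (Qterm X Y k).
Proof. exact: ubsum_zsummable (Qterm_ge0 k) (ubsum_Qterm k). Qed.

Lemma Qconv_ge0 k : 0 <= Qconv X Y k.
Proof. exact: zsum_ge0 (Qterm_ge0 k) (Qterm_summable k). Qed.

(** The two parts of Q contribute 2 A B each: in the first, 1 / |k| is in l^2 and multiplies a
    convolution bounded by A B; in the second, X_j / |j| is in l^1 with norm at most 2 A and [young]
    applies. *)
Lemma l2le_Qconv : l2le (Qconv X Y) (4 * (A * B)).
Proof.
have [A0 _] := XA; have [B0 _] := YB.
have AB0 : 0 <= A * B by exact: mulr_ge0.
have iX0 j : 0 <= iv R j * X j by rewrite mulr_ge0 ?iv_ge0.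
have iX : ubsum (fun j => iv R j * X j) (2 * A).
  by apply: cauchy_schwarz => //; [exact: iv_ge0|exact: l2le_iv].
have [_ yng] := young iX0 Y0 iX YB.
have XY0 k j : 0 <= X j * Y (k - j) by exact: mulr_ge0.
have sXY k : ubsum (fun j => X j * Y (k - j)) (A * B).
  exact: (cauchy_schwarz X0 _ XA (l2le_shift k YB)).
have sI k : zsummable (fun j => iv R j * X j * Y (k - j)).
  apply: (zsummable_le _ (Qterm_summable k)) => j.
  rewrite ger0_norm ?mulr_ge0// ?iv_ge0// /Qterm -!mulrA ler_wpM2r//.
  by rewrite lerDr iv_ge0.
have QE k : Qconv X Y k = iv R k * zsum (fun j => X j * Y (k - j)) +
    zsum (fun j => iv R j * X j * Y (k - j)).
  rewrite -zsumZ; last exact: ubsum_zsummable (sXY k).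
  rewrite -zsumD//; last exact/zsummableZ/ubsum_zsummable/sXY.
  by apply: eq_zsum => j; rewrite /Qterm; ring.
split; first by rewrite mulr_ge0.
have h := ubsumD (ubsumZ (mulr_ge0 (ler0n _ 2) (sqr_ge0 (A * B))) (ubsum_iv2 R))
  (ubsumZ (ler0n _ 2) yng).
have -> : (4 * (A * B)) ^+ 2 = 2 * (A * B) ^+ 2 * 4 + 2 * (2 * A * B) ^+ 2 by ring.
apply: ubsum_le h => k; rewrite QE.
set p := zsum (fun j => X j * _); set q := zsum _.
have p0 : 0 <= p by apply: zsum_ge0 => //; exact: ubsum_zsummable (sXY k).
have pAB : p <= A * B by apply: ubsum_zsum => //; exact: ubsum_zsummable (sXY k).
have : (iv R k * p) ^+ 2 <= (A * B) ^+ 2 * iv R k ^+ 2.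
  by rewrite exprMn mulrC ler_wpM2r ?sqr_ge0// lerXn2r ?nnegrE.
have := sqr_ge0 (iv R k * p - q); move: (iv R k) => i; nra.
Qed.

End Qconv.

Lemma ler_Qconv X Y X' Y' A B k : (forall k, 0 <= X k <= X' k) -> (forall k, 0 <= Y k <= Y' k) ->
  l2le X' A -> l2le Y' B -> Qconv X Y k <= Qconv X' Y' k.
Proof.
move=> XX' YY' XA YB.
have X0 j : 0 <= X j by have /andP[] := XX' j.
have Y0 j : 0 <= Y j by have /andP[] := YY' j.
have X'0 j : 0 <= X' j by have /andP[/le_trans] := XX' j; apply.
have Y'0 j : 0 <= Y' j by have /andP[/le_trans] := YY' j; apply.
apply: ler_zsum; first exact: (Qterm_summable X0 Y0 (l2le_le XX' XA) (l2le_le YY' YB)).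
  exact: (Qterm_summable X'0 Y'0 XA YB).
move=> j; rewrite /Qterm -!mulrA ler_wpM2l ?addr_ge0 ?iv_ge0//.
by apply: ler_pM => //; [have /andP[] := XX' j|have /andP[] := YY' (k - j)].
Qed.

Lemma QconvB X X' A k : (forall k, 0 <= X k <= X' k) -> l2le X' A ->
  Qconv X' X' k - Qconv X X k =
  Qconv (fun j => X' j - X j) X' k + Qconv X (fun j => X' j - X j) k.
Proof.
move=> XX' XA.
have X0 j : 0 <= X j by have /andP[] := XX' j.
have X'0 j : 0 <= X' j by have /andP[/le_trans] := XX' j; apply.
have D j : 0 <= X' j - X j <= X' j.
  by have /andP[? ?] := XX' j; rewrite subr_ge0 gerBl; apply/andP; split.
have D0 j : 0 <= X' j - X j by have /andP[] := D j.
have lX := l2le_le XX' XA; have lD := l2le_le D XA.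
rewrite /Qconv -zsumB; [|exact: (Qterm_summable X'0 X'0 XA XA)|exact: (Qterm_summable X0 X0 lX lX)].
rewrite -zsumD; [|exact: (Qterm_summable D0 X'0 lD XA)|exact: (Qterm_summable X0 D0 lX lD)].
by apply: eq_zsum => j; rewrite /Qterm; ring.
Qed.

End Convolution.

(** * The bilinear form of the nonlinearity on Fourier coefficients *)

Section BilinearForm.
Variables (R : realType) (a : R).
Implicit Types (v w : int -> R[i]) (X Y : int -> R) (A B M : R) (k j : int).

(* With h and u the Hilbert transform and the velocity of w, the k-th Fourier
   coefficient of (1 + a) w h - a (u w)_x is the sum over j of
   [msym k j * w_j * w_(k - j)]; indeed h_j = - i sgn(j) w_j, u_j = - w_j / |j|. *)
Definition msym k j : R[i] := 0 +i* (a * k%:~R * iv R j - (1 + a) * (sgz j)%:~R).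

Definition Bterm v w k j := msym k j * v j * w (k - j).
Definition Bq v w k : R[i] := zsumC (Bterm v w k).

Definition Ba : R := 1 + `|a|.

Lemma Ba_ge0 : 0 <= Ba. Proof. by rewrite addr_ge0. Qed.

Lemma mulr_iv k : k != 0 -> `|k|%:~R * iv R k = 1.
Proof. by move=> k0; rewrite divff// intr_eq0 normr_eq0. Qed.

Lemma cabs_msym k j : k != 0 -> cabs (msym k j) <= Ba * `|k|%:~R * (iv R k + iv R j).
Proof.
move=> k0; rewrite cabs_imag; apply: le_trans (ler_normB _ _) _.
have -> : Ba * `|k|%:~R * (iv R k + iv R j) = Ba + Ba * `|k|%:~R * iv R j.
  by rewrite mulrDr; congr (_ + _); rewrite -mulrA (mulr_iv k0) mulr1.
rewrite !normrM addrC; apply: lerD.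
  rewrite -[leRHS]mulr1.
  apply: ler_pM => //; first by rewrite (le_trans (ler_normD _ _))// normr1.
  by case: j => [[|n]|n] /=; rewrite ?normr0 ?normrN ?normr1.
rewrite (ger0_norm (iv_ge0 _ _)) -intr_norm ler_wpM2r ?iv_ge0// ler_wpM2r ?ler0z//.
by rewrite /Ba lerDr.
Qed.

Section Weighted.
Variables (e : int -> R) (X Y : int -> R) (A B : R).
Hypotheses (e_gt0 : forall k, 0 < e k) (e_sub : forall k j, e k <= e j * e (k - j)).
Hypotheses (XA : l2le X A) (YB : l2le Y B).
Variables (v w : int -> R[i]).
Hypotheses (vX : forall k, e k * cabs (v k) <= X k) (wY : forall k, e k * cabs (w k) <= Y k).

Let X0 k : 0 <= X k.
Proof. by apply: le_trans (vX k); rewrite mulr_ge0 ?cabs_ge0// ltW. Qed.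
Let Y0 k : 0 <= Y k.
Proof. by apply: le_trans (wY k); rewrite mulr_ge0 ?cabs_ge0// ltW. Qed.

(** Since e_k <= e_j e_(k - j), the weight distributes over the two factors and weighted sequences
    obey the unweighted estimate. The constant weight 1 gives the version used for uniqueness. *)
Lemma cabs_Bterm k j : k != 0 ->
  e k * cabs (Bterm v w k j) <= Ba * `|k|%:~R * Qterm X Y k j.
Proof.
move=> k0; rewrite !cabsM.
apply: (@le_trans _ _ (cabs (msym k j) * ((e j * cabs (v j)) * (e (k - j) * cabs (w (k - j)))))).
  rewrite -mulrA mulrCA ler_wpM2l ?cabs_ge0// [leRHS]mulrACA ler_wpM2r//.
  by rewrite mulr_ge0 ?cabs_ge0.
apply: (@le_trans _ _ (cabs (msym k j) * (X j * Y (k - j)))).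
  rewrite ler_wpM2l ?cabs_ge0// ler_pM// mulr_ge0 ?cabs_ge0// ltW//.
rewrite /Qterm -mulrA mulrA -mulrA; apply: le_trans (ler_wpM2r _ (cabs_msym j k0)) _.
  by rewrite mulr_ge0.
by rewrite !mulrA.
Qed.

Lemma Bterm_summable k : k != 0 -> zsummableC (Bterm v w k).
Proof.
move=> k0; apply: (@zsummableC_le _ _ (fun j => (e k)^-1 * (Ba * `|k|%:~R) * Qterm X Y k j)).
  move=> j; rewrite -mulrA -ler_pdivrMl ?invr_gt0// invrK; exact: cabs_Bterm.
exact: zsummableZ (Qterm_summable X0 Y0 XA YB k).
Qed.

Lemma cabs_Bq k : k != 0 -> e k * cabs (Bq v w k) <= 2 * Ba * `|k|%:~R * Qconv X Y k.
Proof.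
move=> k0; have sB := Bterm_summable k0; have sQ := Qterm_summable X0 Y0 XA YB k.
apply: le_trans (ler_wpM2l (ltW (e_gt0 k)) (cabs_zsumC sB)) _.
rewrite mulrCA -!mulrA ler_wpM2l// mulrA -!zsumZ//; apply: ler_zsum.
- exact: zsummableZ.
- exact: zsummableZ.
- by move=> j; exact: cabs_Bterm.
Qed.

End Weighted.

Lemma BqB v w v' w' A k : k != 0 ->
  l2le (fun k => cabs (v k)) A -> l2le (fun k => cabs (w k)) A ->
  l2le (fun k => cabs (v' k)) A -> l2le (fun k => cabs (w' k)) A ->
  Bq v w k - Bq v' w' k = Bq (fun j => v j - v' j) w k + Bq v' (fun j => w j - w' j) k.
Proof.
move=> k0 vA wA v'A w'A.
have s v1 w1 : l2le (fun k => cabs (v1 k)) A -> l2le (fun k => cabs (w1 k)) A ->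
    zsummableC (Bterm v1 w1 k).
  move=> h1 h2; apply: (@Bterm_summable (fun=> 1) _ _ A A _ _ h1 h2) => // [l j|l|l].
  - by rewrite mulr1.
  - by rewrite mul1r.
  - by rewrite mul1r.
have E v1 w1 v2 w2 : zsummableC (Bterm v1 w1 k) -> zsummableC (Bterm v2 w2 k) ->
    Bq v1 w1 k - Bq v2 w2 k = zsumC (fun j => Bterm v1 w1 k j - Bterm v2 w2 k j).
  by move=> s1 s2; rewrite zsumCB.
rewrite (_ : Bq v w k - Bq v' w' k = (Bq v w k - Bq v' w k) + (Bq v' w k - Bq v' w' k)); last first.
  by rewrite addrA subrK.
congr (_ + _); rewrite E; try exact: s.
  by apply: eq_zsumC => j; rewrite /Bterm mulrBr mulrBl.
by apply: eq_zsumC => j; rewrite /Bterm mulrBr.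
Qed.

Lemma msym_opp k j : msym (- k) (- j) = (msym k j)^*.
Proof.
apply: complex_eq; rewrite ?cReJ ?cImJ//= ivN sgzN !rmorphN/=; ring.
Qed.

(** Replacing j by -j conjugates each term, so the iterates remain coefficients of real
    functions. *)
Lemma Bq_opp v w A k : k != 0 ->
  l2le (fun k => cabs (v k)) A -> l2le (fun k => cabs (w k)) A ->
  (forall j, v (- j) = (v j)^*) -> (forall j, w (- j) = (w j)^*) ->
  Bq v w (- k) = (Bq v w k)^*.
Proof.
move=> k0 vA wA vJ wJ.
have s : zsummableC (Bterm v w k).
  apply: (@Bterm_summable (fun=> 1) _ _ A A _ _ vA wA) => // [l j|l|l].
  - by rewrite mulr1.
  - by rewrite mul1r.
  - by rewrite mul1r.
have sN : zsummableC (Bterm v w (- k)).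
  apply: (@Bterm_summable (fun=> 1) _ _ A A _ _ vA wA) => // [l j|l|l|].
  - by rewrite mulr1.
  - by rewrite mul1r.
  - by rewrite mul1r.
  - by rewrite oppr_eq0.
rewrite /Bq -zsumC_opp// -zsumC_conj//; apply: eq_zsumC => j.
rewrite /Bterm !rmorphM/= msym_opp vJ -wJ; congr (_ * w _).
by rewrite opprB opprK addrC.
Qed.

End BilinearForm.

(** * The time-independent majorant recursion in l^2 *)

Section Majorants.
Variables (R : realType) (b : int -> R) (C beta : R).
Hypotheses (b0 : forall k, 0 <= b k) (C0 : 0 <= C) (b_beta : l2le b beta).
Hypothesis small : 16 * C * beta <= 1.

Fixpoint majorant (n : nat) (k : int) : R :=
  if n is n'.+1 then b k + C * Qconv (majorant n') (majorant n') k else 0.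

Lemma l2leD (X Y : int -> R) A B : (forall k, 0 <= X k) -> (forall k, 0 <= Y k) ->
  l2le X A -> l2le Y B -> l2le (fun k => X k + Y k) (A + B).
Proof.
move=> X0 Y0 XA YB; have [A0 sX] := XA; have [B0 sY] := YB.
split; first exact: addr_ge0.
have h := ubsumD (ubsumD sX (ubsumZ (ler0n _ 2) (cauchy_schwarz X0 Y0 XA YB))) sY.
rewrite (_ : (A + B) ^+ 2 = A ^+ 2 + 2 * (A * B) + B ^+ 2); last by ring.
by apply: ubsum_le h => k; rewrite le_eqVlt (_ : (X k + Y k) ^+ 2 = X k ^+ 2 + 2 * (X k * Y k) + Y k ^+ 2) ?eqxx//; ring.
Qed.

Lemma l2leZ (X : int -> R) A c : 0 <= c -> l2le X A -> l2le (fun k => c * X k) (c * A).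
Proof.
move=> c0 [A0 XA]; split; first exact: mulr_ge0.
rewrite exprMn; apply: ubsum_le (ubsumZ (sqr_ge0 c) XA) => k.
by rewrite exprMn.
Qed.

(** The ball of radius 2 beta is invariant: beta + 4 C (2 beta)^2 = beta + 16 C beta^2 <= 2 beta,
    which is the origin of the constant in [small]. *)
Lemma majorant_bounds n : (forall k, 0 <= majorant n k) /\ l2le (majorant n) (2 * beta).
Proof.
have [beta0 _] := b_beta.
elim: n => [|n [Z0 lZ]].
  split=> //; split; first by rewrite mulr_ge0.
  by move=> s us; rewrite big1 ?sqr_ge0// => k _; rewrite expr0n.
split=> [k|] /=.
  by rewrite addr_ge0 ?mulr_ge0//; exact: (Qconv_ge0 Z0 Z0 lZ lZ).
apply: (@l2leW _ _ (beta + C * (4 * (2 * beta * (2 * beta))))); last first.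
  rewrite -subr_ge0 [leRHS](_ : _ = beta * (1 - 16 * C * beta)); last by ring.
  by rewrite mulr_ge0// subr_ge0.
apply: l2leD => // [k|]; last by apply: l2leZ => //; exact: l2le_Qconv.
by rewrite mulr_ge0//; exact: (Qconv_ge0 Z0 Z0 lZ lZ).
Qed.

Lemma majorant_ge0 n k : 0 <= majorant n k. Proof. by have [] := majorant_bounds n. Qed.
Lemma l2le_majorant n : l2le (majorant n) (2 * beta). Proof. by have [] := majorant_bounds n. Qed.

(** [Qconv] is monotone on nonnegative sequences, so the recursion started at 0 increases; with the
    uniform bound this already gives convergence. *)
Lemma majorant_leS n k : majorant n k <= majorant n.+1 k.
Proof.
elim: n k => [|n IH] k; first exact: majorant_ge0.
rewrite /= lerD2l ler_wpM2l//.
have h j : 0 <= majorant n j <= majorant n.+1 j by rewrite majorant_ge0 IH.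
exact: (ler_Qconv _ h h (l2le_majorant n.+1) (l2le_majorant n.+1)).
Qed.

Definition majorant_lim k : R := limn (majorant ^~ k).

Lemma majorant_homo k : {homo majorant ^~ k : n m / (n <= m)%N >-> n <= m}.
Proof. by apply: (homo_leq (@lexx _ _) (@le_trans _ _)) => n; exact: majorant_leS. Qed.

Lemma majorant_cvg k : majorant ^~ k @ \oo --> majorant_lim k.
Proof.
suff : cvgn (majorant ^~ k) by [].
apply: nondecreasing_is_cvgn; first exact: majorant_homo.
by exists (2 * beta) => _ [n _ <-]; apply: l2le_pt; [exact: majorant_ge0|exact: l2le_majorant].
Qed.

Lemma majorant_le_lim n k : majorant n k <= majorant_lim k.
Proof.
apply: (cvgr_to_ge (@majorant_cvg k)); near=> m; apply: majorant_homo.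
by near: m; exact: nbhs_infty_ge.
Unshelve. all: by end_near. Qed.

Lemma majorant_lim_ge0 k : 0 <= majorant_lim k.
Proof. exact: le_trans (majorant_ge0 0 k) (majorant_le_lim 0 k). Qed.

Lemma l2le_majorant_lim : l2le majorant_lim (2 * beta).
Proof.
have [beta0 _] := b_beta; split; first by rewrite mulr_ge0.
apply: (@ubsum_lim _ (fun n k => majorant n k ^+ 2)) => [k|n].
  by under eq_fun do rewrite expr2; rewrite expr2; apply: cvgM; exact: majorant_cvg.
by have [] := l2le_majorant n.
Qed.

Lemma Qconv_majorant_cvg k : Qconv majorant_lim majorant_lim k - Qconv (majorant n) (majorant n) k @[n --> \oo] --> 0.
Proof.
rewrite -(subrr (Qconv majorant_lim majorant_lim k)); apply: cvgB; first exact: cvg_cst.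
apply: (@zsum_dominated _ _ _ (Qterm majorant_lim majorant_lim k)) => [n j||j].
- rewrite ger0_norm; last exact: (Qterm_ge0 (majorant_ge0 n) (majorant_ge0 n)).
  rewrite /Qterm -!mulrA ler_wpM2l ?addr_ge0 ?iv_ge0//.
  by rewrite ler_pM// ?majorant_ge0// majorant_le_lim.
- exact: (Qterm_summable majorant_lim_ge0 majorant_lim_ge0 l2le_majorant_lim l2le_majorant_lim).
- by apply: cvgM; [apply: cvgMr|]; exact: majorant_cvg.
Qed.

End Majorants.

(** * Duhamel integrals *)

Section ComplexIntegral.
Variables (R : realType) (mu : {measure set (measurableTypeR R) -> \bar R}).
Variables (D : set R) (mD : measurable (D : set (measurableTypeR R))).
Implicit Types (F G : R -> R[i]) (f h : R -> R) (z : R[i]).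

Definition Cmeas (E : set R) F :=
  measurable_fun (E : set (measurableTypeR R)) (fun x => complex.Re (F x)) /\
  measurable_fun (E : set (measurableTypeR R)) (fun x => complex.Im (F x)).

Definition Cintegrable F :=
  mu.-integrable D (EFin \o (fun x => complex.Re (F x))) /\
  mu.-integrable D (EFin \o (fun x => complex.Im (F x))).

Lemma integrable_le_fun f h : measurable_fun (D : set (measurableTypeR R)) f ->
  mu.-integrable D (EFin \o h) -> (forall x, D x -> `|f x| <= h x) ->
  mu.-integrable D (EFin \o f).
Proof.
move=> mf ih fh; apply: le_integrable ih => //; first exact/measurable_EFinP.
by move=> x Dx /=; rewrite lee_fin (le_trans (fh x Dx))// ler_norm.
Qed.

Lemma Cintegrable_le F h : Cmeas D F -> mu.-integrable D (EFin \o h) ->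
  (forall x, D x -> cabs (F x) <= h x) -> Cintegrable F.
Proof.
move=> [mr mi] ih Fh; split; apply: (integrable_le_fun _ ih) => // x Dx.
  exact: le_trans (Re_le_cabs _) (Fh x Dx).
exact: le_trans (Im_le_cabs _) (Fh x Dx).
Qed.

Lemma ler_norm_Rint f h : measurable_fun (D : set (measurableTypeR R)) f ->
  mu.-integrable D (EFin \o h) -> (forall x, D x -> `|f x| <= h x) ->
  `|\int[mu]_(x in D) f x| <= \int[mu]_(x in D) h x.
Proof.
move=> mf ih fh; have If := integrable_le_fun mf ih fh.
apply: le_trans (le_normr_Rintegral mD If) _.
by apply: le_Rintegral => //; exact: (integrable_norm If).
Qed.

Lemma cabs_Cint_le F h : Cmeas D F -> mu.-integrable D (EFin \o h) ->
  (forall x, D x -> cabs (F x) <= h x) ->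
  cabs (Cintegral mu D F) <= 2 * \int[mu]_(x in D) h x.
Proof.
move=> [mr mi] ih Fh; apply: le_trans (cabs_le_ReIm _) _.
rewrite mulr_natl mulr2n; apply: lerD; apply: ler_norm_Rint => // x Dx.
  exact: le_trans (Re_le_cabs _) (Fh x Dx).
exact: le_trans (Im_le_cabs _) (Fh x Dx).
Qed.

Lemma eq_Cint F G : (forall x, D x -> F x = G x) -> Cintegral mu D F = Cintegral mu D G.
Proof.
move=> FG; rewrite /Cintegral; congr (_ +i* _); apply: eq_Rintegral => x /[!inE] /FG -> //.
Qed.

Lemma CintB F G : Cintegrable F -> Cintegrable G ->
  Cintegral mu D (fun x => F x - G x) = Cintegral mu D F - Cintegral mu D G.
Proof.
move=> [Fr Fi] [Gr Gi]; apply: complex_eq; rewrite ?cReD ?cImD ?cReN ?cImN /=.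
  by rewrite -RintegralB//; apply: eq_Rintegral => x _; rewrite cReD cReN.
by rewrite -RintegralB//; apply: eq_Rintegral => x _; rewrite cImD cImN.
Qed.

Lemma integrableZl_fun f (r : R) : mu.-integrable D (EFin \o f) ->
  mu.-integrable D (EFin \o (fun x => r * f x)).
Proof. by move=> /(integrableZl mD r). Qed.

Lemma integrableD_fun f h : mu.-integrable D (EFin \o f) -> mu.-integrable D (EFin \o h) ->
  mu.-integrable D (EFin \o (fun x => f x + h x)).
Proof. by move=> If Ih; exact: (integrableD mD If Ih). Qed.

Lemma CintZ z F : Cintegrable F ->
  Cintegral mu D (fun x => z * F x) = z * Cintegral mu D F.
Proof.
move=> [Fr Fi]; apply: complex_eq.
  rewrite [RHS]cReM /= -!RintegralZl// -RintegralB//; try exact: integrableZl_fun.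
  by apply: eq_Rintegral => x _; rewrite cReM.
rewrite [RHS]cImM /= -!RintegralZl// -RintegralD//; try exact: integrableZl_fun.
by apply: eq_Rintegral => x _; rewrite cImM.
Qed.

Lemma Cint_conj F : Cintegrable F ->
  Cintegral mu D (fun x => (F x)^*) = (Cintegral mu D F)^*.
Proof.
move=> [Fr Fi]; apply: complex_eq; rewrite ?cReJ ?cImJ.
  by apply: eq_Rintegral => x _; rewrite cReJ.
rewrite -[complex.Im (Cintegral mu D F)]/(\int[mu]_(x in D) complex.Im (F x)).
by rewrite -mulN1r -RintegralZl//; apply: eq_Rintegral => x _; rewrite cImJ mulN1r.
Qed.

Lemma Cmeas_mul F G : Cmeas D F -> Cmeas D G -> Cmeas D (fun x => F x * G x).
Proof.
move=> [Fr Fi] [Gr Gi]; split.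
  under eq_fun do rewrite cReM; apply: measurable_funB; exact: measurable_funM.
under eq_fun do rewrite cImM; apply: measurable_funD; exact: measurable_funM.
Qed.

Lemma CmeasB F G : Cmeas D F -> Cmeas D G -> Cmeas D (fun x => F x - G x).
Proof.
move=> [Fr Fi] [Gr Gi]; split.
  by under eq_fun do rewrite cReD cReN; exact: measurable_funB.
by under eq_fun do rewrite cImD cImN; exact: measurable_funB.
Qed.

Lemma Cmeas_cst z : Cmeas D (fun=> z).
Proof. by split; exact: measurable_cst. Qed.

Lemma Cmeas_zsumC (F : R -> int -> R[i]) : (forall k, Cmeas D (F ^~ k)) ->
  (forall x, D x -> zsummableC (F x)) -> Cmeas D (fun x => zsumC (F x)).
Proof.
move=> mF sF; split.
  apply: (@measurable_fun_cvg _ _ _ _ (fun n x => psum (fun k => complex.Re (F x k)) n)).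
    move=> n; apply: measurable_sum => i; apply: measurable_funD.
      by have [] := mF (Posz i).
    by have [] := mF (Negz i).
  by move=> x Dx; apply: zsum_cvg; apply: zsummable_Re; exact: sF.
apply: (@measurable_fun_cvg _ _ _ _ (fun n x => psum (fun k => complex.Im (F x k)) n)).
  move=> n; apply: measurable_sum => i; apply: measurable_funD.
    by have [] := mF (Posz i).
  by have [] := mF (Negz i).
by move=> x Dx; apply: zsum_cvg; apply: zsummable_Im; exact: sF.
Qed.

Lemma Cmeas_eq F G : (forall x, D x -> F x = G x) -> Cmeas D F -> Cmeas D G.
Proof.
move=> FG [mr mi]; split.
  by apply: (eq_measurable_fun (fun x => complex.Re (F x))) => // x /[!inE] /FG ->.
by apply: (eq_measurable_fun (fun x => complex.Im (F x))) => // x /[!inE] /FG ->.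
Qed.

End ComplexIntegral.

Lemma Cmeas_sub (R : realType) (D E : set R) (F : R -> R[i]) :
  measurable (D : set (measurableTypeR R)) -> E `<=` D -> Cmeas D F -> Cmeas E F.
Proof.
move=> mD ED [mr mi]; split; exact: measurable_funS ED _.
Qed.

(** * Integrals of decaying exponentials over time intervals *)

Section TimeIntegrals.
Variable R : realType.
Notation leb := (@lebesgue_measure R).
Implicit Types (a t lambda : R).

Lemma integrable_cst_itv a t c : leb.-integrable `]a, t[%classic (EFin \o (fun=> c)).
Proof.
apply: measurable_bounded_integrable => //.
- by rewrite /= lebesgue_measure_itv/=; case: ifP => // _; rewrite -EFinB ltry.
- by exists `|c|; split; [exact: num_real|move=> x xc y _ /=; rewrite ltW].
Qed.

Lemma Rint_cst_itv a t c : a <= t -> \int[leb]_(x in `]a, t[) c = c * (t - a).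
Proof.
move=> le_at; rewrite Rintegral_cst//= lebesgue_measure_itv/= lte_fin.
by move: le_at; rewrite le_eqVlt => /orP[/eqP ->|->//]; rewrite ltxx subrr.
Qed.

Lemma continuous_expdecay t lambda : continuous (fun x : R => expR (- ((t - x) * lambda))).
Proof.
move=> x; apply: continuous_comp; last exact: continuous_expR.
apply: cvgN; apply: cvgM; last exact: cvg_cst.
by apply: cvgB; [exact: cvg_cst|exact: cvg_id].
Qed.

Lemma integrable_expdecay a t s lambda :
  leb.-integrable `]a, t[%classic (EFin \o (fun x => expR (- ((s - x) * lambda)))).
Proof.
apply: (@integrableS _ _ _ leb `[a, t]%classic) => //.
  exact: subset_itv_oo_cc.
apply: continuous_compact_integrable; first exact: segment_compact.
by apply: continuous_subspaceT => x; exact: continuous_expdecay.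
Qed.

Lemma Rint_expdecay a t lambda : a <= t -> 0 < lambda ->
  \int[leb]_(x in `]a, t[) expR (- ((t - x) * lambda)) <= lambda^-1.
Proof.
rewrite le_eqVlt => /orP[/eqP -> l0|a_lt_t l0].
  by rewrite set_itvoo0 Rintegral_set0 invr_ge0 ltW.
rewrite Rintegral_itv_obnd_cbnd; last exact: integrable_expdecay.
rewrite Rintegral_itv_bndo_bndc; last first.
  (* The interval is enlarged to the left so that an open interval contains the endpoint a. *)
  apply: (@integrableS _ _ _ leb `]a - 1, t[%classic) => //; last exact: integrable_expdecay.
  by apply: subset_itvr; rewrite bnd_simp; lra.
have dF (x : R) : is_derive x (1 : R) (fun x => lambda^-1 * expR (- ((t - x) * lambda)))
    (expR (- ((t - x) * lambda))).
  have dG : is_derive x (1 : R) (fun x : R => - ((t - x) * lambda)) lambda.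
    have -> : (fun x : R => - ((t - x) * lambda)) = (fun x : R => lambda *: x + (- (t * lambda))).
      by apply/funext => y; rewrite /GRing.scale/=; ring.
    by apply: is_derive_eq; rewrite /GRing.scale/= mulr1 subr0.
  have dH := @is_derive1_comp _ expR _ x _ _ _ dG.
  have dZ := is_deriveZ lambda^-1 (dH _ (is_derive_expR _)).
  have e : lambda^-1 *: (expR (- ((t - x) * lambda)) * lambda) = expR (- ((t - x) * lambda)).
    by rewrite /GRing.scale/= mulrCA mulVf ?mulr1// lt0r_neq0.
  by rewrite -[X in is_derive _ _ _ X]e.
have cF x : {for x, continuous (fun x => lambda^-1 * expR (- ((t - x) * lambda)))}.
  by apply: differentiable_continuous; apply/derivable1_diffP; have [] := dF x.
rewrite /Rintegral.
rewrite (@continuous_FTC2 _ _ (fun x => lambda^-1 * expR (- ((t - x) * lambda))))//=.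
- by rewrite subrr mul0r oppr0 expR0 mulr1 gerBl mulr_ge0 ?expR_ge0// invr_ge0 ltW.
- by apply: continuous_subspaceT => x; exact: continuous_expdecay.
- split=> [x _||]; first by have [] := dF x.
    exact/cvg_at_right_filter/cF.
  exact/cvg_at_left_filter/cF.
- by move=> x _; rewrite derive1E; have [_ ->] := dF x.
Qed.

End TimeIntegrals.

(** * Continuity of primitives of locally bounded functions *)

Section PrimitiveContinuity.
Variable R : realType.
Notation leb := (@lebesgue_measure R).

Lemma Rint_lipschitz (f : R -> R) (M T x b : R) :
  measurable_fun (`]0, T[%classic : set (measurableTypeR R)) f ->
  (forall y, 0 < y < T -> `|f y| <= M) -> 0 < x -> x <= b -> b <= T ->
  `|\int[leb]_(y in `]0, b[) f y - \int[leb]_(y in `]0, x[) f y| <= M * (b - x).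
Proof.
move=> mf fM x0 xb bT.
have If c d : 0 <= c -> d <= T -> leb.-integrable `]c, d[%classic (EFin \o f).
  move=> c0 dT; apply: (@integrableS _ _ _ leb `]0, T[%classic) => //.
    by apply: subset_itvW.
  apply: (@integrable_le_fun _ leb _ _ f (fun=> M)) => //.
  exact: integrable_cst_itv.
have [->|xb'] := eqVneq x b; first by rewrite !subrr mulr0 normr0.
have xltb : x < b by rewrite lt_neqAle xb' xb.
rewrite [X in _ - X]Rintegral_itv_bndo_bndc; last by apply: If => //; lra.
rewrite Rintegral_itvB; last 3 first.
- exact: If.
- by rewrite bnd_simp ltW.
- by rewrite bnd_simp.
apply: le_trans (_ : \int[leb]_(y in `]x, b[) M <= _).
  apply: (@ler_norm_Rint _ leb _ _ f (fun=> M)) => //.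
  - by apply: measurable_funS mf => //; apply: subset_itvW => //; rewrite ltW.
  - exact: integrable_cst_itv.
  - by move=> y /=; rewrite in_itv/= => /andP[xy yb]; apply: fM; lra.
by rewrite Rint_cst_itv.
Qed.

(** The bound may grow with the horizon T, as it does for the factor S(- tau) in
    [duhamel_continuous]. *)
Lemma Rint_primitive_continuous (f : R -> R) (M : R -> R) :
  measurable_fun (`]0, +oo[%classic : set (measurableTypeR R)) f ->
  (forall T y, 0 < y < T -> `|f y| <= M T) ->
  forall x : R, 0 < x -> {for x, continuous (fun t : R => \int[leb]_(y in `]0, t[) f y)}.
Proof.
move=> mf fM x x0.
(* Times close to x stay below 2 x, so the single bound M (2 x) serves near x. *)
have M0 : 0 <= M (2 * x) by apply: le_trans (fM (2 * x) x _); rewrite ?normr_ge0//; lra.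
have mf' : measurable_fun (`]0, 2 * x[%classic : set (measurableTypeR R)) f.
  by apply: measurable_funS mf => //; apply: subset_itvl.
apply/cvgrPdist_le => e e0.
near=> t.
have t0 : 0 < t by near: t; exact: lt_nbhsr.
have t2 : t <= 2 * x by apply: ltW; near: t; apply: lt_nbhsl; lra.
have tx : `|x - t| <= e / (M (2 * x) + 1).
  near: t; apply: cvgr_dist_le; [exact: cvg_id|by rewrite divr_gt0// ltr_wpDl].
apply: (@le_trans _ _ (M (2 * x) * `|x - t|)).
  have [xt|/ltW tx'] := leP x t.
    rewrite distrC [X in _ <= _ * X]distrC (ger0_norm (_ : 0 <= t - x)) ?subr_ge0//.
    by apply: Rint_lipschitz mf' _ _ _ _ => //; exact: fM.
  rewrite (ger0_norm (_ : 0 <= x - t)) ?subr_ge0//.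
  by apply: Rint_lipschitz mf' _ _ _ _ => //; [exact: fM|lra].
apply: le_trans (ler_wpM2l M0 tx) _.
rewrite mulrCA ger_pMr// ler_pdivrMr ?mul1r ?ltr_wpDl//; lra.
Unshelve. all: by end_near. Qed.

End PrimitiveContinuity.

(** * The semigroup symbol and the exponential weights *)

Section Semigroup.
Variables (R : realType) (sigma omega : R).
Hypothesis sigma1 : 1 < sigma.
Notation leb := (@lebesgue_measure R).
Notation S := (semigroup_symbol sigma omega).
Implicit Types (t tau s : R) (k j : int).

Definition lam k : R := `|k|%:~R `^ sigma.

Lemma abs_ge1 k : k != 0 -> 1 <= `|k|%:~R :> R.
Proof. by move=> k0; rewrite ler1z -gtz0_ge1 normr_gt0. Qed.

Lemma lam_ge k : k != 0 -> `|k|%:~R <= lam k.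
Proof. by move=> k0; apply: le1r_powR; rewrite ?abs_ge1// ltW. Qed.

Lemma lam_ge1 k : k != 0 -> 1 <= lam k.
Proof. by move=> k0; apply: le_trans (abs_ge1 k0) (lam_ge k0). Qed.

Lemma lam_gt0 k : k != 0 -> 0 < lam k.
Proof. by move=> /lam_ge1; exact: lt_le_trans. Qed.

Lemma cabs_cexp (z : R[i]) : cabs (cexp z) = expR (complex.Re z).
Proof.
rewrite /cexp cabsM cabs_real ger0_norm ?expR_ge0//.
by rewrite /cabs /normsqC /= cos2Dsin2 sqrtr1 mulr1.
Qed.

Lemma cexpD (z w : R[i]) : cexp (z + w) = cexp z * cexp w.
Proof.
rewrite /cexp cReD cImD expRD cosD sinD; apply: complex_eq; rewrite ?cReM ?cImM /=; ring.
Qed.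

Lemma cexp_conj (z : R[i]) : cexp z^* = (cexp z)^*.
Proof.
rewrite /cexp cReJ cImJ cosN sinN; apply: complex_eq; rewrite ?cReJ ?cImJ ?cReM ?cImM /=; ring.
Qed.

Lemma cexp0 : cexp 0 = 1 :> R[i].
Proof. by rewrite /cexp /= expR0 cos0 sin0 mul1r. Qed.

Lemma cabs_S t k : cabs (S t k) = expR (- (t * lam k)).
Proof. exact: cabs_cexp. Qed.

Lemma SD s t k : S (s + t) k = S s k * S t k.
Proof. by rewrite -cexpD; congr cexp; apply: complex_eq; rewrite ?cReD ?cImD/=; ring. Qed.

Lemma SJ t k : S t (- k) = (S t k)^*.
Proof.
by rewrite -cexp_conj; congr cexp; rewrite /= normrN sgzN rmorphN/=; congr (_ +i* _); ring.
Qed.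

Lemma S0 k : S 0 k = 1.
Proof. by rewrite -cexp0; congr cexp; rewrite !mul0r oppr0. Qed.

Lemma continuous_affine (c d : R) : continuous (fun x : R => c + d * x).
Proof.
by move=> x; apply: cvgD; [exact: cvg_cst|apply: cvgM; [exact: cvg_cst|exact: cvg_id]].
Qed.

Lemma Cmeas_S (D : set R) (c d : R) k : measurable (D : set (measurableTypeR R)) ->
  Cmeas D (fun tau => S (c + d * tau) k).
Proof.
move=> mD; have cc := @continuous_affine (- (c * lam k)) (- (d * lam k)).
have cs := @continuous_affine (- (c * omega * (sgz k)%:~R)) (- (d * omega * (sgz k)%:~R)).
have E : (fun tau => S (c + d * tau) k) = (fun tau : R =>
   (expR (- (c * lam k) + - (d * lam k) * tau))%:C *
   (cos (- (c * omega * (sgz k)%:~R) + - (d * omega * (sgz k)%:~R) * tau) +i*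
    sin (- (c * omega * (sgz k)%:~R) + - (d * omega * (sgz k)%:~R) * tau))).
  apply/funext => tau; rewrite /semigroup_symbol /cexp /=.
  by congr (_%:C * (cos _ +i* sin _)); [congr expR|..]; rewrite /lam; ring.
rewrite E; split.
  under eq_fun do rewrite cReM /= mul0r subr0.
  apply: measurable_funTS; apply: continuous_measurable_fun => x.
  apply: cvgM; apply: continuous_comp; [exact: cc|exact: continuous_expR|exact: cs|exact: continuous_cos].
under eq_fun do rewrite cImM /= mul0r addr0.
apply: measurable_funTS; apply: continuous_measurable_fun => x.
apply: cvgM; apply: continuous_comp; [exact: cc|exact: continuous_expR|exact: cs|exact: continuous_sin].
Qed.

Lemma Cmeas_SB (D : set R) t k : measurable (D : set (measurableTypeR R)) ->
  Cmeas D (fun tau => S (t - tau) k).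
Proof.
move=> mD; have := @Cmeas_S D t (-1) k mD.
by under [X in Cmeas D X]eq_fun do rewrite mulN1r.
Qed.

(** A Gevrey-type weight: t^(1 / sigma) is, by scaling, the radius of analyticity that the
    dissipation creates by time t. The factor 1/2 leaves half of the decay of S_k for the time
    integral. *)
Definition weight t k : R := expR (`|k|%:~R * t `^ sigma^-1 / 2).

Lemma weight_gt0 t k : 0 < weight t k. Proof. exact: expR_gt0. Qed.

Lemma weight_sub t k j : weight t k <= weight t j * weight t (k - j).
Proof.
rewrite -expRD ler_expR -!mulrA -mulrDl ler_wpM2r//.
  by rewrite divr_ge0// powR_ge0.
by rewrite -intrD ler_int -{1}(subrK j k) addrC ler_normD.
Qed.

Lemma weight0 k : weight 0 k = 1.
Proof.
rewrite /weight powR0 ?mulr0 ?mul0r ?expR0// invr_eq0 gt_eqF//.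
exact: lt_trans sigma1.
Qed.

Lemma powR_le_1D (x p : R) : 0 <= x -> 0 < p -> p <= 1 -> x `^ p <= 1 + x.
Proof.
move=> x0 p0 p1; have [x1|/ltW x1] := leP x 1.
  have := ge0_ler_powR (ltW p0) x0 (ler01 : (1 : R) \is Num.nneg) x1.
  by rewrite powR1; lra.
by have := ler1_powR x1 p1; lra.
Qed.

(** A ratio r = z / (x + y) in [0, 1] satisfies r <= r^p; adding this for z = x and z = y gives the
    claim. *)
Lemma powR_subadd (x y p : R) : 0 <= x -> 0 <= y -> 0 < p -> p <= 1 ->
  (x + y) `^ p <= x `^ p + y `^ p.
Proof.
move=> x0 y0 p0 p1; have [xy0|xy0] := eqVneq (x + y) 0.
  by rewrite xy0 powR0 ?gt_eqF// addr_ge0 ?powR_ge0.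
have xyp : 0 < x + y by rewrite lt_neqAle eq_sym xy0 addr_ge0.
have h z : 0 <= z -> z <= x + y -> z / (x + y) * (x + y) `^ p <= z `^ p.
  move=> z0 zxy; have [->|zn0] := eqVneq z 0; first by rewrite !mul0r powR_ge0.
  have zp : 0 < z by rewrite lt_neqAle eq_sym zn0.
  have zE : z = z / (x + y) * (x + y) by rewrite divfK.
  rewrite [in leRHS]zE powRM ?divr_ge0 ?(ltW xyp)// ler_wpM2r ?powR_ge0//.
  by apply: ger1_powR => //; rewrite divr_gt0//= ler_pdivrMr// mul1r.
have := h x x0; have := h y y0; rewrite lerDl lerDr => /(_ x0) hy /(_ y0) hx.
apply: le_trans (lerD hx hy); by rewrite -mulrDl -mulrDl divff// mul1r.
Qed.

(** Subadditivity gives t^(1/sigma) <= tau^(1/sigma) + (t - tau)^(1/sigma), and |k| (t -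
    tau)^(1/sigma) is the (1/sigma)-th power of (t - tau) |k|^sigma, hence at most 1 + (t - tau)
    |k|^sigma. After halving, the exponent 1/2 is absorbed in [expR 1]. *)
Lemma weight_decay t tau k : k != 0 -> 0 <= tau -> tau <= t ->
  weight t k * expR (- ((t - tau) * lam k)) <=
  expR 1 * expR (- ((t - tau) * (lam k / 2))) * weight tau k.
Proof.
move=> k0 tau0 taut; rewrite -!expRD ler_expR.
have sig0 : 0 < sigma by exact: lt_trans sigma1.
have sp : 0 < sigma^-1 by rewrite invr_gt0.
have s1 : sigma^-1 <= 1 by rewrite invf_le1// ltW.
have d0 : 0 <= t - tau by rewrite subr_ge0.
have kp : 0 <= `|k|%:~R :> R by rewrite ler0z.
have h1 : t `^ sigma^-1 <= tau `^ sigma^-1 + (t - tau) `^ sigma^-1.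
  by rewrite -{1}(subrKC tau t); exact: powR_subadd.
have h2 : `|k|%:~R * (t - tau) `^ sigma^-1 <= 1 + (t - tau) * lam k.
  have -> : `|k|%:~R = lam k `^ sigma^-1.
    by rewrite /lam -powRrM divff ?powRr1// gt_eqF.
  rewrite -powRM ?powR_ge0// mulrC; apply: powR_le_1D => //.
  by rewrite mulr_ge0// powR_ge0.
have h3 := ler_wpM2l kp h1; move: h2 h3; rewrite mulrDr.
move: (`|k|%:~R * _) (`|k|%:~R * _) (`|k|%:~R * _) => u v w.
rewrite !mulrA; move: ((t - tau) * lam k) => z; lra.
Qed.

Section Duhamel.
Variables (g : R -> R[i]) (k : int) (M : R).
Hypotheses (k0 : k != 0).

Lemma duhamel_integrable t (h : R -> R) : Cmeas `]0, t[%classic g ->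
  leb.-integrable `]0, t[%classic (EFin \o h) ->
  (forall tau, 0 < tau < t -> cabs (S (t - tau) k * g tau) <= h tau) ->
  Cintegrable leb `]0, t[%classic (fun tau => S (t - tau) k * g tau).
Proof.
move=> mg ih gh; apply: Cintegrable_le ih _ => //.
by apply: Cmeas_mul => //; exact: Cmeas_SB.
Qed.

(** The constant is e from [weight_decay], times 2 for the real and imaginary parts, times 2 /
    |k|^sigma for the time integral at half the decay rate. *)
Lemma duhamel_bound t : 0 < t -> Cmeas `]0, t[%classic g ->
  (forall tau, 0 < tau < t -> weight tau k * cabs (g tau) <= M) ->
  weight t k * cabs (Cintegral leb `]0, t[%classic (fun tau => S (t - tau) k * g tau))
    <= 4 * expR 1 * M / lam k.
Proof.
move=> t0 mg gM; have l0 := lam_gt0 k0.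
have M0 : 0 <= M.
  apply: le_trans (gM (t / 2) _); first by rewrite mulr_ge0 ?cabs_ge0// ltW// weight_gt0.
  by lra.
have := @integrable_expdecay R 0 t t (lam k / 2).
move=> /(integrableZl_fun (measurable_itv _) (expR 1 * M / weight t k)) ih.
have gh tau : 0 < tau < t -> cabs (S (t - tau) k * g tau) <=
    expR 1 * M / weight t k * expR (- ((t - tau) * (lam k / 2))).
  move=> /andP[tau0 taut].
  rewrite -(ler_pM2l (weight_gt0 t k)) cabsM cabs_S [leLHS]mulrA.
  apply: le_trans (ler_wpM2r (cabs_ge0 _) (weight_decay k0 (ltW tau0) (ltW taut))) _.
  rewrite [leRHS](_ : _ = expR 1 * expR (- ((t - tau) * (lam k / 2))) * M); last first.
    by field; rewrite gt_eqF// weight_gt0.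
  rewrite -[leLHS]mulrA; apply: ler_wpM2l; last by apply: gM; rewrite tau0.
  by rewrite mulr_ge0 ?expR_ge0.
have gh' tau : `]0, t[%classic tau -> cabs (S (t - tau) k * g tau) <=
    expR 1 * M / weight t k * expR (- ((t - tau) * (lam k / 2))).
  by rewrite /= in_itv/=; exact: gh.
have mF : Cmeas `]0, t[%classic (fun tau => S (t - tau) k * g tau).
  by apply: Cmeas_mul => //; exact: Cmeas_SB.
have := cabs_Cint_le (measurable_itv _) mF ih gh'.
rewrite RintegralZl//; last exact: integrable_expdecay.
move=> /(ler_wpM2l (ltW (weight_gt0 t k))) /le_trans; apply.
have := @Rint_expdecay R 0 t (lam k / 2) (ltW t0); rewrite divr_gt0// => /(_ isT).
rewrite invf_div => /(ler_wpM2l _) h.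
rewrite [leLHS](_ : _ = 2 * (expR 1 * M * \int[leb]_(x in `]0, t[) expR (- ((t - x) * (lam k / 2))))).
  rewrite [leRHS](_ : _ = 2 * (expR 1 * M * (2 / lam k))); last by ring.
  by rewrite ler_wpM2l// h// mulr_ge0// expR_ge0.
by field; rewrite gt_eqF// weight_gt0.
Qed.

(** Moves t out of the integrand: what remains is a primitive, whose continuity in t is known. The
    growth of S(- tau) is harmless at a fixed frequency. *)
Lemma duhamel_factor t : 0 < t -> Cmeas `]0, t[%classic g ->
  (forall tau, 0 < tau < t -> cabs (g tau) <= M) ->
  Cintegral leb `]0, t[%classic (fun tau => S (t - tau) k * g tau) =
  S t k * Cintegral leb `]0, t[%classic (fun tau => S (- tau) k * g tau).
Proof.
move=> t0 mg gM; rewrite -CintZ//; last first.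
  apply: (@Cintegrable_le _ _ _ _ _ (fun=> expR (t * lam k) * M)) => //.
  - apply: Cmeas_mul => //; have := @Cmeas_S `]0, t[%classic 0 (-1) k (measurable_itv _).
    by under [X in Cmeas _ X]eq_fun do rewrite mulN1r add0r.
  - exact: integrable_cst_itv.
  - move=> tau /=; rewrite in_itv/= => /andP[tau0 taut].
    rewrite cabsM cabs_S; apply: ler_pM; rewrite ?expR_ge0 ?cabs_ge0 ?gM ?tau0//.
    by rewrite ler_expR mulNr opprK ler_wpM2r ?(ltW (lam_gt0 k0))// ltW.
by apply: eq_Cint => tau _; rewrite mulrA -SD.
Qed.

Lemma continuous_S t : {for t, continuous (fun t => complex.Re (S t k))} /\
  {for t, continuous (fun t => complex.Im (S t k))}.
Proof.
have E (s : R) : S s k = (expR (0 + - lam k * s))%:C *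
   (cos (0 + - (omega * (sgz k)%:~R) * s) +i* sin (0 + - (omega * (sgz k)%:~R) * s)).
  by rewrite /semigroup_symbol /cexp /=; congr (_%:C * (cos _ +i* sin _)); [congr expR|..]; rewrite /lam; ring.
have cc := @continuous_affine 0 (- lam k); have cs := @continuous_affine 0 (- (omega * (sgz k)%:~R)).
split.
  have -> : (fun t => complex.Re (S t k)) = (fun s => expR (0 + - lam k * s) * cos (0 + - (omega * (sgz k)%:~R) * s)).
    by apply/funext => s; rewrite E cReM /= mul0r subr0.
  apply: cvgM; apply: continuous_comp; [exact: cc|exact: continuous_expR|exact: cs|exact: continuous_cos].
have -> : (fun t => complex.Im (S t k)) = (fun s => expR (0 + - lam k * s) * sin (0 + - (omega * (sgz k)%:~R) * s)).
  by apply/funext => s; rewrite E cImM /= mul0r addr0.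
apply: cvgM; apply: continuous_comp; [exact: cc|exact: continuous_expR|exact: cs|exact: continuous_sin].
Qed.

(** Continuity in time yields the measurability of the next Picard iterate and, later, the L^2
    continuity behind strong measurability. *)
Lemma duhamel_continuous (c0 : R[i]) : Cmeas `]0, +oo[%classic g ->
  (forall tau, 0 < tau -> cabs (g tau) <= M) ->
  let F t := S t k * c0 + Cintegral leb `]0, t[%classic (fun tau => S (t - tau) k * g tau) in
  forall t : R, 0 < t -> {for t, continuous (fun t : R => complex.Re (F t))} /\
  {for t, continuous (fun t : R => complex.Im (F t))}.
Proof.
move=> mg gM F.
pose P t := c0 + Cintegral leb `]0, t[%classic (fun tau => S (- tau) k * g tau).
have FE t : 0 < t -> F t = S t k * P t.
  move=> t0; rewrite /F (duhamel_factor t0) ?mulrDr//.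
    by apply: Cmeas_sub mg => //; exact: subset_itvl.
  by move=> tau /andP[/gM].
have mSg : Cmeas `]0, +oo[%classic (fun tau => S (- tau) k * g tau).
  apply: Cmeas_mul => //; have := @Cmeas_S `]0, +oo[%classic 0 (-1) k (measurable_itv _).
  by under [X in Cmeas _ X]eq_fun do rewrite mulN1r add0r.
have bSg T tau : 0 < tau < T -> cabs (S (- tau) k * g tau) <= expR (T * lam k) * M.
  move=> /andP[tau0 tauT]; rewrite cabsM cabs_S; apply: ler_pM; rewrite ?expR_ge0 ?cabs_ge0 ?gM ?tau0//.
  by rewrite ler_expR mulNr opprK ler_wpM2r ?(ltW (lam_gt0 k0))// ltW.
have [mr mi] := mSg.
have cr := @Rint_primitive_continuous _ _ (fun T => expR (T * lam k) * M) mr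
  (fun T y h => le_trans (Re_le_cabs _) (bSg T y h)).
have ci := @Rint_primitive_continuous _ _ (fun T => expR (T * lam k) * M) mi
  (fun T y h => le_trans (Im_le_cabs _) (bSg T y h)).
have cPr t : 0 < t -> {for t, continuous (fun t => complex.Re (P t))}.
  move=> tp; rewrite /P /prop_for /continuous_at cReD; under eq_fun do rewrite cReD.
  by apply: cvgD; [exact: cvg_cst|exact: cr].
have cPi t : 0 < t -> {for t, continuous (fun t => complex.Im (P t))}.
  move=> tp; rewrite /P /prop_for /continuous_at cImD; under eq_fun do rewrite cImD.
  by apply: cvgD; [exact: cvg_cst|exact: ci].
have nearFE t : 0 < t -> \forall s \near t, S s k * P s = F s.
  move=> t0; near=> s; rewrite FE//.
  by near: s; exact: lt_nbhsr.
move=> t tp; have [Sr Si] := continuous_S t; split.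
  have E1 : \forall s \near t, complex.Re (S s k) * complex.Re (P s) - complex.Im (S s k) * complex.Im (P s) = complex.Re (F s).
    by apply: filterS (nearFE t tp) => s <-; rewrite cReM.
  rewrite /prop_for /continuous_at FE// cReM; apply: cvg_trans (near_eq_cvg E1) _.
  by apply: cvgB; apply: cvgM => //; [exact: cPr|exact: cPi].
have E1 : \forall s \near t, complex.Re (S s k) * complex.Im (P s) + complex.Im (S s k) * complex.Re (P s) = complex.Im (F s).
  by apply: filterS (nearFE t tp) => s <-; rewrite cImM.
rewrite /prop_for /continuous_at FE// cImM; apply: cvg_trans (near_eq_cvg E1) _.
by apply: cvgD; apply: cvgM => //; [exact: cPi|exact: cPr].
Unshelve. all: by end_near. Qed.

End Duhamel.

End Semigroup.

(** * Picard iteration *)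

Section Picard.
Variables (R : realType) (a omega sigma : R).
Hypothesis sigma1 : 1 < sigma.
Variables (c0 : int -> R[i]) (beta : R).
Hypotheses (c00 : c0 0 = 0) (c0J : forall k, c0 (- k) = (c0 k)^*).
Hypothesis c0_beta : l2le (fun k => cabs (c0 k)) beta.
Notation leb := (@lebesgue_measure R).
Notation S := (semigroup_symbol sigma omega).
Notation E := (weight sigma).
Implicit Types (t tau : R) (k j : int) (n m : nat).

(** The factor e is the constant of [weight_decay] at tau = 0, where the weight is 1. *)
Definition picard_datum k : R := expR 1 * cabs (c0 k).
(** The product of 4 e from [duhamel_bound] and 2 (1 + |a|) from [cabs_Bq]; the powers of k are
    disposed of by |k| <= |k|^sigma. *)
Definition picard_const : R := 8 * expR 1 * Ba a.
Hypothesis small : 16 * picard_const * (expR 1 * beta) <= 1.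

Let Pb0 k : 0 <= picard_datum k. Proof. by rewrite mulr_ge0 ?expR_ge0 ?cabs_ge0. Qed.
Let PC0 : 0 <= picard_const. Proof. by rewrite !mulr_ge0 ?expR_ge0 ?Ba_ge0. Qed.
Let Pb_beta : l2le picard_datum (expR 1 * beta). Proof. by apply: l2leZ => //; exact: expR_ge0. Qed.

Notation Z := (majorant picard_datum picard_const).
Notation Zoo := (majorant_lim picard_datum picard_const).
Let Z0 := majorant_ge0 Pb0 PC0 Pb_beta small.
Let lZ := l2le_majorant Pb0 PC0 Pb_beta small.
Let lZoo := l2le_majorant_lim Pb0 PC0 Pb_beta small.

Lemma weight_ge1 t k : 1 <= E t k.
Proof. by rewrite -expR0 ler_expR divr_ge0// mulr_ge0// ?ler0z// powR_ge0. Qed.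

Lemma cabs_le_weight t k (z : R[i]) : cabs z <= E t k * cabs z.
Proof. by rewrite ler_peMl ?cabs_ge0// weight_ge1. Qed.

Lemma l2le_weight t (v : int -> R[i]) X A : (forall k, E t k * cabs (v k) <= X k) -> l2le X A ->
  l2le (fun k => cabs (v k)) A.
Proof.
move=> vX; apply: l2le_le => k; rewrite cabs_ge0/=.
exact: le_trans (cabs_le_weight t k _) (vX k).
Qed.

(** Polarizing both B and Q in the same way produces two terms on each side, which are compared one
    by one. *)
Lemma cabs_Bq_diff t v v' (X X' : int -> R) A k : k != 0 ->
  (forall k, 0 <= X k <= X' k) -> l2le X' A ->
  (forall k, E t k * cabs (v k) <= X k) -> (forall k, E t k * cabs (v' k) <= X' k) ->
  (forall k, E t k * cabs (v' k - v k) <= X' k - X k) ->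
  E t k * cabs (Bq a v' v' k - Bq a v v k) <=
  2 * Ba a * `|k|%:~R * (Qconv X' X' k - Qconv X X k).
Proof.
move=> k0 XX' lX' vX v'X' dX; have lX := l2le_le XX' lX'.
have lv := l2le_weight vX lX; have lv' := l2le_weight v'X' lX'.
have D : forall j, 0 <= X' j - X j <= X' j.
  by move=> j; have /andP[? ?] := XX' j; rewrite subr_ge0 gerBl; apply/andP; split.
have lD := l2le_le D lX'.
rewrite (BqB a k0 lv' lv' lv lv) (QconvB k XX' lX') mulrDr.
apply: le_trans (ler_wpM2l (ltW (weight_gt0 _ _ _)) (cabsD _ _)) _; rewrite mulrDr; apply: lerD.
  exact: (cabs_Bq a (weight_gt0 sigma t) (weight_sub sigma t) lD lX' dX v'X' k0).
exact: (cabs_Bq a (weight_gt0 sigma t) (weight_sub sigma t) lX lD vX dX k0).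
Qed.

Lemma duhamel_le t k g q : k != 0 -> 0 < t -> Cmeas `]0, t[%classic g ->
  (forall tau, 0 < tau < t -> E tau k * cabs (g tau) <= 2 * Ba a * `|k|%:~R * q) ->
  E t k * cabs (Cintegral leb `]0, t[%classic (fun tau => S (t - tau) k * g tau)) <= picard_const * q.
Proof.
move=> k0 t0 mg gq; have kp : 0 < `|k|%:~R :> R := lt_le_trans ltr01 (abs_ge1 R k0).
have q0 : 0 <= q.
  have Bp : 0 < 2 * Ba a * `|k|%:~R by rewrite !mulr_gt0// ltr_wpDr.
  rewrite -(pmulr_rge0 _ Bp); apply: le_trans (gq (t / 2) _); last by lra.
  by rewrite mulr_ge0 ?cabs_ge0// ltW// weight_gt0.
apply: le_trans (duhamel_bound omega sigma1 k0 t0 mg gq) _.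
rewrite ler_pdivrMr ?lam_gt0//.
rewrite (_ : 4 * expR 1 * (2 * Ba a * `|k|%:~R * q) = picard_const * q * `|k|%:~R); last by rewrite /picard_const; ring.
by apply: ler_wpM2l; [exact: mulr_ge0|exact: lam_ge].
Qed.

Lemma linear_le t k : 0 < t -> E t k * cabs (S t k * c0 k) <= picard_datum k.
Proof.
move=> t0; have [->|k0] := eqVneq k 0; first by rewrite c00 mulr0 cabs0 mulr0.
rewrite cabsM cabs_S mulrA ler_wpM2r ?cabs_ge0//.
have := weight_decay sigma1 k0 (lexx 0) (ltW t0); rewrite subr0 weight0// mulr1 => /le_trans; apply.
rewrite ler_piMr ?expR_ge0// -[leRHS]expR0 ler_expR oppr_le0.
by rewrite mulr_ge0 ?(ltW t0)// divr_ge0// powR_ge0.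
Qed.

(** The value 0 at k = 0 encodes the projection that removes the mean. *)
Definition duhamel_map (v : R -> int -> R[i]) t k : R[i] :=
  if k == 0 then 0 else S t k * c0 k +
    Cintegral leb `]0, t[%classic (fun tau => S (t - tau) k * Bq a (v tau) (v tau) k).

Definition picard n : R -> int -> R[i] := iter n duhamel_map (fun _ _ => 0).

Definition tame (v : R -> int -> R[i]) (X : int -> R) :=
  (forall k, Cmeas `]0, +oo[%classic (v ^~ k)) /\
  (forall t k, 0 < t -> E t k * cabs (v t k) <= X k).

Section Tame.
Variables (v : R -> int -> R[i]) (X : int -> R) (A : R).
Hypotheses (vX : tame v X) (X0 : forall k, 0 <= X k) (lX : l2le X A).

Lemma tame_Bq_le t k : 0 < t -> k != 0 ->
  E t k * cabs (Bq a (v t) (v t) k) <= 2 * Ba a * `|k|%:~R * Qconv X X k.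
Proof.
move=> t0 k0; have [_ h] := vX.
exact: (cabs_Bq a (weight_gt0 sigma t) (weight_sub sigma t) lX lX (fun k => h t k t0) (fun k => h t k t0) k0).
Qed.

Lemma tame_Bq_le1 t k : 0 < t -> k != 0 ->
  cabs (Bq a (v t) (v t) k) <= 2 * Ba a * `|k|%:~R * Qconv X X k.
Proof. by move=> t0 k0; apply: le_trans (cabs_le_weight t k _) (tame_Bq_le t0 k0). Qed.

Lemma tame_Cmeas k : k != 0 -> Cmeas `]0, +oo[%classic (fun t => Bq a (v t) (v t) k).
Proof.
move=> k0; have [mv h] := vX; apply: Cmeas_zsumC => // [j|t].
  by do 2?[apply: Cmeas_mul => //]; exact: Cmeas_cst.
rewrite /= in_itv/= andbT => t0.
exact: (Bterm_summable a (weight_gt0 sigma t) (weight_sub sigma t) lX lX (fun k => h t k t0) (fun k => h t k t0) k0).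
Qed.

Lemma tame_Cmeas_t t k : k != 0 -> Cmeas `]0, t[%classic (fun t => Bq a (v t) (v t) k).
Proof. by move=> k0; apply: Cmeas_sub (tame_Cmeas k0) => //; exact: subset_itvl. Qed.

Lemma tame_Cintegrable t k : k != 0 ->
  Cintegrable leb `]0, t[%classic (fun tau => S (t - tau) k * Bq a (v tau) (v tau) k).
Proof.
move=> k0; apply: (@duhamel_integrable _ _ _ _ _ t
  (fun=> 2 * Ba a * `|k|%:~R * Qconv X X k)); first exact: tame_Cmeas_t.
  exact: integrable_cst_itv.
move=> tau /andP[tau0 taut]; rewrite cabsM cabs_S.
apply: le_trans (_ : 1 * cabs (Bq a (v tau) (v tau) k) <= _); last first.
  by rewrite mul1r; exact: tame_Bq_le1.
rewrite ler_wpM2r ?cabs_ge0// -expR0 ler_expR oppr_le0 mulr_ge0 ?powR_ge0//.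
by rewrite subr_ge0 ltW.
Qed.

Lemma duhamel_map_continuous t k : 0 < t ->
  {for t, continuous (fun t => complex.Re (duhamel_map v t k))} /\
  {for t, continuous (fun t => complex.Im (duhamel_map v t k))}.
Proof.
rewrite /duhamel_map; have [_ _|k0 t0] := eqVneq k 0; first by split; exact: cvg_cst.
exact: (@duhamel_continuous _ _ _ sigma1 _ _ _ k0 _ (tame_Cmeas k0) (fun tau h => tame_Bq_le1 h k0) t t0).
Qed.

Lemma duhamel_map_Cmeas k : Cmeas `]0, +oo[%classic (fun t => duhamel_map v t k).
Proof.
split; apply: open_continuous_measurable_fun; try exact: interval_open.
  by move=> t; rewrite inE/= in_itv/= andbT => t0; have [] := duhamel_map_continuous k t0.
by move=> t; rewrite inE/= in_itv/= andbT => t0; have [] := duhamel_map_continuous k t0.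
Qed.

Lemma duhamel_map_tame : tame (duhamel_map v) (fun k => picard_datum k + picard_const * Qconv X X k).
Proof.
split; first exact: duhamel_map_Cmeas.
move=> t k t0; rewrite /duhamel_map; have [->|k0] := eqVneq k 0.
  rewrite cabs0 mulr0; apply: addr_ge0 => //; apply: mulr_ge0 => //.
  exact: (Qconv_ge0 X0 X0 lX lX).
apply: le_trans (ler_wpM2l (ltW (weight_gt0 _ _ _)) (cabsD _ _)) _; rewrite mulrDr lerD ?linear_le//.
apply: duhamel_le => //; first exact: tame_Cmeas_t.
by move=> tau /andP[tau0 _]; exact: tame_Bq_le.
Qed.

Lemma duhamel_map_conj : (forall t k, 0 < t -> v t (- k) = (v t k)^*) ->
  forall t k, 0 < t -> duhamel_map v t (- k) = (duhamel_map v t k)^*.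
Proof.
move=> vJ t k t0; rewrite /duhamel_map oppr_eq0; have [_|k0] := eqVneq k 0; first by rewrite conjc0.
have [_ h] := vX.
rewrite rmorphD rmorphM SJ c0J; congr (_ + _).
have bJ tau : 0 < tau -> S (t - tau) (- k) * Bq a (v tau) (v tau) (- k) =
   (S (t - tau) k * Bq a (v tau) (v tau) k)^*.
  move=> tau0; have lv := l2le_weight (fun k => h tau k tau0) lX.
  by rewrite rmorphM SJ (Bq_opp a k0 lv lv (fun j => vJ tau j tau0) (fun j => vJ tau j tau0)).
rewrite (@eq_Cint _ _ _ _ (fun tau => (S (t - tau) k * Bq a (v tau) (v tau) k)^*)); last first.
  by move=> tau /=; rewrite in_itv/= => /andP[tau0 _]; exact: bJ.
by rewrite Cint_conj//; exact: tame_Cintegrable.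
Qed.

End Tame.

Lemma duhamel_map_diff v v' X X' A : tame v X -> tame v' X' -> (forall k, 0 <= X k <= X' k) -> l2le X' A ->
  (forall t k, 0 < t -> E t k * cabs (v' t k - v t k) <= X' k - X k) ->
  forall t k, 0 < t -> E t k * cabs (duhamel_map v' t k - duhamel_map v t k) <=
     picard_const * (Qconv X' X' k - Qconv X X k).
Proof.
move=> tv tv' XX' lX' dv t k t0; have lX := l2le_le XX' lX'.
have X0 j : 0 <= X j by have /andP[] := XX' j.
have X'0 j : 0 <= X' j by have /andP[/le_trans] := XX' j; apply.
rewrite /duhamel_map; have [_|k0] := eqVneq k 0.
  rewrite subrr cabs0 mulr0 mulr_ge0// subr_ge0; exact: (ler_Qconv k XX' XX' lX' lX').
rewrite opprD addrACA subrr add0r -CintB//; last 2 first.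
- exact: (tame_Cintegrable tv' lX').
- exact: (tame_Cintegrable tv lX).
rewrite (@eq_Cint _ _ _ _ (fun tau => S (t - tau) k *
    (Bq a (v' tau) (v' tau) k - Bq a (v tau) (v tau) k))); last first.
  by move=> tau _; rewrite mulrBr.
have [_ hv] := tv; have [_ hv'] := tv'.
apply: duhamel_le => //.
  by apply: CmeasB => //; [exact: (tame_Cmeas_t tv' lX')|exact: (tame_Cmeas_t tv lX)].
move=> tau /andP[tau0 _]; apply: (cabs_Bq_diff k0 XX' lX').
- by move=> j; exact: hv.
- by move=> j; exact: hv'.
- by move=> j; exact: dv.
Qed.

Lemma picard_tame n : tame (picard n) (Z n).
Proof.
elim: n => [|n IH]; last exact: (duhamel_map_tame IH (Z0 n) (lZ n)).
split; first by move=> k; exact: Cmeas_cst.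
by move=> t k _; rewrite cabs0 mulr0.
Qed.

Lemma picard_conj n t k : 0 < t -> picard n t (- k) = (picard n t k)^*.
Proof.
elim: n t k => [|n IH] t k t0; first exact/esym/conjc0.
exact: (duhamel_map_conj (picard_tame n) (lZ n) IH).
Qed.

Lemma Z_le n k : 0 <= Z n k <= Z n.+1 k.
Proof. by rewrite Z0 (majorant_leS Pb0 PC0 Pb_beta small). Qed.

Lemma picard_diff n t k : 0 < t -> E t k * cabs (picard n.+1 t k - picard n t k) <= Z n.+1 k - Z n k.
Proof.
elim: n t k => [|n IH] t k t0.
  rewrite !subr0; by have [_ ->] := picard_tame 1.
apply: le_trans (duhamel_map_diff (picard_tame n) (picard_tame n.+1) (Z_le n) (lZ n.+1) IH k t0) _.
by rewrite [leRHS](_ : _ = picard_const * (Qconv (Z n.+1) (Z n.+1) k - Qconv (Z n) (Z n) k))//=; ring.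
Qed.

Lemma picard_diffs n m t k : 0 < t -> (n <= m)%N ->
  E t k * cabs (picard m t k - picard n t k) <= Z m k - Z n k.
Proof.
move=> t0; elim: m => [|m IH]; first by rewrite leqn0 => /eqP ->; rewrite !subrr cabs0 mulr0.
rewrite leq_eqVlt => /orP[/eqP ->|]; first by rewrite !subrr cabs0 mulr0.
rewrite ltnS => /IH h.
have -> : picard m.+1 t k - picard n t k = (picard m.+1 t k - picard m t k) + (picard m t k - picard n t k).
  by rewrite addrA subrK.
apply: le_trans (ler_wpM2l (ltW (weight_gt0 _ _ _)) (cabsD _ _)) _; rewrite mulrDr.
have := picard_diff m k t0; lra.
Qed.

(** An increment of the iterates is at most Z_(n+1) - Z_n in modulus, so adding Z_n makes the
    sequence nondecreasing and bounded. Here f stands for the real or the imaginary part. *)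
Lemma picard_cvg_part (f : R[i] -> R) : (forall z, `|f z| <= cabs z) -> (forall z w, f (z - w) = f z - f w) ->
  forall t k, 0 < t -> cvgn (fun n => f (picard n t k)).
Proof.
move=> fle fB t k t0.
have -> : (fun n => f (picard n t k)) = (fun n => f (picard n t k) + Z n k) - (Z ^~ k).
  by apply/funext => n; rewrite !fctE addrK.
apply: is_cvgB; last exact/cvgP/(majorant_cvg Pb0 PC0 Pb_beta small).
apply: nondecreasing_is_cvgn.
  apply: (homo_leq (@lexx _ _) (@le_trans _ _)) => n.
  have := picard_diff n k t0; move/(le_trans (cabs_le_weight t k _))/(le_trans (fle _)).
  by rewrite fB ler_norml => /andP[]; lra.
exists (Zoo k + Zoo k) => _ [n _ <-]; apply: lerD; last exact: (majorant_le_lim Pb0 PC0 Pb_beta small).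
apply: le_trans (ler_norm _) (le_trans (fle _) _); apply: le_trans (cabs_le_weight t k _) _.
have [_ /(_ t k t0)] := picard_tame n; move/le_trans; apply.
exact: (majorant_le_lim Pb0 PC0 Pb_beta small).
Qed.

Definition picard_lim t k : R[i] :=
  limn (fun n => complex.Re (picard n t k)) +i* limn (fun n => complex.Im (picard n t k)).

Lemma picard_cvg_Re t k : 0 < t -> complex.Re (picard n t k) @[n --> \oo] --> complex.Re (picard_lim t k).
Proof.
move=> t0; suff : cvgn (fun n => complex.Re (picard n t k)) by [].
by apply: picard_cvg_part => //; [exact: Re_le_cabs|move=> z w; rewrite cReD cReN].
Qed.

Lemma picard_cvg_Im t k : 0 < t -> complex.Im (picard n t k) @[n --> \oo] --> complex.Im (picard_lim t k).
Proof.
move=> t0; suff : cvgn (fun n => complex.Im (picard n t k)) by [].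
by apply: picard_cvg_part => //; [exact: Im_le_cabs|move=> z w; rewrite cImD cImN].
Qed.

Lemma cabs_lim_le (u : nat -> R[i]) (z : R[i]) (r : R) :
  complex.Re (u n) @[n --> \oo] --> complex.Re z ->
  complex.Im (u n) @[n --> \oo] --> complex.Im z ->
  (\forall n \near \oo, cabs (u n) <= r) -> cabs z <= r.
Proof.
move=> ur ui ule.
have r0 : 0 <= r by have [n _ /(_ n (leqnn n))] := ule; exact: le_trans (cabs_ge0 _).
rewrite -(@ler_pXn2r _ 2)// ?nnegrE ?cabs_ge0// cabs_sqr.
have cv : complex.Re (u n) ^+ 2 + complex.Im (u n) ^+ 2 @[n --> \oo] --> normsqC z.
  rewrite /normsqC !expr2; under eq_fun do rewrite !expr2.
  by apply: cvgD; apply: cvgM.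
apply: (cvgr_to_le cv); apply: filterS ule => n ule.
by rewrite -[X in X <= _]/(normsqC (u n)) -cabs_sqr lerXn2r ?nnegrE ?cabs_ge0.
Qed.

Lemma picard_lim_diff n t k : 0 < t -> E t k * cabs (picard_lim t k - picard n t k) <= Zoo k - Z n k.
Proof.
move=> t0; rewrite mulrC -ler_pdivlMr ?weight_gt0//.
apply: (@cabs_lim_le (fun m => picard m t k - picard n t k)).
- under eq_fun do rewrite cReD; rewrite cReD.
  by apply: cvgD; [exact: picard_cvg_Re|exact: cvg_cst].
- under eq_fun do rewrite cImD; rewrite cImD.
  by apply: cvgD; [exact: picard_cvg_Im|exact: cvg_cst].
near=> m; rewrite ler_pdivlMr ?weight_gt0// mulrC.
apply: le_trans (_ : Z m k - Z n k <= _).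
  by apply: picard_diffs => //; near: m; exact: nbhs_infty_ge.
by rewrite lerD2r (majorant_le_lim Pb0 PC0 Pb_beta small).
Unshelve. all: by end_near. Qed.

Lemma picard_lim_le t k : 0 < t -> E t k * cabs (picard_lim t k) <= Zoo k.
Proof. by move=> t0; have := picard_lim_diff 0 k t0; rewrite !subr0. Qed.

Lemma picard_lim_tame : tame picard_lim Zoo.
Proof.
split; last by move=> t k; exact: picard_lim_le.
move=> k; split.
  apply: (@measurable_fun_cvg _ _ _ _ (fun n t => complex.Re (picard n t k))).
    by move=> n; have [/(_ k)[]] := picard_tame n.
  by move=> t /=; rewrite in_itv/= andbT; exact: picard_cvg_Re.
apply: (@measurable_fun_cvg _ _ _ _ (fun n t => complex.Im (picard n t k))).
  by move=> n; have [/(_ k)[]] := picard_tame n.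
by move=> t /=; rewrite in_itv/= andbT; exact: picard_cvg_Im.
Qed.

(** Both sides are compared with iterate n + 1, which is the image of iterate n; the two errors are
    dominated by Zoo - Z_(n+1) and by a difference of values of Q, and both tend to 0. *)
Lemma picard_lim_fixed t k : 0 < t -> picard_lim t k = duhamel_map picard_lim t k.
Proof.
move=> t0; apply/eqP; rewrite -subr_eq0; apply/eqP/cabs_eq0/eqP.
rewrite eq_le cabs_ge0 andbT.
have cv : (Zoo k - Z n.+1 k) + picard_const * (Qconv Zoo Zoo k - Qconv (Z n) (Z n) k) @[n --> \oo] --> 0 + picard_const * 0.
  apply: cvgD; last by apply: cvgMr; exact: (Qconv_majorant_cvg Pb0 PC0 Pb_beta small).
  rewrite -(subrr (Zoo k)); apply: cvgB; first exact: cvg_cst.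
  by rewrite (cvg_shiftS (Z ^~ k)); exact: (majorant_cvg Pb0 PC0 Pb_beta small).
rewrite mulr0 addr0 in cv; apply: (cvgr_to_ge cv); near=> n.
apply: le_trans (cabs_le_weight t k _) _.
have -> : picard_lim t k - duhamel_map picard_lim t k = (picard_lim t k - picard n.+1 t k) - (duhamel_map picard_lim t k - duhamel_map (picard n) t k).
  by rewrite opprB addrA (subrK (picard n.+1 t k)).
apply: le_trans (ler_wpM2l (ltW (weight_gt0 _ _ _)) (cabsB _ _)) _; rewrite mulrDr lerD ?picard_lim_diff//.
apply: (duhamel_map_diff (picard_tame n) picard_lim_tame _ lZoo _ k t0) => [j|s j s0]; last exact: picard_lim_diff.
by rewrite Z0 (majorant_le_lim Pb0 PC0 Pb_beta small).
Unshelve. all: by end_near. Qed.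

Lemma picard_lim_conj t k : 0 < t -> picard_lim t (- k) = (picard_lim t k)^*.
Proof.
move=> t0; rewrite /picard_lim; apply: complex_eq; rewrite ?cReJ ?cImJ /=.
  apply/cvg_lim => //; under eq_fun do rewrite picard_conj// cReJ.
  exact: picard_cvg_Re.
apply/cvg_lim => //; under eq_fun do rewrite picard_conj// cImJ.
by apply: cvgN; exact: picard_cvg_Im.
Qed.

Lemma picard_lim0 t : 0 < t -> picard_lim t 0 = 0.
Proof. by move=> t0; rewrite picard_lim_fixed// /duhamel_map eqxx. Qed.

Lemma picard_lim_continuous t k : 0 < t ->
  {for t, continuous (fun t => complex.Re (picard_lim t k))} /\
  {for t, continuous (fun t => complex.Im (picard_lim t k))}.
Proof.
move=> t0; have [cr ci] := duhamel_map_continuous picard_lim_tame lZoo k t0.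
have E1 : \forall s \near t, duhamel_map picard_lim s k = picard_lim s k.
  by near=> s; rewrite -picard_lim_fixed//; near: s; exact: lt_nbhsr.
split; rewrite /prop_for /continuous_at picard_lim_fixed//.
  apply: cvg_trans cr; apply: near_eq_cvg; apply: filterS E1 => s -> //.
by apply: cvg_trans ci; apply: near_eq_cvg; apply: filterS E1 => s -> //.
Unshelve. all: by end_near. Qed.

End Picard.

(** * Fourier series on the circle *)

Section CircleIntegral.
Variable R : realType.
Notation mu := (circle_measure R).
Notation leb := (@lebesgue_measure R).
Notation intg f := (mu.-integrable setT (EFin \o f)).
Implicit Types (f g : R -> R) (M : R).

Lemma circle_measureT : mu setT = (2 * pi : R)%:E.
Proof.
rewrite /circle_measure /= /mrestr/= setTI lebesgue_measure_itv/= lte_fin.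
have p0 := pi_gt0 R; rewrite ifT; last lra.
by rewrite -EFinB; congr EFin; ring.
Qed.

Lemma circle_bounded_integrable f M : measurable_fun (setT : set (measurableTypeR R)) f ->
  (forall x, `|f x| <= M) -> intg f.
Proof.
move=> mf fM; apply: measurable_bounded_integrable => //.
  by rewrite circle_measureT ltry.
exists M; split; [exact: num_real|move=> x Mx y _ /=].
by apply: le_trans (fM y) _; exact: ltW.
Qed.

Lemma circle_integrable f : intg f -> leb.-integrable `[- pi, pi]%classic (EFin \o f) /\
  \int[mu]_x f x = \int[leb]_(x in `[- pi, pi]) f x.
Proof.
move=> If; have m12 A : measurable (A : set (measurableTypeR R)) -> A `<=` `[- pi, pi]%classic -> mu A = leb A.
  by move=> mA AI; rewrite /circle_measure /= /mrestr/= setIidl.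
have If' : mu.-integrable `[- pi, pi]%classic (EFin \o f).
  by apply: (@integrableS _ _ _ mu setT).
split.
  have /integrableP[mf fo] := If'; apply/integrableP; split=> //.
  by rewrite -(@eq_measure_integral _ _ _ _ _ mu).
rewrite /Rintegral (@negligible_integral _ _ _ mu setT (~` `[- pi, pi]%classic))//.
- by rewrite setTD setCK; congr fine; exact: eq_measure_integral.
- exact: measurableC.
- rewrite /circle_measure /= /mrestr/= setICl; exact: measure0.
Qed.

Lemma L2_integrable_sqr f : f \in L2 -> intg (fun x => f x ^+ 2).
Proof. exact: Lfun2_integrable_sqr. Qed.

Lemma L2_measurable f : f \in L2 -> measurable_fun (setT : set (measurableTypeR R)) f.
Proof. by rewrite inE => /andP[]; rewrite inE. Qed.

Lemma L2_normE f : L2_norm f = poweR (\int[mu]_x (f x ^+ 2)%:E)%E 2^-1.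
Proof.
rewrite /L2_norm unlock; congr poweR; apply: eq_integral => x _ /=.
by rewrite powR_mulrn// -normrX ger0_norm ?sqr_ge0.
Qed.

Lemma L2I f : measurable_fun (setT : set (measurableTypeR R)) f -> intg (fun x => f x ^+ 2) -> f \in L2.
Proof.
move=> mf If; rewrite inE; apply/andP; split; rewrite inE//=.
rewrite /finite_norm -/(L2_norm f) L2_normE poweR_lty//.
have /integrableP[_] := If; apply: le_lt_trans.
by under [leRHS]eq_integral => x _ do rewrite /= ger0_norm ?sqr_ge0//.
Qed.

Lemma L2_norm_sqrt f : f \in L2 -> L2_norm f = (Num.sqrt (\int[mu]_x (f x ^+ 2)))%:E.
Proof.
move=> /L2_integrable_sqr If; rewrite L2_normE.
have If0 : 0 <= \int[mu]_x (f x ^+ 2) by apply: Rintegral_ge0 => x _; exact: sqr_ge0.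
rewrite -powR12_sqrt// -poweR_EFin; congr poweR.
by rewrite fineK//; apply: integrable_fin_num.
Qed.

Lemma circle_integrable_le f g : measurable_fun (setT : set (measurableTypeR R)) f ->
  intg g -> (forall x, `|f x| <= g x) -> intg f.
Proof.
by move=> mf Ig fg; apply: (@integrable_le_fun _ mu setT _ f g) => // x _; exact: fg.
Qed.

Lemma circle_integrable_cst (c : R) : intg (fun=> c).
Proof. by apply: (@circle_bounded_integrable _ `|c|) => //; exact: measurable_cst. Qed.

Lemma circle_integrableD f g : intg f -> intg g -> intg (fun x => f x + g x).
Proof. by move=> If Ig; exact: (integrableD measurableT If Ig). Qed.

Lemma L2_integrable f : f \in L2 -> intg f.
Proof.
move=> fL; apply: (@circle_integrable_le _ (fun x => 1 + f x ^+ 2)).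
- exact: L2_measurable.
- apply: circle_integrableD; [exact: circle_integrable_cst|exact: L2_integrable_sqr].
- by move=> x; rewrite ler_norml; apply/andP; split; nra.
Qed.

Lemma L2_mul_integrable f g : f \in L2 -> g \in L2 -> intg (fun x => f x * g x).
Proof. by move=> fL gL; apply/Lfun1_integrable; exact: (Lfun2_mul_Lfun1 fL gL). Qed.

Lemma L2_sub f g : f \in L2 -> g \in L2 -> (fun x => f x - g x) \in L2.
Proof.
move=> fL gL; have mB := measurable_funB (L2_measurable fL) (L2_measurable gL).
apply: L2I => //.
apply: (@circle_integrable_le _ (fun x => 2 * f x ^+ 2 + 2 * g x ^+ 2)).
- exact: measurable_funX.
- by apply: circle_integrableD; apply: integrableZl_fun => //; exact: L2_integrable_sqr.
- move=> x; rewrite ger0_norm ?sqr_ge0//; have := sqr_ge0 (f x + g x); nra.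
Qed.

Lemma bounded_L2 f M : measurable_fun (setT : set (measurableTypeR R)) f ->
  (forall x, `|f x| <= M) -> f \in L2.
Proof.
move=> mf fM; apply: L2I => //; apply: (@circle_bounded_integrable _ (M ^+ 2)).
  exact: measurable_funX.
move=> x; rewrite normrX lerXn2r// nnegrE//; exact: le_trans (fM x).
Qed.

End CircleIntegral.

(** * Characters and Fourier coefficients of integrable functions *)

Section Characters.
Variable R : realType.
Notation mu := (circle_measure R).
Notation leb := (@lebesgue_measure R).
Notation intg f := (mu.-integrable setT (EFin \o f)).
Implicit Types (f g : R -> R) (k j : int) (x : R) (c : int -> R[i]).

Definition ek k x : R[i] := cexp (0 +i* (k%:~R * x)).

Lemma ekE k x : ek k x = cos (k%:~R * x) +i* sin (k%:~R * x).
Proof. by rewrite /ek /cexp /= expR0 mul1r. Qed.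

Lemma ekD k j x : ek (k + j) x = ek k x * ek j x.
Proof. by rewrite /ek -cexpD; congr cexp; apply: complex_eq; rewrite ?cReD ?cImD/= ?addr0// intrD mulrDl. Qed.

Lemma ek_conj k x : (ek k x)^* = ek (- k) x.
Proof. by rewrite !ekE rmorphN/= mulNr cosN sinN. Qed.

Lemma cabs_ek k x : cabs (ek k x) = 1.
Proof. by rewrite cabs_cexp /= expR0. Qed.

Lemma ek0 x : ek 0 x = 1.
Proof. by rewrite ekE mul0r cos0 sin0. Qed.

Lemma continuous_mulz k : continuous (fun x : R => k%:~R * x).
Proof. by move=> x; apply: cvgM; [exact: cvg_cst|exact: cvg_id]. Qed.

Lemma continuous_coskx k : continuous (fun x : R => cos (k%:~R * x)).
Proof. by move=> x; apply: continuous_comp; [exact: continuous_mulz|exact: continuous_cos]. Qed.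

Lemma continuous_sinkx k : continuous (fun x : R => sin (k%:~R * x)).
Proof. by move=> x; apply: continuous_comp; [exact: continuous_mulz|exact: continuous_sin]. Qed.

Lemma measurable_coskx k : measurable_fun (setT : set (measurableTypeR R)) (fun x : R => cos (k%:~R * x)).
Proof. by apply: continuous_measurable_fun; exact: continuous_coskx. Qed.

Lemma measurable_sinkx k : measurable_fun (setT : set (measurableTypeR R)) (fun x : R => sin (k%:~R * x)).
Proof. by apply: continuous_measurable_fun; exact: continuous_sinkx. Qed.

Lemma Cmeas_ek k : Cmeas setT (ek k).
Proof.
split; under eq_fun do rewrite ekE/=; [exact: measurable_coskx|exact: measurable_sinkx].
Qed.

Lemma Cmeas_real f : measurable_fun (setT : set (measurableTypeR R)) f -> Cmeas setT (fun x => (f x)%:C).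
Proof. by move=> mf; split => //=; exact: measurable_cst. Qed.

Lemma fourierE f k : fourier f k = ((2 * pi)^-1)%:C *
  Cintegral mu setT (fun x => (f x)%:C * ek (- k) x).
Proof.
rewrite /fourier; congr (_ * _); apply: eq_Cint => x _; congr (_ * cexp (_ +i* _)).
by rewrite rmorphN/= mulNr.
Qed.

Lemma fourier_integrand f k : intg f -> Cintegrable mu setT (fun x => (f x)%:C * ek (- k) x).
Proof.
move=> If; have /integrableP[/measurable_EFinP mf _] := If.
apply: (@Cintegrable_le _ _ _ _ _ (fun x => `|f x|)) => //.
- by apply: Cmeas_mul; [exact: Cmeas_real|exact: Cmeas_ek].
- exact: integrable_norm If.
- by move=> x _; rewrite cabsM cabs_ek mulr1 cabs_real.
Qed.

Lemma fourier_conj f k : intg f -> fourier f (- k) = (fourier f k)^*.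
Proof.
move=> If; rewrite !fourierE cJM -Cint_conj//; last exact: fourier_integrand.
congr (_ * _); first by rewrite /= oppr0.
apply: eq_Cint => x _; rewrite cJM ek_conj; congr (_ * _).
by rewrite /= oppr0.
Qed.

Lemma fourierB f g k : intg f -> intg g -> fourier (fun x => f x - g x) k = fourier f k - fourier g k.
Proof.
move=> If Ig; rewrite !fourierE -mulrBr -CintB//; try exact: fourier_integrand.
congr (_ * _); apply: eq_Cint => x _; rewrite -mulrBl; congr (_ * _).
by rewrite -rmorphB.
Qed.

Lemma fourier_at0 f : fourier f 0 = ((2 * pi)^-1 * \int[mu]_x f x)%:C.
Proof.
rewrite fourierE oppr0 rmorphM; congr (_ * _).
rewrite (_ : (fun x => _) = (fun x => (f x)%:C)); last first.
  by apply/funext => x; rewrite ek0 mulr1.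
by apply: complex_eq; rewrite //= Rintegral_cst// mul0r.
Qed.

Lemma ae_eq_Rint f g : measurable_fun (setT : set (measurableTypeR R)) f ->
  measurable_fun (setT : set (measurableTypeR R)) g -> f = g %[ae mu] ->
  \int[mu]_x f x = \int[mu]_x g x.
Proof.
move=> mf mg fg; rewrite /Rintegral; congr fine; apply: ae_eq_integral => //.
- exact/measurable_EFinP.
- exact/measurable_EFinP.
- exact: (ae_eq_comp EFin fg).
Qed.

Lemma eq_fourier f g k : f = g %[ae mu] -> measurable_fun (setT : set (measurableTypeR R)) f ->
  measurable_fun (setT : set (measurableTypeR R)) g -> fourier f k = fourier g k.
Proof.
move=> fg mf mg; rewrite !fourierE; congr (_ * _).
have [fr fi] := Cmeas_mul (Cmeas_real mf) (Cmeas_ek (- k)).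
have [gr gi] := Cmeas_mul (Cmeas_real mg) (Cmeas_ek (- k)).
rewrite /Cintegral; congr (_ +i* _); apply: ae_eq_Rint => //.
  exact: (@ae_eq_comp2 _ _ _ mu setT R R (fun x y => complex.Re (y%:C * ek (- k) x)) f g fg).
exact: (@ae_eq_comp2 _ _ _ mu setT R R (fun x y => complex.Im (y%:C * ek (- k) x)) f g fg).
Qed.

End Characters.

(** * Exchange of series and integrals *)

Section SumIntegralExchange.
Variables (R : realType) (mu : {measure set (measurableTypeR R) -> \bar R}).
Variables (D : set R) (mD : measurable (D : set (measurableTypeR R))).

Lemma Rint_sum_seq (I : Type) (r : seq I) (G : R -> I -> R) :
  (forall i, mu.-integrable D (EFin \o (fun x => G x i))) ->
  mu.-integrable D (EFin \o (fun x => \sum_(i <- r) G x i)) /\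
  \int[mu]_(x in D) (\sum_(i <- r) G x i) = \sum_(i <- r) \int[mu]_(x in D) G x i.
Proof.
move=> IG; elim: r => [|i r [IH1 IH2]].
  under eq_fun do rewrite big_nil; split; last by rewrite big_nil Rintegral_cst// mul0r.
  exact: integrable0.
under eq_fun do rewrite big_cons; split; first exact: (integrableD mD (IG i) IH1).
by rewrite big_cons -IH2 -RintegralD.
Qed.

Lemma Rint_dominated (f_ : nat -> R -> R) (f g : R -> R) :
  (forall n, measurable_fun (D : set (measurableTypeR R)) (f_ n)) ->
  (forall x, D x -> f_ ^~ x @ \oo --> f x) -> (forall n x, D x -> `|f_ n x| <= g x) ->
  mu.-integrable D (EFin \o g) ->
  \int[mu]_(x in D) f_ n x @[n --> \oo] --> \int[mu]_(x in D) f x.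
Proof.
move=> mf ff fg ig.
have mf' : measurable_fun (D : set (measurableTypeR R)) f by exact: measurable_fun_cvg mf ff.
have ae1 : {ae mu, forall x, D x -> (fun n => (f_ n x)%:E) @ \oo --> (f x)%:E}.
  by apply: aeW => x Dx; apply: cvg_EFin; [exact: nearW|exact: ff].
have ae2 : {ae mu, forall x n, D x -> (`|(f_ n x)%:E| <= (g x)%:E)%E}.
  by apply: aeW => x n Dx; rewrite /= lee_fin; exact: fg.
have mfE n : measurable_fun (D : set (measurableTypeR R)) (EFin \o f_ n) by exact/measurable_EFinP.
have mfE' : measurable_fun (D : set (measurableTypeR R)) (EFin \o f) by exact/measurable_EFinP.
have [If _ cv] := dominated_convergence mD mfE mfE' ae1 ig ae2.
by apply: fine_cvg; rewrite fineK//; exact: integrable_fin_num.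
Qed.

Lemma Rint_zsum (G : R -> int -> R) (b : int -> R) (h : R -> R) :
  (forall j, measurable_fun (D : set (measurableTypeR R)) (fun x => G x j)) ->
  (forall x j, D x -> `|G x j| <= b j * h x) -> (forall j, 0 <= b j) -> (forall x, D x -> 0 <= h x) ->
  zsummable b -> mu.-integrable D (EFin \o h) ->
  \int[mu]_(x in D) zsum (G x) = zsum (fun j => \int[mu]_(x in D) G x j).
Proof.
move=> mG Gb b0 h0 sb ih; apply/esym/zsum_lim.
have sG x : D x -> zsummable (G x).
  move=> Dx; apply: (@zsummable_le _ _ (fun j => h x * b j)); last exact: zsummableZ.
  by move=> j; rewrite mulrC Gb.
have IG j : mu.-integrable D (EFin \o (fun x => G x j)).
  by apply: (integrable_le_fun mD (mG j) (integrableZl_fun mD (b j) ih)) => x Dx; exact: Gb.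
have -> : psum (fun j => \int[mu]_(x in D) G x j) = (fun n => \int[mu]_(x in D) psum (G x) n).
  apply/funext => n; rewrite psumE -(Rint_sum_seq _ IG).2.
  by apply: eq_Rintegral => x _; rewrite psumE.
apply: (@Rint_dominated _ _ (fun x => zsum b * h x)) => [n|x Dx|n x Dx|].
- by under eq_fun do rewrite psumE; exact: measurable_sum.
- exact/zsum_cvg/sG.
- rewrite psumE; apply: le_trans (ler_norm_sum _ _ _) _.
  apply: (@le_trans _ _ (\sum_(j <- range_int n) b j * h x)).
    by apply: ler_sum => j _; exact: Gb.
  by rewrite -mulr_suml ler_wpM2r ?h0// zsum_ub// range_int_uniq.
- exact: integrableZl_fun.
Qed.

End SumIntegralExchange.

(** * Orthogonality of the characters *)

Section Orthogonality.
Variable R : realType.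
Notation mu := (circle_measure R).
Notation leb := (@lebesgue_measure R).

Lemma sin_natpi (n : nat) : sin (n%:R * pi) = 0 :> R.
Proof.
elim: n => [|n IH]; first by rewrite mul0r sin0.
by rewrite -addn1 natrD mulrDl mul1r sinDpi IH oppr0.
Qed.

Lemma sin_intpi (k : int) : sin (k%:~R * pi) = 0 :> R.
Proof.
case: k => n; first exact: sin_natpi.
by rewrite NegzE rmorphN/= mulNr sinN sin_natpi oppr0.
Qed.

Lemma Rint_FTC (f F : R -> R) (M : R) : continuous f -> (forall x, `|f x| <= M) -> (forall x : R, is_derive x (1 : R) F (f x)) ->
  F (- pi) = F pi -> \int[mu]_x f x = 0.
Proof.
move=> cf fM dF FE.
have p0 := pi_gt0 R; have pp : - pi < pi :> R by lra.
have If : leb.-integrable `[- pi, pi]%classic (EFin \o f).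
  apply: continuous_compact_integrable; first exact: segment_compact.
  exact: continuous_subspaceT.
have cF (x : R) : {for x, continuous F}.
  by apply: differentiable_continuous; apply/derivable1_diffP; have [] := dF x.
have h : \int[leb]_(x in `[- pi, pi]) f x = 0.
  rewrite /Rintegral (@continuous_FTC2 _ f F)//=.
  - by rewrite FE subrr.
  - exact: continuous_subspaceT.
  - split=> [x _||]; first by have [] := dF x.
      exact/cvg_at_right_filter/cF.
    exact/cvg_at_left_filter/cF.
  - by move=> x _; rewrite derive1E; have [_ ->] := dF x.
rewrite (circle_integrable (circle_bounded_integrable _ fM)).2//.
exact: continuous_measurable_fun.
Qed.

Lemma is_derive_coskx (k x : R) : is_derive x (1 : R) (fun x => cos (k * x)) (- sin (k * x) * k).
Proof.
have dG : is_derive x (1 : R) (fun x : R => k * x) k.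
  have -> : (fun x : R => k * x) = (fun x : R => k *: x) by [].
  by apply: is_derive_eq; rewrite /GRing.scale/= mulr1.
exact: (@is_derive1_comp _ (@cos R) _ x _ _ (is_derive_cos _) dG).
Qed.

Lemma is_derive_sinkx (k x : R) : is_derive x (1 : R) (fun x => sin (k * x)) (cos (k * x) * k).
Proof.
have dG : is_derive x (1 : R) (fun x : R => k * x) k.
  have -> : (fun x : R => k * x) = (fun x : R => k *: x) by [].
  by apply: is_derive_eq; rewrite /GRing.scale/= mulr1.
exact: (@is_derive1_comp _ (@sin R) _ x _ _ (is_derive_sin _) dG).
Qed.

Lemma Rint_coskx (k : int) : k != 0 -> \int[mu]_x cos (k%:~R * x) = 0.
Proof.
move=> k0; have kR : k%:~R != 0 :> R by rewrite intr_eq0.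
apply: (@Rint_FTC _ (fun x => (k%:~R)^-1 * sin (k%:~R * x)) 1).
- exact: continuous_coskx.
- by move=> x; rewrite ler_norml cos_geN1 cos_le1.
- move=> x; have := is_deriveZ (k%:~R)^-1 (is_derive_sinkx k%:~R x).
  by rewrite {1}/GRing.scale/= mulrCA mulVf// mulr1.
- by rewrite mulrN sinN sin_intpi oppr0.
Qed.

Lemma Rint_sinkx (k : int) : \int[mu]_x sin (k%:~R * x) = 0.
Proof.
have [->|k0] := eqVneq k 0.
  rewrite (_ : (fun x => _) = cst 0); first by rewrite Rintegral_cst// mul0r.
  by apply/funext => x; rewrite mul0r sin0.
have kR : k%:~R != 0 :> R by rewrite intr_eq0.
apply: (@Rint_FTC _ (fun x => - (k%:~R)^-1 * cos (k%:~R * x)) 1).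
- exact: continuous_sinkx.
- by move=> x; rewrite ler_norml sin_geN1 sin_le1.
- move=> x; have := is_deriveZ (- (k%:~R)^-1) (is_derive_coskx k%:~R x).
  have e : (- (k%:~R)^-1) *: (- sin (k%:~R * x) * k%:~R) = sin (k%:~R * x) :> R.
    by rewrite /GRing.scale/=; field.
  by rewrite e.
- by rewrite mulrN cosN.
Qed.

Lemma fourier1 (k : int) : fourier (fun=> 1 : R) k = if k == 0 then 1 else 0.
Proof.
have [->|k0] := eqVneq k 0.
  rewrite fourier_at0 Rintegral_cst//= mul1r.
  by rewrite (_ : fine _ = 2 * pi) ?mulVf ?mulf_neq0// ?gt_eqF ?pi_gt0//; rewrite circle_measureT.
rewrite fourierE (_ : Cintegral _ _ _ = 0) ?mulr0//.
apply: complex_eq.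
  transitivity (\int[mu]_x cos ((- k)%:~R * x) : R); last by apply: Rint_coskx; rewrite oppr_eq0.
  by apply: eq_Rintegral => x _; rewrite ekE /= mul1r mul0r subr0.
transitivity (\int[mu]_x sin ((- k)%:~R * x) : R); last exact: Rint_sinkx.
by apply: eq_Rintegral => x _; rewrite ekE /= mul1r mul0r addr0.
Qed.

End Orthogonality.

(** * Functions with summable coefficients, Parseval and Bessel *)

Section Synthesis.
Variable R : realType.
Notation mu := (circle_measure R).
Notation intg f := (mu.-integrable setT (EFin \o f)).
Implicit Types (f g : R -> R) (k j : int) (x : R) (c : int -> R[i]).

Definition sterm c x k : R[i] := c k * ek k x.
(** Taking the real part loses nothing under [csym]: by [synthE] the series is then real. *)
Definition synth c x : R := complex.Re (zsumC (sterm c x)).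
Definition csym c := forall k, c (- k) = (c k)^*.

Lemma sterm_summable c x : zsummableC c -> zsummableC (sterm c x).
Proof. by apply: zsummableC_le => k; rewrite cabsM cabs_ek mulr1. Qed.

Lemma synthE c x : zsummableC c -> csym c -> (synth c x)%:C = zsumC (sterm c x).
Proof.
move=> sc cJ; have ss := sterm_summable x sc.
have : zsumC (sterm c x) = (zsumC (sterm c x))^*.
  rewrite -zsumC_conj// -zsumC_opp//; apply: eq_zsumC => k.
  by rewrite cJM ek_conj -cJ.
rewrite /synth; case: (zsumC _) => u v /= [/eqP].
by rewrite -addr_eq0 -mulr2n mulrn_eq0/= => /eqP ->.
Qed.

Lemma synth_bounded c x : zsummableC c -> `|synth c x| <= 2 * zsum (fun k => cabs (c k)).
Proof.
move=> sc; apply: le_trans (Re_le_cabs _) _.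
apply: le_trans (cabs_zsumC (sterm_summable x sc)) _; rewrite ler_wpM2l//.
by rewrite le_eqVlt; apply/orP; left; apply/eqP/eq_zsum => k; rewrite cabsM cabs_ek mulr1.
Qed.

Lemma synth_measurable c : zsummableC c -> measurable_fun (setT : set (measurableTypeR R)) (synth c).
Proof.
move=> sc; have [] : Cmeas setT (fun x => zsumC (sterm c x)).
  apply: Cmeas_zsumC => [k|x _]; last exact: sterm_summable.
  by apply: Cmeas_mul; [exact: Cmeas_cst|exact: Cmeas_ek].
by [].
Qed.

Lemma synth_L2 c : zsummableC c -> synth c \in L2.
Proof.
by move=> sc; apply: bounded_L2 (synth_measurable sc) (fun x => synth_bounded x sc).
Qed.

Lemma Cint_zsumC (G : R -> int -> R[i]) (b : int -> R) (h : R -> R) :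
  (forall j, Cmeas setT (fun x => G x j)) ->
  (forall x j, cabs (G x j) <= b j * h x) -> (forall j, 0 <= b j) -> (forall x, 0 <= h x) ->
  zsummable b -> intg h ->
  Cintegral mu setT (fun x => zsumC (G x)) = zsumC (fun j => Cintegral mu setT (fun x => G x j)).
Proof.
move=> mG Gb b0 h0 sb ih; apply: complex_eq => /=.
  apply: (@Rint_zsum _ mu setT _ (fun x j => complex.Re (G x j)) b h) => //.
    by move=> j; have [] := mG j.
  by move=> x j _; exact: le_trans (Re_le_cabs _) (Gb x j).
apply: (@Rint_zsum _ mu setT _ (fun x j => complex.Im (G x j)) b h) => //.
  by move=> j; have [] := mG j.
by move=> x j _; exact: le_trans (Im_le_cabs _) (Gb x j).
Qed.

Lemma cabs_fourier_le f k : intg f ->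
  cabs (fourier f k) <= (2 * pi)^-1 * (2 * \int[mu]_x `|f x|).
Proof.
move=> If; have /integrableP[/measurable_EFinP mf _] := If.
rewrite fourierE cabsM cabs_real ger0_norm; last by rewrite invr_ge0 mulr_ge0// pi_ge0.
rewrite ler_wpM2l ?invr_ge0 ?mulr_ge0 ?pi_ge0//.
apply: cabs_Cint_le => //.
- by apply: Cmeas_mul; [exact: Cmeas_real|exact: Cmeas_ek].
- exact: integrable_norm If.
- by move=> x _; rewrite cabsM cabs_ek mulr1 cabs_real.
Qed.

(** The series of the second factor converges uniformly, so |f| times a constant dominates the
    termwise integration. *)
Lemma fourier_mul_synth f c k : intg f -> zsummableC c -> csym c ->
  fourier (f \* synth c) k = zsumC (fun j => c j * fourier f (k - j)).
Proof.
move=> If sc cJ; have /integrableP[/measurable_EFinP mf _] := If.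
have sC : zsummableC (fun j => c j * Cintegral mu setT (fun x => (f x)%:C * ek (- (k - j)) x)).
  apply: (@zsummableC_le _ _ (fun j => 2 * (\int[mu]_x `|f x|) * cabs (c j))); last exact: zsummableZ.
  move=> j; rewrite cabsM mulrC ler_wpM2r ?cabs_ge0//; apply: cabs_Cint_le => //.
  - by apply: Cmeas_mul; [exact: Cmeas_real|exact: Cmeas_ek].
  - exact: integrable_norm If.
  - by move=> x _; rewrite cabsM cabs_ek mulr1 cabs_real.
rewrite fourierE.
have -> : Cintegral mu setT (fun x => ((f \* synth c) x)%:C * ek (- k) x) =
   zsumC (fun j => c j * Cintegral mu setT (fun x => (f x)%:C * ek (- (k - j)) x)).
  rewrite (@eq_Cint _ _ _ _ (fun x => zsumC (fun j => c j * ((f x)%:C * ek (- (k - j)) x)))).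
    rewrite (@Cint_zsumC _ (fun j => cabs (c j)) (fun x => `|f x|)) => //.
    - by apply: eq_zsumC => j; rewrite CintZ//; exact: fourier_integrand.
    - move=> j; apply: Cmeas_mul; first exact: Cmeas_cst.
      by apply: Cmeas_mul; [exact: Cmeas_real|exact: Cmeas_ek].
    - by move=> x j; rewrite 2!cabsM cabs_ek mulr1 cabs_real.
    - by move=> j; exact: cabs_ge0.
    - exact: integrable_norm If.
  move=> x _; rewrite /= rmorphM/= synthE//= mulrAC -zsumCZ; last exact: sterm_summable.
  by apply: eq_zsumC => j; rewrite /sterm opprB ekD [ek j x * _]mulrC; ring.
rewrite -zsumCZ//; apply: eq_zsumC => j; rewrite fourierE; ring.
Qed.

Lemma fourier_synth c k : zsummableC c -> csym c -> fourier (synth c) k = c k.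
Proof.
move=> sc cJ; have -> : synth c = (fun=> 1) \* synth c.
  by apply/funext => x; rewrite /= mul1r.
rewrite fourier_mul_synth//; last exact: circle_integrable_cst.
rewrite (@zsumC1 _ _ k); first by rewrite subrr fourier1 eqxx mulr1.
by move=> j jk; rewrite fourier1 subr_eq0 eq_sym (negbTE jk) mulr0.
Qed.

Lemma Rint_fourier0 f : \int[mu]_x f x = 2 * pi * complex.Re (fourier f 0).
Proof. by rewrite fourier_at0/= mulVKf// mulf_neq0// gt_eqF// pi_gt0. Qed.

Lemma normsqCE (z : R[i]) : complex.Re (z * z^*%C) = normsqC z.
Proof. by case: z => u v; rewrite /normsqC /=; ring. Qed.

Lemma Rint_mul_synth f c : intg f -> zsummableC c -> csym c ->
  \int[mu]_x (f x * synth c x) = 2 * pi * zsum (fun j => complex.Re (c j * (fourier f j)^*%C)).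
Proof.
move=> If sc cJ; rewrite (Rint_fourier0 (f \* synth c)) fourier_mul_synth//=.
by congr (_ * _); apply: eq_zsum => j; rewrite sub0r fourier_conj.
Qed.

Lemma parseval_synth c : zsummableC c -> csym c ->
  \int[mu]_x (synth c x ^+ 2) = 2 * pi * zsum (fun j => normsqC (c j)).
Proof.
move=> sc cJ; under eq_Rintegral do rewrite expr2.
rewrite Rint_mul_synth//; last exact/L2_integrable/synth_L2.
by congr (_ * _); apply: eq_zsum => j; rewrite fourier_synth// normsqCE.
Qed.

Lemma finite_support_summable c n : (forall k, (n < `|k|)%N -> c k = 0) -> zsummableC c.
Proof.
move=> c0; exists (\sum_(k <- range_int n.+1) cabs (c k)) => r ur.
under eq_bigr do rewrite ger0_norm ?cabs_ge0//.
rewrite (bigID (mem (range_int n.+1)))/= [X in _ + X]big1 ?addr0; last first.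
  move=> k; rewrite mem_range_int => kn; rewrite c0 ?cabs0//.
  by case: k kn => i; rewrite -leqNgt// => /leq_trans; apply.
rewrite -big_filter; apply: ler_sum_sub; rewrite ?filter_uniq ?range_int_uniq//.
  by move=> k; exact: cabs_ge0.
by move=> k; rewrite mem_filter => /andP[].
Qed.

Lemma Rint_sub_sqr f g : f \in L2 -> g \in L2 ->
  \int[mu]_x ((f x - g x) ^+ 2) =
  \int[mu]_x (f x ^+ 2) - 2 * \int[mu]_x (f x * g x) + \int[mu]_x (g x ^+ 2).
Proof.
move=> fL gL; have If := L2_integrable_sqr fL; have Ig := L2_integrable_sqr gL.
have Ifg := L2_mul_integrable fL gL.
have I2 : intg (fun x => 2 * (f x * g x)) by exact: integrableZl_fun.
have IB : intg (fun x => f x ^+ 2 - 2 * (f x * g x)) by exact: (integrableB measurableT If I2).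
rewrite -RintegralZl// -RintegralB// -RintegralD//; apply: eq_Rintegral => x _; ring.
Qed.

(** With p a truncated Fourier series of f, expand the nonnegative integral of (f - p)^2: the cross
    term and the square of p are both given by the retained coefficients. *)
Lemma bessel f : f \in L2 ->
  ubsum (fun k => normsqC (fourier f k)) ((2 * pi)^-1 * \int[mu]_x (f x ^+ 2)).
Proof.
move=> fL; have If := L2_integrable fL; have p0 : 0 < 2 * pi :> R by rewrite mulr_gt0// pi_gt0.
move=> s us; rewrite mulrC ler_pdivlMr//.
have [n sn] := @sub_range_int s.
(* The truncation is symmetric in k, unlike [range_int n], so that its sum is a real function. *)
pose c k := if (`|k| <= n)%N then fourier f k else 0.
have sc : zsummableC c.
  by apply: (@finite_support_summable _ n) => k; rewrite /c ltnNge => /negbTE ->.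
have cJ : csym c.
  move=> k; rewrite /c abszN; case: ifP => _; first exact: fourier_conj.
  by rewrite conjc0.
have cf j : complex.Re (c j * (fourier f j)^*%C) = normsqC (c j).
  rewrite /c; case: ifP => _; first exact: normsqCE.
  by rewrite mul0r /normsqC/= expr0n addr0.
have snc : zsummable (fun j => normsqC (c j)).
  apply: (zsummable_le _ (@finite_support_summable (fun j => (normsqC (c j))%:C) n _)) => k.
    by rewrite cabs_real.
  by rewrite /c ltnNge => /negbTE -> /=; rewrite /normsqC/= expr0n addr0.
have h0 : 0 <= \int[mu]_x ((f x - synth c x) ^+ 2) by apply: Rintegral_ge0 => x _; exact: sqr_ge0.
have pL := synth_L2 sc.
rewrite Rint_sub_sqr// Rint_mul_synth// parseval_synth// (eq_zsum cf) in h0.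
have h1 : \sum_(k <- s) normsqC (fourier f k) <= zsum (fun j => normsqC (c j)).
  have := @zsum_ub _ _ (fun j => normsqC_ge0 (c j)) snc s us.
  rewrite (eq_big_seq (fun k => normsqC (fourier f k)))// => k /sn.
  rewrite mem_range_int /c; case: k => i; first by move=> /ltnW ->.
  by move=> ->.
have := ler_wpM2l (ltW p0) h1; rewrite [X in X <= _]mulrC; move: h0; lra.
Qed.

End Synthesis.

(** * Uniqueness of Fourier coefficients *)

Section FourierUniqueness.
Variable R : realType.
Notation mu := (circle_measure R).
Notation leb := (@lebesgue_measure R).
Notation intg f := (mu.-integrable setT (EFin \o f)).
Implicit Types (f g : R -> R) (k j : int) (x y : R) (c : int -> R[i]).

Definition null_fourier g := intg g /\ forall k, fourier g k = 0.

(** The functions with vanishing coefficients form a module over absolutely convergent Fourier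
    series, hence over polynomials in [synth c]. *)
Lemma null_fourier_mul g c : null_fourier g -> zsummableC c -> csym c ->
  null_fourier (g \* synth c).
Proof.
move=> [Ig g0] sc cJ; split.
  have /integrableP[/measurable_EFinP mg _] := Ig.
  apply: (@circle_integrable_le _ _ (fun x => (2 * zsum (fun k => cabs (c k))) * `|g x|)).
  - by apply: measurable_funM => //; exact: synth_measurable.
  - by apply: integrableZl_fun => //; exact: integrable_norm Ig.
  - by move=> x; rewrite /= normrM mulrC ler_wpM2r// synth_bounded.
move=> k; rewrite fourier_mul_synth//.
rewrite (@zsumC1 _ _ 0) ?g0 ?mulr0// => j _; by rewrite g0 mulr0.
Qed.

Lemma null_fourierB g h : null_fourier g -> null_fourier h -> null_fourier (fun x => g x - h x).
Proof.
move=> [Ig g0] [Ih h0]; split; first exact: (integrableB measurableT Ig Ih).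
by move=> k; rewrite fourierB// g0 h0 subr0.
Qed.

Lemma null_fourier_pow g c n : null_fourier g -> zsummableC c -> csym c ->
  null_fourier (fun x => g x * synth c x ^+ n).
Proof.
move=> gN sc cJ; elim: n => [|n IH]; first by under eq_fun do rewrite expr0 mulr1.
rewrite (_ : (fun x => _) = (fun x => g x * synth c x ^+ n) \* synth c).
  exact: null_fourier_mul.
by apply/funext => x; rewrite /= exprSr mulrA.
Qed.

Lemma null_fourier_onem_pow g c n m : null_fourier g -> zsummableC c -> csym c ->
  null_fourier (fun x => g x * (1 - synth c x ^+ n) ^+ m).
Proof.
move=> gN sc cJ; elim: m => [|m IH]; first by under eq_fun do rewrite expr0 mulr1.
rewrite (_ : (fun x => _) = (fun x => g x * (1 - synth c x ^+ n) ^+ m -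
   g x * (1 - synth c x ^+ n) ^+ m * synth c x ^+ n)).
  by apply: null_fourierB => //; exact: null_fourier_pow.
by apply/funext => x; rewrite exprSr; ring.
Qed.

Lemma null_fourier_Rint g : null_fourier g -> \int[mu]_x g x = 0.
Proof. by move=> [_ g0]; rewrite Rint_fourier0 g0 mulr0. Qed.

Lemma bernoulli (u : R) n : -1 <= u -> 1 + n%:R * u <= (1 + u) ^+ n.
Proof.
move=> u1; elim: n => [|n IH]; first by rewrite mul0r addr0 expr0.
have u0 : 0 <= 1 + u by lra.
have := ler_wpM2l u0 IH; rewrite exprS -natr1 => /(le_trans _); apply.
rewrite -subr_ge0 [leRHS](_ : _ = n%:R * u ^+ 2); last by ring.
by rewrite mulr_ge0 ?sqr_ge0.
Qed.

(** With z the square root of x, Bernoulli's inequality bounds n z^n, and the other factor z^n tends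
    to 0. *)
Lemma cvg_natmul_expr x : 0 <= x < 1 -> n%:R * x ^+ n @[n --> \oo] --> (0 : R).
Proof.
move=> /andP[x0 x1].
have [->|xn0] := eqVneq x 0.
  rewrite (_ : (fun n => _) = cst 0); first exact: cvg_cst.
  by apply/funext => -[|n]; rewrite ?mul0r// exprS mul0r mulr0.
have xp : 0 < x by rewrite lt_neqAle eq_sym xn0.
pose z := Num.sqrt x; have zp : 0 < z by rewrite sqrtr_gt0.
have z1 : z < 1 by rewrite -sqrtr1 ltr_sqrt.
have zi : 0 < z^-1 - 1 by rewrite subr_gt0 invf_gt1.
have nz n : n%:R * z ^+ n <= (z^-1 - 1)^-1.
  have := @bernoulli (z^-1 - 1) n; rewrite (_ : 1 + (z^-1 - 1) = z^-1); last by ring.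
  rewrite exprVn => h; have {}h : 1 + n%:R * (z^-1 - 1) <= z ^- n by apply: h; lra.
  rewrite -[leRHS]div1r ler_pdivlMr// -mulrA mulrCA -ler_pdivlMl ?exprn_gt0// mulr1.
  apply: le_trans h; lra.
have zn : geometric ((z^-1 - 1)^-1) z n @[n --> \oo] --> (0 : R).
  by apply: cvg_geometric; rewrite ger0_norm// ltW.
apply: squeeze_cvgr (cvg_cst 0) zn; near=> n.
rewrite mulr_ge0 ?exprn_ge0//= (_ : x ^+ n = z ^+ n * z ^+ n).
  by rewrite mulrA /geometric/= ler_wpM2r// exprn_ge0// ltW.
by rewrite -exprMn -expr2 sqr_sqrtr.
Unshelve. all: by end_near. Qed.

(* The polynomials of the Brosowski-Deutsch proof of Stone-Weierstrass: on [0, 1]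
   they converge boundedly to the indicator function of [0, 1/2[. *)
Definition step_poly (n : nat) (x : R) : R := (1 - x ^+ n) ^+ (n * 2 ^ n).

Lemma step_poly_itv n x : 0 <= x <= 1 -> 0 <= step_poly n x <= 1.
Proof.
move=> /andP[x0 x1]; have := exprn_ge0 n x0; have := exprn_ile1 n x0 x1 => h1 h2.
by rewrite /step_poly exprn_ge0 ?exprn_ile1//; lra.
Qed.

(** Below 1/2, Bernoulli gives the lower bound 1 - n (2 x)^n. From 1/2 on, multiply by the same
    power of 1 + x^n, which is at least 1 + n (2 x)^n >= n + 1: the product is a power of 1 - x^(2
    n), hence at most 1. *)
Lemma step_poly_cvg x : 0 <= x <= 1 ->
  step_poly n x @[n --> \oo] --> (if x < 2^-1 then 1 else 0 : R).
Proof.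
move=> x01; have /andP[x0 x1] := x01.
have xn0 n := exprn_ge0 n x0; have xn1 n := exprn_ile1 n x0 x1.
have E n : (n * 2 ^ n)%N%:R * x ^+ n = n%:R * (2 * x) ^+ n :> R.
  by rewrite natrM natrX exprMn mulrA.
case: ifPn => xh.
  have lo : 1 - n%:R * (2 * x) ^+ n @[n --> \oo] --> (1 : R).
    rewrite -[X in _ --> X]subr0; apply: cvgB; first exact: cvg_cst.
    by apply: cvg_natmul_expr; apply/andP; split; lra.
  apply: (squeeze_cvgr _ lo (cvg_cst (1 : R))); near=> n.
  have /andP[_ ->] := step_poly_itv n x01; rewrite andbT -E -mulrN.
  by apply: bernoulli; have := xn1 n; lra.
have h0 : harmonic n @[n --> \oo] --> (0 : R) by exact: cvg_harmonic.
apply: (squeeze_cvgr _ (cvg_cst (0 : R)) h0); near=> n.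
have /andP[-> _] := step_poly_itv n x01; rewrite /harmonic /=.
rewrite -div1r ler_pdivlMr ?ltr0n//.
apply: (@le_trans _ _ (step_poly n x * (1 + x ^+ n) ^+ (n * 2 ^ n))).
  rewrite ler_wpM2l//; first by have /andP[] := step_poly_itv n x01.
  apply: le_trans (bernoulli _ _); last by have := xn0 n; lra.
  rewrite E -natr1 addrC lerD2l -[X in X <= _]mulr1 ler_wpM2l//.
  by rewrite exprn_ege1//; move: xh; rewrite -leNgt; lra.
rewrite /step_poly -exprMn exprn_ile1//.
  by rewrite mulr_ge0//; have := xn0 n; have := xn1 n; lra.
rewrite -subr_ge0 [leRHS](_ : _ = (x ^+ n) ^+ 2); last by ring.
exact: sqr_ge0.
Unshelve. all: by end_near. Qed.

Lemma zsum_finite (u : int -> R) n : (forall k, k \notin range_int n -> u k = 0) -> zsum u = psum u n.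
Proof.
move=> u0; apply: zsum_lim; apply: cvg_near_cst; near=> m.
have nm : (n <= m)%N by near: m; exact: nbhs_infty_ge.
rewrite !psumE (bigID (mem (range_int n)))/= [X in _ + X]big1 ?addr0; last by move=> k; exact: u0.
rewrite -big_filter; apply: perm_big; apply: uniq_perm; rewrite ?filter_uniq ?range_int_uniq//.
move=> k; rewrite mem_filter; case: (boolP (k \in range_int n)) => //=.
by rewrite !mem_range_int; case: k => i /leq_trans ->.
Unshelve. all: by end_near. Qed.

(* Coefficients of x |-> 1/2 + (cos (x - x0) - cos r) / 4, which lies in
   [0, 1] and is at least 1/2 exactly when x is within r of x0 modulo 2 pi. *)
Definition bump_coef (x0 r : R) (k : int) : R[i] :=
  let z := (cos x0 / 8) +i* (- (sin x0 / 8)) in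
  if k == 0 then (2^-1 - cos r / 4)%:C else if k == 1 then z else if k == -1 then z^*%C else 0.

Lemma bump_summable x0 r : zsummableC (bump_coef x0 r).
Proof.
apply: (@finite_support_summable _ _ 1) => k; rewrite /bump_coef.
by case: k => [[|[|n]]|[|n]].
Qed.

Lemma bump_csym x0 r : csym (bump_coef x0 r).
Proof.
move=> k; rewrite /bump_coef oppr_eq0; case: eqP => [_|_]; first by rewrite /= oppr0.
rewrite eqr_oppLR eqr_opp; case: (eqVneq k 1) => [->|_] /=; first by [].
by case: eqP => [_|_]; rewrite /= ?opprK ?oppr0.
Qed.

Lemma synth_bump x0 r x :
  synth (bump_coef x0 r) x = 2^-1 + (cos (x - x0) - cos r) / 4.
Proof.
rewrite /synth /= (@zsum_finite _ 2); last first.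
  move=> k; rewrite mem_range_int => k2.
  by rewrite /sterm (_ : bump_coef x0 r k = 0) ?mul0r//; case: k k2 => [[|[|n]]|[|[|n]]].
have psum2 (u : int -> R) : psum u 2 = u 0 + u (- 1) + (u 1 + u (- 2)).
  by rewrite /psum !big_ord_recr big_ord0/= add0r.
rewrite psum2 /sterm !cReM !ekE.
have -> : bump_coef x0 r (- 2) = 0 by [].
rewrite /bump_coef/= !rmorphN/= mul0r cos0 sin0 mul1r mulN1r cosN sinN cosB expR0.
by field.
Qed.

(** The arc [- pi, y] has midpoint (y - pi) / 2 and half-length (y + pi) / 2; a point lies outside
    exactly when its circular distance to the midpoint exceeds the half-length. *)
Lemma cos_lt_arc x y : - pi <= x < pi -> - pi <= y < pi ->
  (cos (x - (y - pi) / 2) < cos ((y + pi) / 2)) = (y < x).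
Proof.
move=> /andP[x1 x2] /andP[y1 y2]; set r := (y + pi) / 2.
have p0 := pi_gt0 R.
have rI : r \in `[0, pi] by rewrite in_itv/= /r; apply/andP; split; lra.
have [xy|yx] := leP x y.
  have : `|x - (y - pi) / 2| <= r by rewrite ler_norml /r; apply/andP; split; lra.
  rewrite -cos_norm => h; rewrite ltr_cos//; first by rewrite ltNge h.
  rewrite in_itv/= normr_ge0/=; apply: le_trans h _; rewrite /r; lra.
have [t1|t1] := leP (x - (y - pi) / 2) pi.
  rewrite ltr_cos//; last by rewrite in_itv/= t1 andbT; lra.
  by rewrite /r; lra.
(* Beyond pi the distance is measured the other way round the circle, which brings the argument back
   into [0, pi]. *)
have -> : cos (x - (y - pi) / 2) = cos (2 * pi - (x - (y - pi) / 2)).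
  have -> : x - (y - pi) / 2 = (x - (y - pi) / 2 - pi) + pi by ring.
  rewrite [in RHS](_ : 2 * pi - _ = - (x - (y - pi) / 2 - pi) + pi); last by ring.
  by rewrite !cosDpi cosN.
rewrite ltr_cos//; first by rewrite /r; lra.
by rewrite in_itv/=; apply/andP; split; lra.
Qed.

(** The functions f times [step_poly n] of the bump have integral 0 and converge boundedly to f on
    ]y, pi[ and to 0 on the arc; subtracting from the zero total integral leaves the arc. *)
Lemma null_fourier_Rint_itv f y : null_fourier f -> - pi <= y < pi ->
  \int[leb]_(x in `[- pi, y]) f x = 0.
Proof.
move=> fN yI; have /andP[y1 y2] := yI; have p0 := pi_gt0 R.
have If := fN.1; have [Ifl fE] := circle_integrable If.
(* The endpoint pi is left out: as a point of the circle it is - pi, which belongs to the arc. *)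
have Ico : leb.-integrable `[- pi, pi[%classic (EFin \o f).
  by apply: (@integrableS _ _ _ leb `[- pi, pi]%classic) => //; exact: subset_itv_co_cc.
have co g : intg g -> \int[mu]_x g x = \int[leb]_(x in `[- pi, pi[) g x.
  move=> Ig; have [Igl ->] := circle_integrable Ig; rewrite Rintegral_itv_bndo_bndc//.
  by apply: (@integrableS _ _ _ leb `[- pi, pi]%classic) => //; exact: subset_itv_co_cc.
pose c := bump_coef ((y - pi) / 2) ((y + pi) / 2).
pose p := synth c.
have pE x : p x = 2^-1 + (cos (x - (y - pi) / 2) - cos ((y + pi) / 2)) / 4 by exact: synth_bump.
have p01 x : 0 <= p x <= 1.
  rewrite pE; have := cos_geN1 (x - (y - pi) / 2); have := cos_le1 (x - (y - pi) / 2).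
  have := cos_geN1 ((y + pi) / 2); have := cos_le1 ((y + pi) / 2).
  by move=> *; apply/andP; split; lra.
have qN n : null_fourier (fun x => f x * step_poly n (p x)).
  by apply: null_fourier_onem_pow => //; [exact: bump_summable|exact: bump_csym].
have lim0 : \int[leb]_(x in `[- pi, pi[) (f x * step_poly n (p x)) @[n --> \oo] --> (0 : R).
  rewrite (_ : (fun n => _) = cst 0); first exact: cvg_cst.
  by apply/funext => n; rewrite -co ?null_fourier_Rint//; exact: (qN n).1.
have /integrableP[/measurable_EFinP mf _] := Ico.
have lim1 : \int[leb]_(x in `[- pi, pi[) (f x * step_poly n (p x)) @[n --> \oo] -->
    \int[leb]_(x in `[- pi, pi[) (f x * (if p x < 2^-1 then 1 else 0)).
  apply: (@Rint_dominated _ leb _ _ _ _ (fun x => `|f x|)) => // [n|x _|n x _|].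
  - have /integrableP[/measurable_EFinP mq _] := (qN n).1.
    exact: measurable_funTS.
  - by apply: cvgMr; exact: step_poly_cvg.
  - rewrite normrM ler_piMr//; have /andP[h1 h2] := step_poly_itv n (p01 x).
    by rewrite ger0_norm.
  - exact: integrable_norm Ico.
have E1 : \int[leb]_(x in `[- pi, pi[) (f x * (if p x < 2^-1 then 1 else 0)) = 0.
  by rewrite -(cvg_lim (@Rhausdorff R) lim1) (cvg_lim _ lim0).
have E2 : \int[leb]_(x in `]y, pi[) f x = 0.
  rewrite -E1 (_ : `]y, pi[%classic = `[- pi, pi[%classic `&` `]y, pi[%classic); last first.
    by rewrite setIidr//; apply: subset_itvr; rewrite bnd_simp.
  rewrite Rintegral_mkcondr; apply: eq_Rintegral => x; rewrite inE/= in_itv/= => xI.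
  rewrite patchE; have -> : (p x < 2^-1) = (y < x).
    rewrite -(@cos_lt_arc x y)// pE; apply/idP/idP; lra.
  have -> : (x \in `]y, pi[%classic) = (y < x).
    by rewrite mem_setE in_itv/=; have /andP[_ ->] := xI; rewrite andbT.
  by case: ifP => _; rewrite ?mulr1 ?mulr0.
have := @Rintegral_itvB _ f (BLeft (- pi)) (BLeft pi) y Ico.
rewrite !bnd_simp => /(_ y1 y2); rewrite E2 -co// null_fourier_Rint// sub0r.
by move=> /eqP; rewrite oppr_eq0 => /eqP.
Qed.

(** The primitive of f extended by 0 vanishes identically, so Lebesgue's differentiation theorem
    gives f = 0 almost everywhere. *)
Lemma null_fourier_ae0 f : null_fourier f -> f = cst 0 %[ae mu].
Proof.
move=> fN; have p0 := pi_gt0 R; have pp : - pi < pi :> R by lra.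
have If := fN.1; have [Ifl fE] := circle_integrable If.
pose g := f \_ `[- pi, pi]%classic.
have Ig : leb.-integrable setT (EFin \o g).
  rewrite /g -restrict_EFin; apply/integrable_restrict => //=.
  by rewrite setTI.
have F0 y : \int[leb]_(x in `]-oo, y]) g x = 0.
  rewrite /g -Rintegral_mkcondr.
  have [yp|yp] := ltP y (- pi).
    rewrite (_ : _ `&` _ = set0) ?Rintegral_set0//; apply/seteqP; split => // x [] /=.
    rewrite !in_itv/= => xy /andP[h _]; lra.
  have [yp2|yp2] := ltP y pi.
    rewrite (_ : _ `&` _ = `[- pi, y]%classic); first by apply: null_fourier_Rint_itv; rewrite ?yp.
    apply/seteqP; split => x /=; rewrite !in_itv/=.
      by move=> [-> /andP[-> _]].
    by move=> /andP[h1 h2]; split=> //; apply/andP; split=> //; lra.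
  rewrite (_ : _ `&` _ = `[- pi, pi]%classic); first by rewrite -fE null_fourier_Rint.
  apply/seteqP; split => x /=; rewrite !in_itv/=; first by move=> [].
  by move=> /andP[h1 h2]; split; [lra|apply/andP].
have [N [mN N0 sN]] : {ae leb, forall x, g x = 0}.
  have := @FTC1Ny R g.
  have IgS y : leb.-integrable `]-oo, y]%classic (EFin \o g).
    by apply: (@integrableS _ _ _ leb setT).
  move=> /(_ IgS (integrable_locally (measurable_itv _) Ifl)).
  apply: filterS; first exact: (ae_filter_ringOfSetsType leb).
  move=> x [_ <-]; rewrite (_ : (fun y => _) = cst 0) ?derive1_cst//.
  by apply/funext => y; exact: F0.
(* The extension says nothing about f off [- pi, pi], a null set for the circle measure. *)
exists (N `|` ~` `[- pi, pi]%classic); split.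
- by apply: measurableU => //; exact: measurableC.
- apply/eqP; rewrite eq_le measure_ge0 andbT.
  apply: le_trans (measureU2 _ _ _) _ => //; first exact: measurableC.
  rewrite [X in (_ + X)%E](_ : _ = 0%E) ?adde0; last first.
    by rewrite /circle_measure /= /mrestr/= setICl measure0.
  rewrite /circle_measure /= /mrestr/= -N0; apply: le_measure; rewrite ?inE//.
  exact: measurableI.
- move=> x /=; rewrite not_implyE => -[_ fx].
  have [xI|xI] := pselect (x \in `[- pi, pi]); last by right.
  left; apply: sN => /= gx; apply: fx.
  by move: gx; rewrite /g patchE mem_setE xI.
Qed.

End FourierUniqueness.

(** * Tails of the series of n^(- p) *)

Section PowerSeriesTail.
Variable R : realType.
Implicit Types (p q x : R).

(** The integral comparison for the power - (q + 1), obtained from 1 + y <= exp y alone, used at y =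
    - 1 / (x + 1) and y = q / (x + 1). *)
Lemma powR_step q x : 0 < q -> 0 < x ->
  q * (x + 1) `^ (- (q + 1)) <= x `^ (- q) - (x + 1) `^ (- q).
Proof.
move=> q0 x0; have x1 : 0 < x + 1 by rewrite addr_gt0.
have e : x / (x + 1) <= expR (- (x + 1)^-1).
  have := expR_ge1Dx (- (x + 1)^-1); apply: le_trans.
  by rewrite le_eqVlt; apply/orP; left; apply/eqP; field; rewrite gt_eqF.
have xx : 0 < x / (x + 1) by rewrite divr_gt0.
have h : 1 + q / (x + 1) <= (x / (x + 1)) `^ (- q).
  rewrite powRN; apply: le_trans (_ : expR (q / (x + 1)) <= _); first exact: expR_ge1Dx.
  rewrite -[leLHS]invrK lef_pV2 ?posrE ?invr_gt0 ?expR_gt0 ?powR_gt0// -expRN.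
  have := ge0_ler_powR (ltW q0) (ltW xx : _ \is Num.nneg) (expR_ge0 _ : _ \is Num.nneg) e.
  by rewrite -expRM mulNr [_ * q]mulrC.
have -> : x `^ (- q) = (x + 1) `^ (- q) * (x / (x + 1)) `^ (- q).
  by rewrite -powRM ?(ltW xx) ?(ltW x1)// mulrC divfK// gt_eqF.
rewrite -{2}[(x + 1) `^ (- q)]mulr1 -mulrBr.
have -> : q * (x + 1) `^ (- (q + 1)) = (x + 1) `^ (- q) * (q / (x + 1)).
  rewrite opprD powRD; last by apply/implyP => _; rewrite gt_eqF.
  by rewrite powR_inv1 ?(ltW x1)//; ring.
by rewrite ler_wpM2l ?powR_ge0//; lra.
Qed.

(** [powR_step] with q = p - 1 telescopes. *)
Lemma pseries_tail p (N K : nat) : 1 < p -> (0 < N)%N ->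
  (p - 1) * (\sum_(N <= i < K) i.+1%:R `^ (- p)) <= N%:R `^ (1 - p).
Proof.
move=> p1 N0; have [KN|NK] := leqP K N; first by rewrite big_geq// mulr0 powR_ge0.
suff : (p - 1) * (\sum_(N <= i < K) i.+1%:R `^ (- p)) <= N%:R `^ (1 - p) - K%:R `^ (1 - p).
  by have := powR_ge0 (K%:R : R) (1 - p); lra.
have ge m : (N <= m)%N -> (p - 1) * (\sum_(N <= i < m) i.+1%:R `^ (- p)) <= N%:R `^ (1 - p) - m%:R `^ (1 - p).
  elim: m => [|m IH]; first by rewrite leqn0 => /eqP N00; rewrite N00 in N0.
  rewrite leq_eqVlt => /orP[/eqP ->|]; first by rewrite big_geq// mulr0 subrr.
  rewrite ltnS => Nm; rewrite big_nat_recr//= mulrDr; have := IH Nm.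
  have m0 : 0 < m%:R :> R by rewrite ltr0n (leq_trans N0).
  have := @powR_step (p - 1) m%:R; rewrite subr_gt0 => /(_ p1 m0).
  by rewrite subrK natr1 opprB; lra.
exact: ge (ltnW NK).
Qed.

Lemma pseries_bounded p n : 1 < p -> \sum_(0 <= i < n) i.+1%:R `^ (- p) <= 1 + (p - 1)^-1 :> R.
Proof.
move=> p1; case: n => [|n]; first by rewrite big_geq// addr_ge0// invr_ge0; lra.
rewrite big_nat_recl// powR1 lerD2l.
have := @pseries_tail p 1 n.+1 p1 isT; rewrite powR1 big_add1/= => h.
by rewrite -[leRHS]mul1r ler_pdivlMr ?subr_gt0// mulrC.
Qed.

Lemma ubsum_powR p : 1 < p ->
  ubsum (fun k : int => if k == 0 then 0 else `|k|%:~R `^ (- p) : R) (2 * (1 + (p - 1)^-1)).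
Proof.
move=> p1; apply: psum_ubsum => [k|n]; first by case: ifP => // _; exact: powR_ge0.
rewrite /psum big_split/= mulr_natl mulr2n; apply: lerD.
  case: n => [|n]; first by rewrite big_ord0 addr_ge0// invr_ge0; lra.
  rewrite big_ord_recl/= add0r; apply: le_trans (pseries_bounded n p1).
  by rewrite big_mkord.
by apply: le_trans (pseries_bounded n p1); rewrite big_mkord.
Qed.

Lemma natr_powR_small q e : 0 < q -> 0 < e -> exists2 N : nat, (0 < N)%N & N%:R `^ (- q) <= e.
Proof.
move=> q0 e0; pose B := e^-1 `^ q^-1.
have [N BN] : exists N : nat, B < N%:R by exists (Num.bound B); exact: archi_boundP (powR_ge0 _ _).
have N0 : 0 < N%:R :> R by exact: le_lt_trans (powR_ge0 _ _) BN.
exists N; first by rewrite -(ltr0n R).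
rewrite powRN -[leRHS]invrK lef_pV2 ?posrE ?invr_gt0 ?powR_gt0//.
have -> : e^-1 = B `^ q by rewrite /B -powRrM mulVf ?powRr1 ?invr_ge0 ?(ltW e0)// gt_eqF.
by apply: ge0_ler_powR; rewrite ?nnegrE ?powR_ge0 ?(ltW q0) ?(ltW BN) ?(ltW N0).
Qed.

End PowerSeriesTail.

(** * Fourier coefficients of products and of the nonlinearity *)

Section NonlinearityCoefficients.
Variable R : realType.
Notation mu := (circle_measure R).
Implicit Types (f h u : R -> R) (k j : int) (c : int -> R[i]).

Lemma summable_synth_ae f : f \in L2 -> zsummableC (fourier f) -> f = synth (fourier f) %[ae mu].
Proof.
move=> fL sf; have If := L2_integrable fL.
have fJ : csym (fourier f) by move=> k; exact: fourier_conj.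
have Is := L2_integrable (synth_L2 sf).
have : null_fourier (fun x => f x - synth (fourier f) x).
  split; first exact: (integrableB measurableT If Is).
  by move=> k; rewrite fourierB// fourier_synth// subrr.
move=> /null_fourier_ae0; apply: filterS; first exact: (ae_filter_ringOfSetsType mu).
by move=> x /(_ I) /eqP; rewrite subr_eq0 => /eqP.
Qed.

Lemma fourier_mul_summable f h k : f \in L2 -> h \in L2 -> zsummableC (fourier h) ->
  fourier (f \* h) k = zsumC (fun j => fourier h j * fourier f (k - j)).
Proof.
move=> fL hL sh; have If := L2_integrable fL; have Ih := L2_integrable hL.
rewrite -fourier_mul_synth//; last by move=> j; exact: fourier_conj.
apply: eq_fourier.
- exact: (@ae_eq_comp2 _ _ _ mu setT R R (fun x y => f x * y) h _ (summable_synth_ae hL sh)).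
- by apply: measurable_funM; exact: L2_measurable.
- by apply: measurable_funM; [exact: L2_measurable|exact: synth_measurable].
Qed.

Lemma sgz_iv j : j%:~R * iv R j = (sgz j)%:~R.
Proof.
case: j => [[|n]|n]; first by rewrite mul0r.
  by rewrite iv_Posz -pmulrn divff// pnatr_eq0.
by rewrite iv_Negz NegzE rmorphN/= -pmulrn mulNr divff// pnatr_eq0.
Qed.

(** For j nonzero, divide i j u_j = - i sgn(j) f_j by i j; for j = 0 both sides vanish because u has
    zero mean. *)
Lemma velocity_fourier f h u j : f \in L2 -> is_hilbert f h -> is_velocity h u ->
  fourier u j = - ((iv R j)%:C * fourier f j).
Proof.
move=> fL [hL hf] [uL u0 uh]; have [->|j0] := eqVneq j 0.
  by rewrite fourier_at0 u0 mulr0 iv0 mul0r oppr0.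
have jR : j%:~R != 0 :> R by rewrite intr_eq0.
have jC : (0 +i* j%:~R : R[i]) != 0 by rewrite eq_complex/= negb_and jR orbT.
apply: (mulfI jC); have := uh j; rewrite /fourier_dx => ->; rewrite hf.
have -> : 0 +i* (- (sgz j)%:~R) = - ((0 +i* j%:~R) * (iv R j)%:C).
  by apply: complex_eq; rewrite ?cReN ?cImN ?cReM ?cImM /= -?sgz_iv; ring.
rewrite mulNr mulrN; congr (- _); by rewrite -mulrA.
Qed.

Lemma zsummableC_real_mul c (r : int -> R) : (forall k, `|r k| <= 1) -> zsummableC c ->
  zsummableC (fun k => (0 +i* r k) * c k).
Proof.
move=> r1 sc; apply: zsummableC_le sc => k; rewrite cabsM cabs_imag ler_piMl ?cabs_ge0//.
Qed.

Lemma nonlinearity_Bq a f h u k : f \in L2 -> zsummableC (fourier f) ->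
  is_hilbert f h -> is_velocity h u ->
  nonlinearity a f h u k = Bq a (fourier f) (fourier f) k.
Proof.
move=> fL sf hf uh; have [hL hE] := hf; have [uL u0 _] := uh.
have If := L2_integrable fL.
have uE j : fourier u j = - ((iv R j)%:C * fourier f j) by exact: velocity_fourier hf uh.
have sh : zsummableC (fourier h).
  rewrite (_ : fourier h = (fun k => (0 +i* (- (sgz k)%:~R)) * fourier f k)); last exact/funext.
  apply: zsummableC_real_mul => // j; rewrite normrN.
  by case: (j) => [[|n]|n] /=; rewrite ?normr0 ?normrN ?normr1.
have su : zsummableC (fourier u).
  apply: zsummableC_le sf => j; rewrite uE cabsN cabsM cabs_real ger0_norm ?iv_ge0//.
  by rewrite ler_piMl ?cabs_ge0// iv_le1.
pose M : R := (2 * pi)^-1 * (2 * \int[mu]_x `|f x|).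
have bd j : cabs (fourier f j) <= M by exact: cabs_fourier_le.
have sc c : zsummableC c -> zsummableC (fun j => c j * fourier f (k - j)).
  move=> sc; apply: (@zsummableC_le _ _ (fun j => M * cabs (c j))); last exact: zsummableZ.
  by move=> j; rewrite cabsM mulrC ler_wpM2r ?cabs_ge0.
rewrite /nonlinearity /fourier_dx fourier_mul_summable//.
have -> : u \* f = f \* u by apply/funext => x; rewrite /= mulrC.
rewrite fourier_mul_summable// mulrA -!zsumCZ -?zsumCB; try exact: sc; try exact/zsummableCZ/sc.
apply: eq_zsumC => j; rewrite /Bterm hE uE.
have -> : msym a k j = (1 + a)%:C * (0 +i* (- (sgz j)%:~R)) + a%:C * (0 +i* k%:~R) * (iv R j)%:C.
  by apply: complex_eq; rewrite /msym ?cReD ?cImD ?cReM ?cImM /=; ring.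
move: (_%:C) (0 +i* _) (_%:C) (0 +i* _) (_%:C) (fourier f j) (fourier f _) => *; ring.
Qed.

End NonlinearityCoefficients.

(** * Uniqueness of mild solutions at the level of coefficients *)

Section DecayKernel.
Variables (R : realType) (sigma : R).
Hypothesis sigma1 : 1 < sigma.
Notation leb := (@lebesgue_measure R).

(* A majorant of |k| exp(- r |k|^sigma) for |k| <= K whose time integral stays
   bounded as K grows, and is small on short intervals for N large. *)
Definition decay_kernel (N K : nat) (r : R) : R :=
  N%:R + \sum_(N <= i < K) expR (- (r * i.+1%:R `^ sigma)).

Lemma decay_kernel_ge0 N K r : 0 <= decay_kernel N K r.
Proof. by rewrite addr_ge0// sumr_ge0// => i _; exact: expR_ge0. Qed.

(** For n > N write n = N + (n - N): each of the n - N exponentials with N <= i < n is at least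
    exp(- r n^sigma). *)
Lemma decay_kernel_ge N K (n : nat) r : 0 <= r -> (n <= K)%N ->
  n%:R * expR (- (r * n%:R `^ sigma)) <= decay_kernel N K r.
Proof.
move=> r0 nK; have e1 : expR (- (r * n%:R `^ sigma)) <= 1.
  by rewrite -expR0 ler_expR oppr_le0 mulr_ge0// powR_ge0.
have S0 (p q : nat) : 0 <= \sum_(p <= i < q) expR (- (r * i.+1%:R `^ sigma)).
  by rewrite sumr_ge0// => i _; exact: expR_ge0.
have [nN|Nn] := leqP n N.
  apply: (@le_trans _ _ N%:R); last by rewrite lerDl S0.
  apply: (@le_trans _ _ n%:R); first by rewrite ler_piMr.
  by rewrite ler_nat.
rewrite [X in X * _](_ : _ = N%:R + (n - N)%:R); last by rewrite -natrD subnKC// ltnW.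
rewrite mulrDl; apply: lerD.
  by rewrite ler_piMr.
rewrite (big_cat_nat (ltnW Nn) nK)/=; apply: ler_wpDr; first exact: S0.
rewrite mulr_natl -sumr_const_nat; apply: ler_sum_nat => i /andP[Ni ni].
rewrite ler_expR lerN2 ler_wpM2l//; apply: ge0_ler_powR; rewrite ?nnegrE ?ler_nat//.
exact/ltW/(lt_trans ltr01).
Qed.

Lemma integrable_decay_kernel N K a t s :
  leb.-integrable `]a, t[%classic (EFin \o (fun tau => decay_kernel N K (s - tau))).
Proof.
have If i : leb.-integrable `]a, t[%classic
    (EFin \o (fun tau => expR (- ((s - tau) * i.+1%:R `^ sigma)))) by exact: integrable_expdecay.
have [IS _] := Rint_sum_seq (measurable_itv `]a, t[) (index_iota N K) If.
exact: (integrableD_fun (measurable_itv _) (integrable_cst_itv a t N%:R) IS).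
Qed.

(** Each exponential integrates to at most (i + 1)^(- sigma), whatever the interval, and sigma > 1
    bounds the tail of that series uniformly in K. *)
Lemma Rint_decay_kernel N K a t : (0 < N)%N -> a <= t ->
  \int[leb]_(tau in `]a, t[) decay_kernel N K (t - tau) <=
  N%:R * (t - a) + (sigma - 1)^-1 * N%:R `^ (1 - sigma).
Proof.
move=> N0 a_le_t; have If i : leb.-integrable `]a, t[%classic
    (EFin \o (fun tau => expR (- ((t - tau) * i.+1%:R `^ sigma)))) by exact: integrable_expdecay.
have [IS SE] := Rint_sum_seq (measurable_itv `]a, t[) (index_iota N K) If.
rewrite /decay_kernel RintegralD//; last exact: integrable_cst_itv.
rewrite Rint_cst_itv// SE lerD2l -ler_pdivrMl ?invr_gt0 ?subr_gt0// invrK.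
apply: le_trans (pseries_tail K sigma1 N0); rewrite ler_wpM2l ?subr_ge0 ?(ltW sigma1)//.
apply: ler_sum => i _; rewrite powRN; exact: Rint_expdecay.
Qed.

End DecayKernel.

Section CoefficientUniqueness.
Variables (R : realType) (a omega sigma : R).
Hypothesis sigma1 : 1 < sigma.
Notation leb := (@lebesgue_measure R).
Notation S := (semigroup_symbol sigma omega).
Implicit Types (t tau d : R) (k j : int) (v : R -> int -> R[i]).

(** What every solution in the class provides: the l^2 bound M is neither small nor weighted. *)
Definition mild_coef (c0 : int -> R[i]) (M : R) v :=
  [/\ forall t, 0 < t -> l2le (fun k => cabs (v t k)) M,
      forall t, 0 < t -> v t 0 = 0,
      forall t k, 0 < t -> k != 0 ->
        Cmeas `]0, t[%classic (fun tau => S (t - tau) k * Bq a (v tau) (v tau) k) &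
      forall t k, 0 < t -> k != 0 -> v t k = S t k * c0 k +
        Cintegral leb `]0, t[%classic (fun tau => S (t - tau) k * Bq a (v tau) (v tau) k)].

Lemma cabs_Bq1 v1 v2 (X1 X2 : int -> R) A1 A2 t k : k != 0 ->
  (forall j, cabs (v1 t j) <= X1 j) -> (forall j, cabs (v2 t j) <= X2 j) ->
  l2le X1 A1 -> l2le X2 A2 ->
  cabs (Bq a (v1 t) (v2 t) k) <= 2 * Ba a * `|k|%:~R * Qconv X1 X2 k.
Proof.
move=> k0 h1 h2 l1 l2.
have e0 (l : int) : 0 < 1 :> R by [].
have e1 (l j : int) : 1 <= 1 * 1 :> R by rewrite mulr1.
have h1' j : 1 * cabs (v1 t j) <= X1 j by rewrite mul1r.
have h2' j : 1 * cabs (v2 t j) <= X2 j by rewrite mul1r.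
by have := @cabs_Bq R a (fun=> 1) X1 X2 A1 A2 e0 e1 l1 l2 _ _ h1' h2' k k0; rewrite mul1r.
Qed.

Lemma cabs_S_le1 r k : 0 <= r -> cabs (S r k) <= 1.
Proof. by move=> r0; rewrite cabs_S -expR0 ler_expR oppr_le0 mulr_ge0// powR_ge0. Qed.

Lemma mild_coef_integrable c0 M v t k : mild_coef c0 M v -> 0 < t -> k != 0 ->
  Cintegrable leb `]0, t[%classic (fun tau => S (t - tau) k * Bq a (v tau) (v tau) k).
Proof.
move=> [vM _ mv _] t0 k0.
apply: (@Cintegrable_le _ leb _ _ _ (fun=> 2 * Ba a * `|k|%:~R * (4 * (M * M)))) => //.
- exact: mv.
- exact: integrable_cst_itv.
move=> tau /=; rewrite in_itv/= => /andP[tau0 taut]; have vt := vM tau tau0.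
have c0v j : 0 <= cabs (v tau j) by exact: cabs_ge0.
rewrite cabsM; apply: le_trans (_ : 1 * cabs (Bq a (v tau) (v tau) k) <= _).
  by rewrite ler_wpM2r ?cabs_ge0// cabs_S_le1// subr_ge0 ltW.
rewrite mul1r; apply: le_trans (cabs_Bq1 k0 _ _ vt vt) _ => //.
rewrite ler_wpM2l ?mulr_ge0 ?Ba_ge0 ?ler0z//; apply: l2le_pt.
  exact: (Qconv_ge0 c0v c0v vt vt).
exact: l2le_Qconv.
Qed.

Section Difference.
Variables (c0 : int -> R[i]) (M : R) (v1 v2 : R -> int -> R[i]).
Hypotheses (hv1 : mild_coef c0 M v1) (hv2 : mild_coef c0 M v2).

Let D t k := v1 t k - v2 t k.
Let F t tau k := S (t - tau) k * Bq a (v1 tau) (v1 tau) k - S (t - tau) k * Bq a (v2 tau) (v2 tau) k.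
(** A real substitute for |F|, comparable to it within a factor 2, whose integrability follows from
    that of the two parts. *)
Let rho t tau k : R := `|complex.Re (F t tau k)| + `|complex.Im (F t tau k)|.

Let D0 t : 0 < t -> D t 0 = 0.
Proof. by move=> t0; have [_ h1 _ _] := hv1; have [_ h2 _ _] := hv2; rewrite /D h1// h2// subrr. Qed.

Let DE t k : 0 < t -> k != 0 -> D t k = Cintegral leb `]0, t[%classic (fun tau => F t tau k).
Proof.
move=> t0 k0; have [_ _ _ h1] := hv1; have [_ _ _ h2] := hv2.
rewrite /D h1// h2// opprD addrACA subrr add0r -CintB//; [exact: (mild_coef_integrable hv1)|exact: (mild_coef_integrable hv2)].
Qed.

(** The kernel depends on the cutoff K but not on k, so that the l^2 bounds on the two Q-terms
    survive the time integration. *)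
Lemma coef_diff_kernel d t tau k (N K : nat) : 0 <= d -> k != 0 -> (`|k|%N <= K)%N ->
  0 < tau -> tau < t -> l2le (fun j => cabs (D tau j)) d ->
  cabs (F t tau k) <= 2 * Ba a * (decay_kernel sigma N K (t - tau) *
    (Qconv (fun j => cabs (D tau j)) (fun j => cabs (v1 tau j)) k +
     Qconv (fun j => cabs (v2 tau j)) (fun j => cabs (D tau j)) k)).
Proof.
move=> d0 k0 kK tau0 taut lD; have [h1 _ _ _] := hv1; have [h2 _ _ _] := hv2.
have l1 := h1 tau tau0; have l2 := h2 tau tau0; have r0 : 0 <= t - tau by rewrite subr_ge0 ltW.
have cp (w : int -> R[i]) j : 0 <= cabs (w j) by exact: cabs_ge0.
have M0 : 0 <= M by case: l1.
pose A1 := M + d.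
have l1' : l2le (fun j => cabs (v1 tau j)) A1 by apply: l2leW l1 _; rewrite lerDl.
have l2' : l2le (fun j => cabs (v2 tau j)) A1 by apply: l2leW l2 _; rewrite lerDl.
rewrite /F -mulrBr cabsM (BqB a k0 l1' l1' l2' l2').
set G := Qconv _ _ k + _.
have G0 : 0 <= G by rewrite addr_ge0//; [exact: (Qconv_ge0 (cp _) (cp _) lD l1)|exact: (Qconv_ge0 (cp _) (cp _) l2 lD)].
apply: (@le_trans _ _ (cabs (S (t - tau) k) * (2 * Ba a * `|k|%:~R * G))).
  rewrite ler_wpM2l ?cabs_ge0//; apply: le_trans (cabsD _ _) _; rewrite mulrDr; apply: lerD.
    exact: (@cabs_Bq1 (fun=> fun j => D tau j) (fun=> v1 tau) _ _ _ _ tau k k0 (fun=> lexx _) (fun=> lexx _) lD l1).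
  exact: (@cabs_Bq1 (fun=> v2 tau) (fun=> fun j => D tau j) _ _ _ _ tau k k0 (fun=> lexx _) (fun=> lexx _) l2 lD).
rewrite cabs_S [leLHS](_ : _ = 2 * Ba a * ((`|k|%:~R * expR (- ((t - tau) * lam sigma k))) * G)); last by ring.
rewrite ler_wpM2l ?mulr_ge0 ?Ba_ge0//; apply: ler_wpM2r => //.
have kE : `|k|%:~R = `|k|%N%:R :> R by rewrite -abszE pmulrn.
by rewrite /lam kE; apply: decay_kernel_ge.
Qed.

Let Cmeas_F t k : 0 < t -> k != 0 -> Cmeas `]0, t[%classic (fun tau => F t tau k).
Proof.
by move=> t0 k0; have [_ _ h1 _] := hv1; have [_ _ h2 _] := hv2; apply: CmeasB; [exact: h1|exact: h2].
Qed.

Lemma Rint_vanish (f : R -> R) A t : 0 <= A -> (forall tau, 0 < tau <= A -> f tau = 0) ->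
  \int[leb]_(tau in `]0, t[) f tau = \int[leb]_(tau in `]A, t[) f tau.
Proof.
move=> A0 fA; rewrite (_ : `]A, t[%classic = `]0, t[%classic `&` `]A, t[%classic); last first.
  by rewrite setIidr//; apply: subset_itvr; rewrite bnd_simp.
rewrite Rintegral_mkcondr; apply: eq_Rintegral => tau; rewrite inE/= in_itv/= => /andP[t0 tt].
rewrite patchE mem_setE in_itv/= tt andbT; case: ltP => // tA.
by apply: fA; rewrite t0.
Qed.

(** One window of the continuation in time: the solutions agree up to A, their difference is at most
    d on the next window of length T, and theta bounds the time integral of the kernel there. *)
Variables (A T theta d : R) (N : nat).
Hypotheses (A0 : 0 <= A) (vanish : forall tau k, 0 < tau <= A -> D tau k = 0).
Hypotheses (lD : forall tau, A < tau <= A + T -> l2le (fun k => cabs (D tau k)) d).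
Hypotheses (N0 : (0 < N)%N) (T0 : 0 < T).
Hypothesis theta_ge : N%:R * T + (sigma - 1)^-1 * N%:R `^ (1 - sigma) <= theta.
Hypothesis theta_small : 128 * Ba a * M * theta <= 1.

Let F_vanish t tau k : 0 < tau <= A -> F t tau k = 0.
Proof.
move=> tA; rewrite /F; have -> : v1 tau = v2 tau; last by rewrite subrr.
by apply/funext => j; apply/eqP; rewrite -subr_eq0; apply/eqP; exact: vanish.
Qed.

(* Bounding |D_k|^2 by |D_k| int |F_k| and splitting the product by AM-GM replaces
   Minkowski's integral inequality. *)
Lemma coef_halving t : A < t <= A + T -> l2le (fun k => cabs (D t k)) (d / 2).
Proof.
move=> /andP[At tAT]; have t0 : 0 < t by exact: le_lt_trans At.
have [h1 _ _ _] := hv1; have [h2 _ _ _] := hv2.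
have M0 : 0 <= M by have [] := h1 t t0.
have d0 : 0 <= d by have [] : l2le (fun k => cabs (D t k)) d by apply: lD; rewrite At.
have Ba1 : 1 <= Ba a by rewrite /Ba lerDl.
have theta0 : 0 < theta.
  apply: lt_le_trans theta_ge; rewrite ltr_pwDl ?mulr_gt0 ?ltr0n//.
  by rewrite mulr_ge0 ?powR_ge0// invr_ge0 subr_ge0 ltW.
split; first by rewrite divr_ge0.
move=> s us; set X2 := \sum_(k <- s) _.
(* A finite set of frequencies has a largest modulus, which serves as the cutoff; no later bound
   depends on it. *)
have [K sK] : exists K : nat, forall k, k \in s -> (`|k|%N <= K)%N.
  exists (\max_(k <- s) `|k|%N) => k ks; exact: leq_bigmax_seq.
pose psi tau := decay_kernel sigma N K (t - tau).
(* With this value the coefficient 2 (1 + |a|) lambda theta of X2 on the right becomes 1/4, which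
   can be absorbed. *)
pose lambda := (8 * Ba a * theta)^-1.
have lambda0 : 0 < lambda by rewrite invr_gt0 !mulr_gt0//; lra.
(* 8 M d = 4 d M + 4 M d bounds the l^2 norm of the two Q-terms together. *)
pose G2 := (8 * M * d) ^+ 2.
pose h tau := 2 * Ba a * (lambda * X2 + G2 / lambda) * psi tau.
have rho_le tau : A < tau < t -> \sum_(k <- s) cabs (D t k) * rho t tau k <= h tau.
  move=> /andP[Atau taut]; have tau0 : 0 < tau by exact: le_lt_trans Atau.
  have lDt : l2le (fun k => cabs (D tau k)) d by apply: lD; rewrite Atau/= (le_trans (ltW taut)).
  have cp (w : int -> R[i]) j : 0 <= cabs (w j) by exact: cabs_ge0.
  pose g k := Qconv (fun j => cabs (D tau j)) (fun j => cabs (v1 tau j)) k +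
     Qconv (fun j => cabs (v2 tau j)) (fun j => cabs (D tau j)) k.
  have lg : l2le g (8 * M * d).
    apply: l2leW (_ : l2le g (4 * (d * M) + 4 * (M * d))) _; last by rewrite le_eqVlt; apply/orP; left; apply/eqP; ring.
    apply: l2leD; [exact: (Qconv_ge0 (cp _) (cp _) lDt (h1 tau tau0))|exact: (Qconv_ge0 (cp _) (cp _) (h2 tau tau0) lDt)|..].
      exact: (l2le_Qconv (cp _) (cp _) lDt (h1 tau tau0)).
    exact: (l2le_Qconv (cp _) (cp _) (h2 tau tau0) lDt).
  have psi0 : 0 <= psi tau by exact: decay_kernel_ge0.
  apply: (@le_trans _ _ (\sum_(k <- s) 2 * Ba a * psi tau * (lambda * cabs (D t k) ^+ 2 + g k ^+ 2 / lambda))).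
    rewrite !big_seq; apply: ler_sum => k ks.
    have [->|k0] := eqVneq k 0.
      rewrite D0// cabs0 mul0r !mulr_ge0//; first by lra.
      by apply: addr_ge0; [apply: mulr_ge0|apply: divr_ge0]; rewrite ?sqr_ge0 ?(ltW lambda0).
    have rF : rho t tau k <= 2 * (2 * Ba a * (psi tau * g k)).
      apply: le_trans (_ : 2 * cabs (F t tau k) <= _).
        rewrite mulr_natl mulr2n; apply: lerD; [exact: Re_le_cabs|exact: Im_le_cabs].
      rewrite ler_wpM2l//; exact: coef_diff_kernel (sK k ks) tau0 taut lDt.
    apply: le_trans (ler_wpM2l (cabs_ge0 _) rF) _.
    rewrite -subr_ge0 [leRHS](_ : _ = 2 * Ba a * psi tau * lambda * (cabs (D t k) - g k / lambda) ^+ 2).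
      by rewrite mulr_ge0 ?sqr_ge0// !mulr_ge0// ?(ltW lambda0)//; lra.
    by field; rewrite gt_eqF.
  rewrite -mulr_sumr big_split/= -mulr_sumr -mulr_suml -/X2 /h mulrAC.
  rewrite ler_wpM2r// ler_wpM2l ?mulr_ge0 ?Ba_ge0// lerD2l; apply: ler_wpM2r; first by rewrite invr_ge0 ltW.
  by have [_ /(_ s us)] := lg.
have IF k : k != 0 -> leb.-integrable `]0, t[%classic (EFin \o (fun tau => rho t tau k)).
  move=> k0; have [I1r I1i] := mild_coef_integrable hv1 t0 k0.
  have [I2r I2i] := mild_coef_integrable hv2 t0 k0.
  apply: integrableD_fun => //.
    apply: (@integrable_norm _ _ _ leb `]0, t[%classic (fun tau => complex.Re (F t tau k))).
    rewrite (_ : _ \o _ = EFin \o (fun tau => complex.Re (S (t - tau) k * Bq a (v1 tau) (v1 tau) k) +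
       (- 1) * complex.Re (S (t - tau) k * Bq a (v2 tau) (v2 tau) k))).
      by apply: integrableD_fun => //; exact: integrableZl_fun.
    by apply/funext => tau; congr EFin; rewrite /F cReD cReN mulN1r.
  apply: (@integrable_norm _ _ _ leb `]0, t[%classic (fun tau => complex.Im (F t tau k))).
  rewrite (_ : _ \o _ = EFin \o (fun tau => complex.Im (S (t - tau) k * Bq a (v1 tau) (v1 tau) k) +
       (- 1) * complex.Im (S (t - tau) k * Bq a (v2 tau) (v2 tau) k))).
    by apply: integrableD_fun => //; exact: integrableZl_fun.
  by apply/funext => tau; congr EFin; rewrite /F cImD cImN mulN1r.
have I0 k : leb.-integrable `]0, t[%classic (EFin \o (fun tau => cabs (D t k) * rho t tau k)).
  have [->|k0] := eqVneq k 0; last by apply: integrableZl_fun => //; exact: IF.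
  rewrite D0// cabs0 (_ : (fun tau => _) = cst 0); first exact: integrable_cst_itv.
  by apply/funext => tau; rewrite mul0r.
have X_le k : cabs (D t k) ^+ 2 <= \int[leb]_(tau in `]0, t[) (cabs (D t k) * rho t tau k).
  have [->|k0] := eqVneq k 0.
    by rewrite D0// cabs0 expr0n; apply: Rintegral_ge0 => tau _; rewrite mul0r.
  rewrite RintegralZl//; last exact: IF.
  rewrite expr2 ler_wpM2l ?cabs_ge0//.
  have [I1r I1i] := mild_coef_integrable hv1 t0 k0.
  have mF := Cmeas_F t0 k0; have [mr mi] := mF.
  rewrite {1}DE//; apply: le_trans (cabs_le_ReIm _) _.
  have In : leb.-integrable `]0, t[%classic (EFin \o (fun tau => `|complex.Re (F t tau k)|)).
    apply: (integrable_le_fun _ _ (IF k k0)) => //.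
      by apply: measurableT_comp.
    by move=> tau _; rewrite normr_id lerDl.
  have In' : leb.-integrable `]0, t[%classic (EFin \o (fun tau => `|complex.Im (F t tau k)|)).
    apply: (integrable_le_fun _ _ (IF k k0)) => //.
      by apply: measurableT_comp.
    by move=> tau _; rewrite normr_id lerDr.
  rewrite /rho RintegralD//; apply: lerD; apply: ler_norm_Rint => //.
have [I1 E1] := Rint_sum_seq (measurable_itv `]0, t[) s I0.
have Ih : leb.-integrable `]A, t[%classic (EFin \o h).
  by apply: integrableZl_fun => //; exact: integrable_decay_kernel.
have X2_le : X2 <= 2 * Ba a * (lambda * X2 + G2 / lambda) * theta.
  apply: le_trans (ler_sum _ (fun k _ => X_le k)) _; rewrite -E1 (@Rint_vanish _ A)//; last first.
    by move=> tau tA; rewrite big1// => k _; rewrite /rho F_vanish//= normr0 addr0 mulr0.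
  apply: le_trans (_ : \int[leb]_(tau in `]A, t[) h tau <= _).
    apply: le_Rintegral => //.
    by apply: (@integrableS _ _ _ leb `]0, t[%classic) => //; apply: subset_itvr; rewrite bnd_simp.
  rewrite RintegralZl//; last exact: integrable_decay_kernel.
  have X20 : 0 <= X2 by rewrite sumr_ge0// => k _; exact: sqr_ge0.
  apply: ler_wpM2l.
    apply: mulr_ge0; first by rewrite mulr_ge0 ?Ba_ge0.
    apply: addr_ge0; first exact: (mulr_ge0 (ltW lambda0)).
    by apply: divr_ge0; rewrite ?sqr_ge0 ?(ltW lambda0).
  apply: le_trans (Rint_decay_kernel sigma1 K N0 (ltW At)) _; apply: le_trans theta_ge.
  by rewrite lerD2r ler_wpM2l ?ler0n//; lra.
have e1 : 2 * Ba a * (lambda * X2 + G2 / lambda) * theta = X2 / 4 + 16 * (Ba a * theta) ^+ 2 * G2.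
  by rewrite /lambda; field; rewrite !gt_eqF//; lra.
rewrite e1 in X2_le.
(* The smallness of theta gives X2 <= X2 / 4 + d^2 / 16, hence X2 <= d^2 / 12, which is below (d /
   2)^2. *)
have e2 : (32 * Ba a * M * theta * d) ^+ 2 <= (d / 4) ^+ 2.
  have h0 : 0 <= 32 * Ba a * M * theta by rewrite !mulr_ge0 ?Ba_ge0// ltW.
  rewrite lerXn2r ?nnegrE ?(mulr_ge0 h0) ?divr_ge0//.
  by rewrite [leRHS]mulrC ler_wpM2r//; have := theta_small; lra.
have e3 : 16 * (Ba a * theta) ^+ 2 * G2 = (32 * Ba a * M * theta * d) ^+ 2 by rewrite /G2; ring.
rewrite e3 in X2_le; move: X2_le e2; rewrite !exprMn; have := sqr_ge0 d; lra.
Qed.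

End Difference.

(** Two nested inductions: over consecutive windows of length T and, within a window, over repeated
    halvings of the bound. As T depends only on M, a and sigma, the windows exhaust all times. *)
Lemma mild_coef_unique c0 M v1 v2 : mild_coef c0 M v1 -> mild_coef c0 M v2 ->
  forall t k, 0 < t -> v1 t k = v2 t k.
Proof.
move=> hv1 hv2; have [h1 _ _ _] := hv1; have [h2 _ _ _] := hv2.
have M0 : 0 <= M by have [] := h1 1 ltr01.
have Ba1 : 1 <= Ba a by rewrite /Ba lerDl.
(* M + 1 instead of M keeps theta positive when M = 0. *)
pose theta := (128 * Ba a * (M + 1))^-1.
have theta0 : 0 < theta by rewrite invr_gt0 !mulr_gt0//; lra.
have sig0 : 0 < sigma - 1 by rewrite subr_gt0.
(* N makes the tail part of the kernel integral at most theta / 2; then T is chosen so that the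
   constant part N T equals theta / 2. *)
have [N N0 hN] : exists2 N : nat, (0 < N)%N & N%:R `^ (- (sigma - 1)) <= (sigma - 1) * (theta / 2).
  by apply: natr_powR_small => //; rewrite mulr_gt0// divr_gt0.
have NR : 0 < N%:R :> R by rewrite ltr0n.
pose T := theta / 2 / N%:R.
have T0 : 0 < T by rewrite !divr_gt0.
have theta_ge : N%:R * T + (sigma - 1)^-1 * N%:R `^ (1 - sigma) <= theta.
  rewrite /T mulrC divfK ?gt_eqF// -(opprB sigma 1).
  rewrite [leRHS](splitr theta) lerD2l -ler_pdivlMl ?invr_gt0// invrK //.
have theta_small : 128 * Ba a * M * theta <= 1.
  rewrite /theta ler_pdivrMr ?mul1r; last by rewrite !mulr_gt0//; lra.
  by rewrite ler_wpM2l ?mulr_ge0 ?Ba_ge0//; lra.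
have step n tau k : 0 < tau <= n%:R * T -> v1 tau k - v2 tau k = 0.
  elim: n tau k => [|n IH] tau k; first by rewrite mul0r => /andP[/lt_le_trans h /h]; rewrite ltxx.
  move=> /andP[tau0 tauT]; have [tn|tn] := leP tau (n%:R * T); first by apply: IH; rewrite tau0.
  have A0 : 0 <= n%:R * T by rewrite mulr_ge0// ltW.
  (* The starting bound is the trivial one, M + M. *)
  have halve m s : n%:R * T < s <= n%:R * T + T ->
      l2le (fun k => cabs (v1 s k - v2 s k)) ((M + M) / 2 ^+ m).
    elim: m s => [|m IHm] s sI.
      have s0 : 0 < s by case/andP: sI => /(le_lt_trans A0).
      rewrite expr0 divr1; apply: l2le_le (l2leD _ _ (h1 s s0) (h2 s s0)) => j; try exact: cabs_ge0.
      by rewrite cabs_ge0/= cabsB.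
    have -> : (M + M) / 2 ^+ m.+1 = (M + M) / 2 ^+ m / 2.
      by rewrite exprSr invfM mulrA.
    exact: (coef_halving hv1 hv2 A0 IH IHm N0 T0 theta_ge theta_small sI).
  apply/cabs_eq0/eqP; rewrite eq_le cabs_ge0 andbT.
  have cv : geometric (M + M) (2^-1) m @[m --> \oo] --> (0 : R).
    by apply: cvg_geometric; rewrite ger0_norm//; lra.
  apply: (cvgr_to_ge cv); near=> m; rewrite /geometric/= exprVn.
  apply: (@l2le_pt _ (fun k => cabs (v1 tau k - v2 tau k))); first by move=> j; exact: cabs_ge0.
  by apply: halve; rewrite tn/=; move: tauT; rewrite -natr1 mulrDl mul1r.
move=> t k t0; apply/eqP; rewrite -subr_eq0; apply/eqP.
apply: (step (Num.bound (t / T))); rewrite t0/= -ler_pdivrMr//.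
by apply/ltW/archi_boundP; rewrite divr_ge0 ?ltW.
Unshelve. all: by end_near. Qed.

End CoefficientUniqueness.

(** * Mild solutions as functions on the circle *)

Section NormConversions.
Variable R : realType.
Implicit Types (f g : int -> R) (c : int -> R[i]) (M A : R).

Lemma esum_ubsum f M : ubsum f M -> (\esum_(k in [set: int]) (f k)%:E <= M%:E)%E.
Proof.
move=> fM; apply: ge_ereal_sup => _ [D [fD _] <-].
by rewrite fsbig_finite// sumEFin lee_fin fM// finmap.fset_uniq.
Qed.

Lemma ubsum_esum f : (\esum_(k in [set: int]) (f k)%:E < +oo)%E -> exists M, ubsum f M.
Proof.
move=> foo; exists (fine (\esum_(k in [set: int]) (f k)%:E)) => s us.
have h : ((\sum_(k <- s) f k)%:E <= \esum_(k in [set: int]) (f k)%:E)%E.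
  rewrite -sumEFin fsbig_seq//; apply: ereal_sup_ubound; exists [set` s] => //.
  by split => //; exact: finite_seq.
rewrite -lee_fin fineK//; apply: fin_real.
by rewrite foo andbT (lt_le_trans _ h)// ltNyr.
Qed.

Lemma poweR_half_le (x : \bar R) A : (0 <= x)%E -> 0 <= A -> (x <= (A ^+ 2)%:E)%E ->
  (poweR x 2^-1 <= A%:E)%E.
Proof.
move=> x0 A0 xA.
have -> : A%:E = poweR (A ^+ 2)%:E 2^-1.
  by rewrite poweR_EFin powR12_sqrt ?sqr_ge0// sqrtr_sqr ger0_norm.
apply: gt0_ler_poweR => //; rewrite in_itv/= leey andbT//.
by rewrite lee_fin sqr_ge0.
Qed.

Lemma l2_norm_le c A : l2le (fun k => cabs (c k)) A -> (l2_norm c <= A%:E)%E.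
Proof.
move=> [A0 cA]; apply: poweR_half_le => //.
  by apply: esum_ge0 => k _; rewrite lee_fin normsqC_ge0.
by apply: esum_ubsum; apply: ubsum_le cA => k; rewrite cabs_sqr.
Qed.

(** The integral of a nonnegative function is a supremum over simple functions below it, and those
    below F are below the constant; this spares the measurability of tau |-> [l2_norm (F tau)]. *)
Lemma integral_le_cst (mu : {measure set (measurableTypeR R) -> \bar R}) (D : set R)
    (F : R -> \bar R) M : measurable (D : set (measurableTypeR R)) -> 0 <= M ->
  (forall x, D x -> (0 <= F x <= M%:E)%E) ->
  (\int[mu]_(x in D) F x <= M%:E * mu D)%E.
Proof.
move=> mD M0 FM.
have F0 x : D x -> (0 <= F x)%E by move=> /FM/andP[].
rewrite -integral_cst// !ge0_integralE//.
  by apply: le_ereal_sup => _ [h /= hF <-]; exists h => //= x; apply: le_trans (hF x) _;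
    rewrite !patchE; case: ifPn => // /set_mem /FM /andP[].
Qed.

End NormConversions.

(** * From Sobolev and L^2 norms to coefficients and back *)

Section SobolevSummable.
Variable R : realType.
Notation mu := (circle_measure R).

(** AM-GM bounds |f_k| by half of |k|^(- 2 eta) + |k|^(2 eta) |f_k|^2, and the first family is
    summable as 2 eta > 1. The zero mean takes care of k = 0. *)
Lemma sobolev_summable (eta : R) (f : R -> R) : 2^-1 < eta -> f \in L2 -> zero_mean f ->
  (sobolev_norm eta f < +oo)%E -> zsummableC (fourier f).
Proof.
move=> eta2 fL f0 fs.
have [M hM] : exists M, ubsum (fun k => powR `|k|%:~R (2 * eta) * normsqC (fourier f k)) M.
  by apply: ubsum_esum; apply: lty_poweRy fs; rewrite invr_neq0.
have p1 : 1 < 2 * eta by lra.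
have h := ubsumZ (_ : 0 <= 2^-1 :> R) (ubsumD (ubsum_powR p1) hM).
apply: (@ubsum_zsummable _ _ _ (fun k => cabs_ge0 (fourier f k)) (ubsum_le _ (h _))); last by lra.
move=> k; have [->|k0] := eqVneq k 0.
  rewrite fourier_at0 f0 mulr0 cabs0 add0r mulr_ge0 ?invr_ge0//.
  by rewrite mulr_ge0 ?powR_ge0// normsqC_ge0.
rewrite powRN -cabs_sqr; have kp := lt_le_trans ltr01 (abs_ge1 R k0).
set q := powR _ _; have q0 : 0 < q by exact: powR_gt0.
rewrite -subr_ge0 [leRHS](_ : _ = 2^-1 * q * (cabs (fourier f k) - q^-1) ^+ 2).
  by rewrite mulr_ge0 ?sqr_ge0// mulr_ge0// ltW.
by field; rewrite gt_eqF.
Qed.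

(** The factor 1 / (2 pi) of Bessel's inequality is below 1 and is dropped, so a small L^2 norm is
    at once a small l^2 norm of the coefficients. *)
Lemma bessel_l2le (f : R -> R) : f \in L2 ->
  l2le (fun k => cabs (fourier f k)) (Num.sqrt (\int[mu]_x (f x ^+ 2))).
Proof.
move=> fL; split; first exact: sqrtr_ge0.
have I0 : 0 <= \int[mu]_x (f x ^+ 2) by apply: Rintegral_ge0 => x _; exact: sqr_ge0.
rewrite sqr_sqrtr//; have b := bessel fL.
apply: (@ubsum_le _ _ (fun k => normsqC (fourier f k))) => [k|]; first by rewrite cabs_sqr.
apply: le_ubsum b _; rewrite ler_piMl// invf_le1 ?mulr_gt0 ?pi_gt0//.
by have := pi_ge2 R; lra.
Qed.

Lemma L2_norm_synth_le c A : zsummableC c -> csym c -> l2le (fun k => cabs (c k)) A ->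
  (L2_norm (@synth R c) <= (Num.sqrt (2 * pi) * A)%:E)%E.
Proof.
move=> sc cJ [A0 cA]; have sL := synth_L2 sc.
rewrite L2_norm_sqrt// parseval_synth// lee_fin.
have -> : Num.sqrt (2 * pi) * A = Num.sqrt (2 * pi * A ^+ 2).
  by rewrite [RHS]sqrtrM ?mulr_ge0 ?pi_ge0// sqrtr_sqr ger0_norm.
rewrite ler_wsqrtr// ler_wpM2l ?mulr_ge0 ?pi_ge0//.
have nA : ubsum (fun k => normsqC (c k)) (A ^+ 2).
  by apply: ubsum_le cA => k; rewrite cabs_sqr.
apply: (ubsum_zsum _ nA); exact: ubsum_zsummable (fun k => normsqC_ge0 (c k)) nA.
Qed.

End SobolevSummable.

Lemma synthB (R : realType) (c d : int -> R[i]) x : zsummableC c -> zsummableC d ->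
  synth (fun k => c k - d k) x = synth c x - synth d x.
Proof.
move=> sc sd; rewrite /synth -cReN -cReD -zsumCB; try exact: sterm_summable.
by congr complex.Re; apply: eq_zsumC => k; rewrite /sterm mulrBl.
Qed.

(** * Powers of k against the exponential weight *)

Section WeightDecay.
Variables (R : realType) (sigma : R).
Hypothesis sigma1 : 1 < sigma.
Implicit Types (t : R) (k : int).

(** With y = |k| t^(1 / sigma) this is y^eta <= 1 + y <= 2 exp(y / 2). *)
Lemma weight_pow (eta t : R) k : 0 < eta -> eta <= 1 -> 0 < t ->
  t `^ (eta / sigma) * `|k|%:~R `^ eta <= 2 * weight sigma t k.
Proof.
move=> eta0 eta1 t0; have k0 : 0 <= `|k|%:~R :> R by rewrite ler0z.
have y0 : 0 <= `|k|%:~R * t `^ sigma^-1 by rewrite mulr_ge0// powR_ge0.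
rewrite mulrC [eta / sigma]mulrC powRrM -powRM ?powR_ge0//.
apply: le_trans (powR_le_1D y0 eta0 eta1) _.
have := expR_ge1Dx (`|k|%:~R * t `^ sigma^-1 / 2); rewrite /weight; lra.
Qed.

Lemma abs_weight_inv t k : 0 < t -> `|k|%:~R / weight sigma t k <= 2 * t `^ (- sigma^-1).
Proof.
move=> t0; have := @weight_pow 1 t k ltr01 (lexx 1) t0.
rewrite powRr1 ?ler0z// div1r => h.
rewrite ler_pdivrMr ?weight_gt0// powRN -mulrA mulrCA -ler_pdivrMl ?invr_gt0 ?powR_gt0//.
by rewrite invrK.
Qed.

Lemma expR_bound (x : R) : 0 <= x -> x * expR (- x) <= 1.
Proof.
by move=> x0; rewrite expRN ler_pdivrMr ?expR_gt0// mul1r; have := expR_ge1Dx x; lra.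
Qed.

(** For tau >= t / 2 the weight absorbs |k|; for tau < t / 2 the semigroup does, since |k| <=
    |k|^sigma and x exp(- x) <= 1. *)
Lemma kernel_bound t tau k : k != 0 -> 0 < tau -> tau < t ->
  `|k|%:~R * expR (- ((t - tau) * lam sigma k)) / weight sigma tau k <=
  2 / t + 2 * (t / 2) `^ (- sigma^-1).
Proof.
move=> k0 tau0 taut; have t0 : 0 < t by exact: lt_trans taut.
have kp : 0 <= `|k|%:~R :> R by rewrite ler0z.
have l0 := lam_gt0 sigma1 k0.
have E1 : (weight sigma tau k)^-1 <= 1 by rewrite invf_le1 ?weight_gt0// weight_ge1.
have p2 : 0 <= 2 * (t / 2) `^ (- sigma^-1) by rewrite mulr_ge0// powR_ge0.
have [th|th] := leP (t / 2) tau.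
  apply: ler_wpDl; first by rewrite divr_ge0// ltW.
  apply: le_trans (_ : `|k|%:~R / weight sigma tau k <= _).
    rewrite ler_wpM2r ?invr_ge0 ?(ltW (weight_gt0 _ _ _))// ler_piMr// -expR0 ler_expR oppr_le0.
    by rewrite mulr_ge0 ?(ltW l0)// subr_ge0 ltW.
  apply: le_trans (abs_weight_inv k tau0) _; rewrite ler_wpM2l// !powRN.
  rewrite lef_pV2 ?posrE ?powR_gt0 ?divr_gt0//; apply: ge0_ler_powR => //.
  - by rewrite invr_ge0; apply: ltW; exact: lt_trans sigma1.
  - by rewrite nnegrE divr_ge0// ltW.
  - by rewrite nnegrE ltW.
apply: ler_wpDr => //.
apply: le_trans (_ : `|k|%:~R * expR (- ((t - tau) * lam sigma k)) <= _).
  by rewrite ler_piMr// mulr_ge0// expR_ge0.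
apply: le_trans (_ : lam sigma k * expR (- (t / 2 * lam sigma k)) <= _).
  apply: ler_pM; [exact: kp|exact: expR_ge0|exact: lam_ge|].
  rewrite ler_expR lerN2 ler_wpM2r ?(ltW l0)//; lra.
have := @expR_bound (t / 2 * lam sigma k); rewrite mulr_ge0 ?divr_ge0 ?(ltW l0) ?(ltW t0)// => /(_ isT).
by rewrite -mulrA -ler_pdivlMl ?divr_gt0// mulr1 invf_div.
Qed.

End WeightDecay.

(** * The solution as a function of space and time *)

Section Solution.
Variables (R : realType) (a omega sigma : R).
Hypothesis sigma1 : 1 < sigma.
Notation leb := (@lebesgue_measure R).
Notation mu := (circle_measure R).
Notation S := (semigroup_symbol sigma omega).
Variables (w0 : R -> R) (v : R -> int -> R[i]) (Z : int -> R) (B : R).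
Hypotheses (w0L : w0 \in L2) (w0z : zero_mean w0).
Hypotheses (Z0 : forall k, 0 <= Z k) (lZ : l2le Z B).
Hypothesis vZ : tame sigma v Z.
Hypothesis v0 : forall t, 0 < t -> v t 0 = 0.
Hypothesis vJ : forall t, 0 < t -> csym (v t).
Hypothesis veq : forall t k, 0 < t -> v t k = duhamel_map a omega sigma (fourier w0) v t k.
Hypothesis vcont : forall t k, 0 < t ->
  {for t, continuous (fun t => complex.Re (v t k))} /\
  {for t, continuous (fun t => complex.Im (v t k))}.

Let vle t k : 0 < t -> weight sigma t k * cabs (v t k) <= Z k.
Proof. by case: vZ => _; apply. Qed.

Let cvle t k : 0 < t -> cabs (v t k) <= Z k.
Proof. by move=> t0; apply: le_trans (cabs_le_weight sigma t k _) (vle k t0). Qed.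

Let B0 : 0 <= B. Proof. by case: lZ. Qed.

Lemma l2le_v t : 0 < t -> l2le (fun k => cabs (v t k)) B.
Proof. by move=> t0; apply: l2le_le lZ => k; rewrite cabs_ge0 cvle. Qed.

(** For t > 0 the inverse weight is at most a multiple of 1 / |k|, and Cauchy-Schwarz pairs 1 / |k|
    with Z. *)
Lemma v_summable t : 0 < t -> zsummableC (v t).
Proof.
move=> t0; have s : zsummable (fun k => 2 * t `^ (- sigma^-1) * (iv R k * Z k)).
  apply: zsummableZ; apply: (ubsum_zsummable _ (cauchy_schwarz (@iv_ge0 R) Z0 (@l2le_iv R) lZ)).
  by move=> k; rewrite mulr_ge0 ?iv_ge0.
apply: zsummableC_le s => k; have [->|k0] := eqVneq k 0.
  by rewrite v0// cabs0 !mulr_ge0 ?powR_ge0 ?iv_ge0.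
have E0 := weight_gt0 sigma t k.
apply: (@le_trans _ _ ((weight sigma t k)^-1 * Z k)).
  by rewrite mulrC ler_pdivlMr// mulrC vle.
rewrite mulrA ler_wpM2r//; have := abs_weight_inv sigma k t0.
move=> /(ler_wpM2r (iv_ge0 R k)); rewrite mulrAC (mulr_iv _ k0) mul1r//.
Qed.

(** At t = 0 the coefficients are only in l^2 and the series need not converge absolutely, so the
    datum itself is used there. *)
Definition solution (t : R) : R -> R := if t <= 0 then w0 else synth (v t).

Lemma solutionE t : 0 < t -> solution t = synth (v t).
Proof. by rewrite /solution leNgt => ->. Qed.

Lemma solution_L2 t : solution t \in L2.
Proof.
have [t0|t0] := leP t 0; first by rewrite /solution t0.
by rewrite solutionE//; apply: synth_L2; exact: v_summable.
Qed.

Lemma fourier_solution t k : 0 < t -> fourier (solution t) k = v t k.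
Proof. by move=> t0; rewrite solutionE// fourier_synth//; [exact: v_summable|exact: vJ]. Qed.

Lemma solution_zero_mean t : zero_mean (solution t).
Proof.
have [t0|t0] := leP t 0; first by rewrite /solution t0.
by rewrite /zero_mean Rint_fourier0 fourier_solution// v0// mulr0.
Qed.

Let hcoef t k : R[i] := (0 +i* (- (sgz k)%:~R)) * v t k.
Let ucoef t k : R[i] := - ((iv R k)%:C * v t k).

Let hcoef_ok t : 0 < t -> zsummableC (hcoef t) /\ csym (hcoef t).
Proof.
move=> t0; split.
  apply: zsummableC_real_mul; last exact: v_summable.
  by case=> [[|n]|n] /=; rewrite ?oppr0 ?opprK ?normrN ?normr0 ?normr1.
move=> k; rewrite /hcoef vJ// cJM sgzN; congr (_ * _).
by apply: complex_eq; rewrite ?cReJ ?cImJ /= ?rmorphN.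
Qed.

Let ucoef_ok t : 0 < t -> zsummableC (ucoef t) /\ csym (ucoef t).
Proof.
move=> t0; split.
  apply: zsummableC_le (v_summable t0) => k.
  by rewrite cabsN cabsM cabs_real ger0_norm ?iv_ge0// ler_piMl ?cabs_ge0// iv_le1.
move=> k; rewrite /ucoef vJ// ivN; apply: complex_eq; rewrite ?cReJ ?cImJ ?cReN ?cImN ?cReM ?cImM ?cReJ ?cImJ /=; ring.
Qed.

Lemma solution_hilbert t : 0 < t -> is_hilbert (solution t) (synth (hcoef t)).
Proof.
move=> t0; have [sh hJ] := hcoef_ok t0; split; first exact: synth_L2.
by move=> k; rewrite fourier_synth// fourier_solution.
Qed.

Lemma solution_velocity t : 0 < t -> is_velocity (synth (hcoef t)) (synth (ucoef t)).
Proof.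
move=> t0; have [sh hJ] := hcoef_ok t0; have [su uJ] := ucoef_ok t0; split.
- exact: synth_L2.
- by rewrite /zero_mean Rint_fourier0 fourier_synth// /ucoef v0// mulr0 oppr0 mulr0.
- move=> k; rewrite /fourier_dx !fourier_synth// /ucoef /hcoef.
  have -> : 0 +i* (- (sgz k)%:~R) = - ((0 +i* k%:~R) * (iv R k)%:C) :> R[i].
    by apply: complex_eq; rewrite ?cReN ?cImN ?cReM ?cImM /= -?sgz_iv; ring.
  by rewrite mulNr mulrN -mulrA.
Qed.

Lemma solution_nonlinearity t k : 0 < t ->
  nonlinearity a (solution t) (synth (hcoef t)) (synth (ucoef t)) k = Bq a (v t) (v t) k.
Proof.
move=> t0; have fE : fourier (solution t) = v t by apply/funext => j; exact: fourier_solution.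
rewrite (nonlinearity_Bq _ _ (solution_L2 t) _ (solution_hilbert t0) (solution_velocity t0)) fE//.
exact: v_summable.
Qed.

(** For fixed t, [kernel_bound] makes the l^2 norm of the integrand bounded in tau, including near
    tau = 0 and tau = t. *)
Lemma solution_bochner t : 0 < t -> bochner_integrable `]0, t[%classic
  (duhamel_integrand a omega sigma solution (fun t => synth (hcoef t)) (fun t => synth (ucoef t)) t).
Proof.
move=> t0; set F := duhamel_integrand _ _ _ _ _ _ _.
have FE tau k : 0 < tau -> F tau k = if k == 0 then 0 else S (t - tau) k * Bq a (v tau) (v tau) k.
  move=> tau0; rewrite /F /duhamel_integrand /proj0; case: ifP => _; first by rewrite mulr0.
  by rewrite solution_nonlinearity.
split=> [k|].
  have : Cmeas `]0, t[%classic (fun tau => F tau k); last by [].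
  apply: (@Cmeas_eq _ _ (fun tau => if k == 0 then 0 else S (t - tau) k * Bq a (v tau) (v tau) k)).
    by move=> tau /=; rewrite in_itv/= => /andP[tau0 _]; rewrite FE.
  have [_|k0] := eqVneq k 0; first exact: Cmeas_cst.
  apply: Cmeas_mul; first exact: Cmeas_SB.
  exact: (tame_Cmeas_t a vZ lZ).
pose K := 2 * Ba a * (2 / t + 2 * (t / 2) `^ (- sigma^-1)).
have K0 : 0 <= K by rewrite !mulr_ge0 ?Ba_ge0// addr_ge0 ?mulr_ge0 ?powR_ge0// invr_ge0 ltW.
have lQ := l2le_Qconv Z0 Z0 lZ lZ.
have Q0 k := Qconv_ge0 Z0 Z0 lZ lZ k.
apply: (@le_lt_trans _ _ ((K * (4 * (B * B)))%:E * leb `]0%R, t[%classic)%E).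
  apply: integral_le_cst => //; first by apply: (mulr_ge0 K0); rewrite !mulr_ge0.
  move=> tau /=; rewrite in_itv/= => /andP[tau0 taut]; rewrite poweR_ge0/=.
  apply: l2_norm_le; apply: l2le_le (l2leZ K0 lQ) => k; rewrite cabs_ge0/= FE//.
  have [_|k0] := eqVneq k 0; first by rewrite cabs0 mulr_ge0.
  have E0 := weight_gt0 sigma tau k.
  have h := tame_Bq_le a vZ lZ tau0 k0.
  rewrite cabsM cabs_S.
  apply: le_trans (_ : expR (- ((t - tau) * lam sigma k)) *
    ((weight sigma tau k)^-1 * (2 * Ba a * `|k|%:~R * Qconv Z Z k)) <= _).
    by rewrite ler_wpM2l ?expR_ge0// mulrC ler_pdivlMr// mulrC.
  rewrite [leLHS](_ : _ = 2 * Ba a * (`|k|%:~R * expR (- ((t - tau) * lam sigma k)) / weight sigma tau k) * Qconv Z Z k).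
    rewrite ler_wpM2r// /K ler_wpM2l ?mulr_ge0 ?Ba_ge0//; exact: kernel_bound.
  ring.
- by rewrite lebesgue_measure_itv/= lte_fin t0 -EFinB -EFinM ltry.
Qed.

Lemma solution_mild : mild_solution a omega sigma w0 solution.
Proof.
split.
- by move=> t _; exact: solution_zero_mean.
- by rewrite /solution lexx; exact: aeW.
exists (fun t => synth (hcoef t)), (fun t => synth (ucoef t)); split.
  by move=> t t0; split; [exact: solution_hilbert|exact: solution_velocity].
move=> t t0 F; split; first exact: solution_bochner.
move=> k; rewrite fourier_solution// veq// /duhamel_map; have [->|k0] := eqVneq k 0.
  rewrite fourier_at0 w0z mulr0 mulr0 add0r.
  rewrite (@eq_Cint _ _ _ _ (fun=> 0)); last first.
    by move=> tau _; rewrite /F /duhamel_integrand /proj0 /= mulr0.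
  by apply: complex_eq; rewrite /= Rintegral_cst// mul0r.
congr (_ + _); apply: eq_Cint => tau /=; rewrite in_itv/= => /andP[tau0 _].
by rewrite /F /duhamel_integrand /proj0 (negbTE k0) solution_nonlinearity.
Qed.

Lemma solution_L2_norm_le t : 0 < t -> (L2_norm (solution t) <= (Num.sqrt (2 * pi) * B)%:E)%E.
Proof.
move=> t0; rewrite solutionE//; apply: L2_norm_synth_le; [exact: v_summable|exact: vJ|exact: l2le_v].
Qed.

Lemma solution_sobolev_le eta t : 0 < eta -> eta <= 1 -> 0 < t ->
  ((t `^ (eta / sigma))%:E * sobolev_norm eta (solution t) <= (2 * B)%:E)%E.
Proof.
move=> eta0 eta1 t0; set p := t `^ _; have p0 : 0 < p by exact: powR_gt0.
have h : (sobolev_norm eta (solution t) <= (2 / p * B)%:E)%E.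
  apply: poweR_half_le.
  - by apply: esum_ge0 => k _; rewrite lee_fin mulr_ge0 ?powR_ge0// normsqC_ge0.
  - by rewrite mulr_ge0// divr_ge0// ltW.
  have p2 : 0 <= 2 / p by rewrite divr_ge0// ltW.
  have [_ uZ] := l2leZ p2 lZ; apply: esum_ubsum; apply: ubsum_le uZ => k.
  rewrite fourier_solution// -cabs_sqr [2 * eta]mulrC powRrM powR_mulrn ?powR_ge0//.
  rewrite -exprMn lerXn2r ?nnegrE ?mulr_ge0 ?powR_ge0 ?cabs_ge0 ?invr_ge0 ?(ltW p0)//.
  rewrite -(ler_pM2l p0) mulrA [leRHS](_ : _ = 2 * Z k); last by field; rewrite gt_eqF.
  apply: (@le_trans _ _ (2 * weight sigma t k * cabs (v t k))).
    by rewrite ler_wpM2r ?cabs_ge0//; exact: weight_pow.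
  by rewrite -mulrA ler_wpM2l// vle.
apply: le_trans (lee_wpmul2l _ h) _; first by rewrite lee_fin ltW.
by rewrite -EFinM lee_fin [leLHS](_ : _ = 2 * B)//; field; rewrite gt_eqF.
Qed.

(** L^2 continuity at positive times: each coefficient is continuous, the squared differences are
    dominated by 4 Z^2, and Parseval turns the sum into the L^2 norm. *)
Lemma solution_cvg (t : R) (s : nat -> R) : 0 < t -> s n @[n --> \oo] --> t ->
  (fun n => L2_norm (solution (s n) \- solution t)) @ \oo --> 0%E.
Proof.
move=> t0 st.
have spos : \forall n \near \oo, 0 < s n by exact: (cvgr_gt t).
(* The value 0 for the finitely many n with s n <= 0 makes the domination valid for every n. *)
pose F n k := if 0 < s n then normsqC (v (s n) k - v t k) else 0.
have F0 n k : 0 <= F n k <= 4 * Z k ^+ 2.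
  rewrite /F; case: ifPn => sn; last by rewrite lexx mulr_ge0// sqr_ge0.
  rewrite normsqC_ge0/= -cabs_sqr (_ : 4 * _ = (2 * Z k) ^+ 2); last by ring.
  rewrite lerXn2r ?nnegrE ?cabs_ge0 ?mulr_ge0//.
  apply: le_trans (cabsB _ _) _; have := cvle k sn; have := cvle k t0; lra.
have Fcvg k : F ^~ k @ \oo --> 0.
  have [cr ci] := vcont k t0.
  have {}cr : complex.Re (v (s n) k) - complex.Re (v t k) @[n --> \oo] --> complex.Re (v t k) - complex.Re (v t k).
    by apply: cvgB; [exact: (@cvg_comp _ _ _ s _ _ (nbhs t) _ st cr)|exact: cvg_cst].
  have {}ci : complex.Im (v (s n) k) - complex.Im (v t k) @[n --> \oo] --> complex.Im (v t k) - complex.Im (v t k).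
    by apply: cvgB; [exact: (@cvg_comp _ _ _ s _ _ (nbhs t) _ st ci)|exact: cvg_cst].
  have := cvgD (cvgM cr cr) (cvgM ci ci); rewrite !subrr !mulr0 addr0 => h.
  have E : \forall n \near \oo,
      (complex.Re (v (s n) k) - complex.Re (v t k)) * (complex.Re (v (s n) k) - complex.Re (v t k)) +
      (complex.Im (v (s n) k) - complex.Im (v t k)) * (complex.Im (v (s n) k) - complex.Im (v t k)) = F n k.
    apply: filterS spos => n sn.
    by rewrite /F sn /normsqC !cReD !cImD !cReN !cImN !expr2.
  move: h; move/near_eq_cvg: E => E h. exact: cvg_trans E (h _ _ _).
have [_ uZ] := lZ; have uZ4 := ubsumZ (ler0n R 4) uZ.
have bd n e : 0 < s n -> 0 <= e -> ubsum (F n) (e ^+ 2) ->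
    (L2_norm (solution (s n) \- solution t)%R <= (Num.sqrt (2 * pi) * e)%:E)%E.
  move=> sn e0 Fe; rewrite (_ : solution (s n) \- solution t = synth (fun k => v (s n) k - v t k)); last first.
    by apply/funext => x; rewrite /= !solutionE// synthB; [|exact: v_summable..].
  apply: L2_norm_synth_le.
  - by apply: zsummableCD; [exact: v_summable|apply: zsummableCN; exact: v_summable].
  - by move=> k; rewrite vJ// vJ// rmorphB.
  - split => //; apply: ubsum_le Fe => k; by rewrite /F sn cabs_sqr.
apply/fine_cvgP; split.
  near=> n; have sn : 0 < s n by near: n; exact: spos.
  have := L2_norm_sqrt (L2_sub (solution_L2 (s n)) (solution_L2 t)).
  by rewrite -[X in L2_norm X]/(solution (s n) \- solution t) => ->.
apply/cvgrPdist_le => e e0.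
pose c : R := Num.sqrt (2 * pi).
have c0 : 0 < c by rewrite sqrtr_gt0 mulr_gt0// pi_gt0.
near=> n; have sn : 0 < s n by near: n; exact: spos.
have Fe : ubsum (F n) ((e / c) ^+ 2).
  near: n; apply: (ubsum_dominated F0 uZ4 Fcvg); rewrite exprn_gt0// divr_gt0//.
have := bd n (e / c) sn (ltW (divr_gt0 e0 c0)) Fe.
have NE : L2_norm (solution (s n) \- solution t) = (Num.sqrt (\int[mu]_x ((solution (s n) x - solution t x) ^+ 2)))%:E.
  exact: L2_norm_sqrt (L2_sub (solution_L2 (s n)) (solution_L2 t)).
rewrite /= NE lee_fin -/c mulrCA divff ?gt_eqF// mulr1.
by rewrite sub0r normrN (ger0_norm (sqrtr_ge0 _)).
Unshelve. all: by end_near. Qed.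

Definition node n (t : R) : R := (Num.truncn (t * n.+1%:R))%:R / n.+1%:R.

Lemma node_cvg (t : R) : 0 <= t -> node n t @[n --> \oo] --> t.
Proof.
move=> t0; apply/cvgrPdist_le => e e0; near=> n.
have n0 : 0 < n.+1%:R :> R by [].
have /andP[h1 h2] := truncn_itv (mulr_ge0 t0 (ltW n0)).
have ne : n.+1%:R^-1 <= e.
  by apply: ltW; near: n; exact: (near_infty_natSinv_lt (PosNum e0)).
rewrite /node; move: (Num.truncn _) h1 h2 => m; rewrite -[m.+1%:R]natr1.
move: (m%:R) (n.+1%:R) n0 ne => {}m N N0 Ne h1 h2.
rewrite ger0_norm; last by rewrite subr_ge0 ler_pdivrMr.
apply: le_trans Ne; rewrite lerBlDr -{1}[N^-1]mul1r -mulrDl ler_pdivlMr//; lra.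
Unshelve. all: by end_near. Qed.

(** The (n + 1)^2 cells of width 1 / (n + 1) cover [0, n + 1[, so the mesh shrinks while the covered
    range grows. *)
Definition solution_approx n (t x : R) : R :=
  \sum_(j < (n.+1 ^ 2)%N)
    \1_(`[j%:R / n.+1%:R, j.+1%:R / n.+1%:R[%classic) t * solution (j%:R / n.+1%:R) x.

Lemma solution_approxE n t : 0 <= t -> t < n.+1%:R -> solution_approx n t = solution (node n t).
Proof.
move=> t0 tn; apply/funext => x; have n0 : 0 < n.+1%:R :> R by [].
have tn0 : 0 <= t * n.+1%:R by rewrite mulr_ge0.
have lt : (Num.truncn (t * n.+1%:R)%R < n.+1 ^ 2)%N.
  by rewrite truncn_lt_nat// natrX expr2 ltr_pM2r.
rewrite /solution_approx (bigD1 (Ordinal lt))//= big1 ?addr0 => [|j jn].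
  rewrite indicE mem_set ?mul1r//= in_itv/= ler_pdivrMr// ltr_pdivlMr//.
  exact: truncn_itv.
rewrite indicE memNset ?mul0r//= in_itv/= ler_pdivrMr// ltr_pdivlMr// -truncn_eq//.
by move=> /eqP h; move/eqP: jn; apply; apply: val_inj.
Qed.

Lemma solution_strongly_measurable : strongly_measurable solution.
Proof.
exists solution_approx; split.
  move=> n; exists (n.+1 ^ 2)%N, (fun j : 'I_(n.+1 ^ 2) => `[j%:R / n.+1%:R, j.+1%:R / n.+1%:R[%classic),
    (fun j : 'I_(n.+1 ^ 2) => solution (j%:R / n.+1%:R)); split => // i; exact: solution_L2.
apply: aeW => t t0.
have E : \forall n \near \oo, L2_norm (solution (node n t) \- solution t) = L2_norm (solution_approx n t \- solution t).
  near=> n; rewrite solution_approxE//.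
  near: n; have := nbhs_infty_gtr t; apply: filterS => m /lt_trans; apply.
  by rewrite ltr_nat.
(* At t = 0 every node is 0 and the differences vanish; for t > 0 [solution_cvg] applies. *)
apply: cvg_trans (near_eq_cvg E) _; move: t0; rewrite le_eqVlt => /orP[/eqP<-|tp].
  rewrite (_ : (fun n => _) = cst 0%E); first exact: cvg_cst.
  apply/funext => n; rewrite /node mul0r truncn0 mul0r.
  have -> : solution 0 \- solution 0 = cst 0 by apply/funext => x /=; rewrite subrr.
  by rewrite /L2_norm (_ : EFin \o cst 0 = cst 0%E)// Lnorm0// lte_fin.
by apply: solution_cvg => //; apply: node_cvg; exact: ltW.
Unshelve. all: by end_near. Qed.

Lemma solution_in_Xinf eta : 0 < eta -> eta <= 1 -> in_Xinf sigma eta solution.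
Proof.
move=> eta0 eta1; split.
- by move=> t _; exact: solution_L2.
- exact: solution_strongly_measurable.
- apply: (@le_lt_trans _ _ (Num.sqrt (2 * pi) * B)%:E); last exact: ltry.
  by apply: ge_ereal_sup => _ [t t0 <-]; exact: solution_L2_norm_le.
- apply: (@le_lt_trans _ _ (2 * B)%:E); last exact: ltry.
  by apply: ge_ereal_sup => _ [t t0 <-]; exact: solution_sobolev_le.
Qed.

End Solution.

Section SolutionCoefficients.
Variables (R : realType) (a omega sigma eta : R).
Hypothesis eta2 : 2^-1 < eta.
Notation mu := (circle_measure R).

Lemma mild_solution_coef (w0 : R -> R) (w : R -> R -> R) :
  in_Xinf sigma eta w -> mild_solution a omega sigma w0 w ->
  exists M, mild_coef a omega sigma (fourier w0) M (fun t => fourier (w t)).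
Proof.
move=> [wL _ supL supH] [wz _ [h [u [hu duham]]]].
set SL := ereal_sup _ in supL.
have SLle t : 0 < t -> (L2_norm (w t) <= SL)%E.
  by move=> t0; apply: ereal_sup_ubound; exists t.
have SL0 : (0 <= SL)%E by apply: le_trans (SLle 1 ltr01); exact: Lnorm_ge0.
have SLE : SL = (fine SL)%:E by rewrite fineK// ge0_fin_numE.
exists (fine SL).
have sH t : 0 < t -> (sobolev_norm eta (w t) < +oo)%E.
  move=> t0; set p := t `^ (eta / sigma); have p0 : 0 < p by exact: powR_gt0.
  have : (p%:E * sobolev_norm eta (w t) < +oo)%E.
    by apply: le_lt_trans supH; apply: ereal_sup_ubound; exists t.
  rewrite !ltey; apply: contra => /eqP ->; by rewrite gt0_muley ?lte_fin.
have sF t : 0 < t -> zsummableC (fourier (w t)).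
  move=> t0; apply: (sobolev_summable eta2); [exact/wL/ltW|exact/wz/ltW|exact: sH].
have FE t tau k : 0 < tau -> k != 0 -> duhamel_integrand a omega sigma w h u t tau k =
    semigroup_symbol sigma omega (t - tau) k * Bq a (fourier (w tau)) (fourier (w tau)) k.
  move=> tau0 k0; rewrite /duhamel_integrand /proj0 (negbTE k0); congr (_ * _).
  have [hh hv] := hu tau tau0.
  by apply: nonlinearity_Bq => //; [exact/wL/ltW|exact: sF].
split.
- move=> t t0; have wLt := wL t (ltW t0).
  have b := bessel_l2le wLt; split; first by rewrite fine_ge0.
  have [s0 bs] := b; apply: le_ubsum bs _; rewrite lerXn2r ?nnegrE ?fine_ge0//.
  by rewrite -lee_fin -SLE -L2_norm_sqrt//; exact: SLle.
- by move=> t t0; rewrite fourier_at0 wz ?mulr0// ltW.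
- move=> t k t0 k0; have [[mF _] _] := duham t t0.
  apply: Cmeas_eq (mF k) => tau /=; rewrite in_itv/= => /andP[tau0 _]; exact: FE.
- move=> t k t0 k0; have [_ ->] := duham t t0; congr (_ + _).
  by apply: eq_Cint => tau /=; rewrite in_itv/= => /andP[tau0 _]; exact: FE.
Qed.

End SolutionCoefficients.

Lemma fourier_inj_ae (R : realType) (f g : R -> R) : f \in L2 -> g \in L2 ->
  fourier f =1 fourier g -> f = g %[ae circle_measure R].
Proof.
move=> fL gL fg; have If := L2_integrable fL; have Ig := L2_integrable gL.
have N : null_fourier (fun x => f x - g x).
  split; first exact: (integrableB measurableT If Ig).
  by move=> k; rewrite fourierB// fg subrr.
have := null_fourier_ae0 N; apply: filterS; first exact: (ae_filter_ringOfSetsType (circle_measure R)).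
by move=> x h xT; have /eqP := h xT; rewrite subr_eq0 => /eqP.
Qed.

Theorem theorem4p7 (R : realType) (a omega_av sigma : R) (hsigma : 1 < sigma) :
  exists eps : R, 0 < eps /\
    forall w0 : R -> R,
      w0 \in L2 -> zero_mean w0 -> (L2_norm w0 < eps%:E)%E ->
    forall eta : R, 2^-1 < eta -> eta < Num.min 1 (sigma - 2^-1) ->
      exists w : R -> R -> R,
        [/\ in_Xinf sigma eta w,
            mild_solution a omega_av sigma w0 w &
            forall w' : R -> R -> R,
              in_Xinf sigma eta w' -> mild_solution a omega_av sigma w0 w' ->
              forall t : R, 0 <= t -> w' t = w t %[ae circle_measure R]].
Proof.
have Ba1 : 1 <= Ba a by rewrite /Ba lerDl.
have PC0 : 0 < picard_const a.
  by rewrite /picard_const mulr_gt0 ?(lt_le_trans ltr01 Ba1)// mulr_gt0 ?expR_gt0.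
have e0 : 0 < expR 1 :> R := expR_gt0 1.
have q0 : 0 < 16 * picard_const a * expR 1 by apply: mulr_gt0 => //; exact: mulr_gt0.
(* This is the smallness condition of the Picard iteration, with beta the L^2 norm of the datum; it
   is fixed before eta is introduced. *)
exists (16 * picard_const a * expR 1)^-1; split; first by rewrite invr_gt0.
move=> w0 w0L w0z w0eps eta eta2; rewrite lt_min => /andP[eta1 _].
have w0I := L2_integrable w0L.
pose beta := Num.sqrt (\int[circle_measure R]_x (w0 x ^+ 2)).
have c0_beta : l2le (fun k => cabs (fourier w0 k)) beta := bessel_l2le w0L.
have small : 16 * picard_const a * (expR 1 * beta) <= 1.
  move: w0eps; rewrite L2_norm_sqrt// lte_fin -/beta => /ltW.
  by rewrite -[(_)^-1]mul1r ler_pdivlMr// mulrC mulrA.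
have c00 : fourier w0 0 = 0 by rewrite fourier_at0 w0z mulr0.
have c0J k : fourier w0 (- k) = conjc (fourier w0 k) by exact: fourier_conj.
have Pb0 k : 0 <= picard_datum (fourier w0) k by rewrite mulr_ge0 ?expR_ge0 ?cabs_ge0.
have Pbb : l2le (picard_datum (fourier w0)) (expR 1 * beta) by apply: l2leZ => //; exact: expR_ge0.
have Z0 := majorant_lim_ge0 Pb0 (ltW PC0) Pbb small.
have lZ := l2le_majorant_lim Pb0 (ltW PC0) Pbb small.
pose v := picard_lim a omega_av sigma (fourier w0).
have vZ : tame sigma v (majorant_lim (picard_datum (fourier w0)) (picard_const a)) by exact: (picard_lim_tame _ hsigma c00 c0_beta small).
have v0 t : 0 < t -> v t 0 = 0 by move=> t0; exact: (picard_lim0 _ hsigma c00 c0_beta small).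
have vJ t : 0 < t -> csym (v t) by move=> t0 k; exact: (picard_lim_conj _ hsigma c00 c0J c0_beta small).
have vcont t k (t0 : 0 < t) := picard_lim_continuous omega_av hsigma c00 c0_beta small k t0.
have veq t k (t0 : 0 < t) := picard_lim_fixed omega_av hsigma c00 c0_beta small k t0.
have eta0 : 0 < eta by lra.
have wmild : mild_solution a omega_av sigma w0 (solution w0 v) by exact: (solution_mild hsigma w0L w0z Z0 lZ vZ v0 vJ veq).
have wX : in_Xinf sigma eta (solution w0 v) by exact: (solution_in_Xinf w0L Z0 lZ vZ v0 vJ vcont eta0 (ltW eta1)).
exists (solution w0 v); split=> // w' w'X w'mild t; rewrite le_eqVlt => /orP[/eqP<-|t0].
  have [_ w'0 _] := w'mild; have [_ ws0 _] := wmild.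
  move: w'0 ws0; apply: filterS2; first exact: (ae_filter_ringOfSetsType (circle_measure R)).
  by move=> x h1 h2 xT; rewrite h1// h2.
have [M1 m1] := mild_solution_coef eta2 w'X w'mild.
have [M2 m2] := mild_solution_coef eta2 wX wmild.
have [[w'L _ _ _] [wL _ _ _]] := (w'X, wX).
apply: fourier_inj_ae; [exact/w'L/ltW|exact/wL/ltW|move=> k].
(* The uniqueness lemma asks for one common l^2 bound, here the larger of the two. *)
have up M c (w : R -> int -> R[i]) : M <= Num.max M1 M2 -> mild_coef a omega_av sigma c M w ->
    mild_coef a omega_av sigma c (Num.max M1 M2) w.
  by move=> MM [h1 h2 h3 h4]; split => // s s0; apply: l2leW (h1 s s0) _.
apply: (mild_coef_unique hsigma (up _ _ _ _ m1) (up _ _ _ _ m2)) => //.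
  by rewrite le_max lexx.
by rewrite le_max lexx orbT.
Qed.
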